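(* Let $\mathcal P_t=e^{t\mathcal L}$ be a primitive quantum Markov semigroup satisfying the $\sigma$-GNS detailed balance condition for its full-rank invariant state $\sigma$, and let $p\in(1,2]$. If the transport cost inequality $$W_{2,p}(\rho,\sigma)\le\sqrt{c\,\mathcal F_{p,\sigma}(\rho)}\qquad\text{for all }\rho\in\mathcal D(\mathcal H)$$ holds with constant $c>0$, then the Poincaré inequality $$\lambda\,\|X-\mathrm{Tr}(\sigma X)\mathbf 1\|_{\sigma,\varphi_p}^2\le-\langle X,\mathcal LX\rangle_{\sigma,\varphi_p}\qquad\text{for all }X\in\mathcal B(\mathcal H)$$ holds with a constant $\lambda\ge2/c$.
   Context: $\mathcal H$ is a Hilbert space of finite dimension $d$; $\mathcal D(\mathcal H)$, $\mathcal D_+(\mathcal H)$ are the density operators and the full-rank ones; $\dagger$ is the adjoint for $\langle X,Y\rangle=\mathrm{Tr}(X^*Y)$. A quantum Markov semigroup is a $C_0$-semigroup of completely positive unital maps on $\mathcal B(\mathcal H)$ with generator $\mathcal L$; primitive means there is a unique invariant state $\sigma$ ($\mathcal P_t^\dagger(\sigma)=\sigma$) and it is full rank; $\sigma$-GNS detailed balance means $\mathcal L$ is self-adjoint for $\mathrm{Tr}(\sigma X^*Y)$. By Alicki's theorem one can write (and a choice is fixed) $$\mathcal L(X)=\sum_{j=1}^J\big(e^{-\omega_j/2}V_j^*[X,V_j]+e^{\omega_j/2}[V_j,X]V_j^*\big),$$ with $\omega_j\in\mathbb R$, $\sigma V_j\sigma^{-1}=e^{-\omega_j}V_j$, $\mathrm{Tr}(V_j)=0$,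 $\langle V_j,V_k\rangle=c_j\delta_{jk}$, $c_j>0$, and for each $j$ an index $j'$ with $V_j^*=V_{j'}$, $\omega_{j'}=-\omega_j$. Let $\partial_jX=[V_j,X]$, so $\partial_j^\dagger Y=[V_j^*,Y]$. Let $\Gamma_\sigma^s(X)=\sigma^{s/2}X\sigma^{s/2}$, $\hat p=p/(p-1)$, $\|X\|_{p,\sigma}=\mathrm{Tr}(|\Gamma_\sigma^{1/p}(X)|^p)^{1/p}$, $\mathcal F_{p,\sigma}(\rho)=\frac1{p(p-1)}\big(\|\Gamma_\sigma^{-1}(\rho)\|_{p,\sigma}^p-1\big)$. For $x,y>0$ let $\theta_p(x,y)=(p-1)\frac{x-y}{x^{p-1}-y^{p-1}}$ if $x\ne y$ and $\theta_p(x,x)=x^{2-p}$. For self-adjoint $A=\sum_i\lambda_iA_i$, $B=\sum_k\mu_kB_k$ (spectral decompositions), $f(A,B)(X)=\sum_{i,k}f(\lambda_i,\mu_k)A_iXB_k$. For $\rho\in\mathcal D_+(\mathcal H)$, $\omega\in\mathbb R$, $$[\rho]_{p,\omega}=\Gamma_\sigma^{1/\hat p}\circ\theta_p\big(e^{\omega/2p}\Gamma_\sigma^{-1/\hat p}(\rho),\,e^{-\omega/2p}\Gamma_\sigma^{-1/\hat p}(\rho)\big)\circ\Gamma_\sigma^{1/\hat p},\qquad \mathfrak D_{p,\rho}(A)=\sum_{j=1}^J\partial_j^\dagger\big([\rho]_{p,\omega_j}\partial_jA\big).$$ On $T_\rho=\mathcal B^0_{sa}(\mathcal H)$ (traceless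 self-adjoint operators), the tangent space of $\mathcal D_+(\mathcal H)$ at $\rho$, $\mathfrak D_{p,\rho}$ is positive definite and $g_{p,\rho}(\nu_1,\nu_2)=\langle\mathfrak D_{p,\rho}^{-1}(\nu_1),\nu_2\rangle$ is a Riemannian metric. $W_{2,p}$ is its Riemannian distance: $W_{2,p}(\rho_0,\rho_1)^2=\inf\int_0^1g_{p,\gamma(s)}(\dot\gamma(s),\dot\gamma(s))\,ds$ over smooth curves $\gamma:[0,1]\to\mathcal D_+(\mathcal H)$ from $\rho_0$ to $\rho_1$; it extends continuously to $\mathcal D(\mathcal H)$, the extension being denoted the same. For $x>0$, $\varphi_p(x)=\frac1{p-1}\frac{x-x^{1/p}}{x^{1/p}-1}$ (extended continuously at $x=1$, $\varphi_p(1)=1$). With $\Delta_\sigma(X)=\sigma X\sigma^{-1}$ and $R_\sigma(X)=X\sigma$ put $\langle X,Y\rangle_{\sigma,\varphi_p}=\langle X,R_\sigma\varphi_p(\Delta_\sigma)(Y)\rangle$ and $\|X\|_{\sigma,\varphi_p}^2=\langle X,X\rangle_{\sigma,\varphi_p}$. *)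

(* Defs.v *)
From HB Require Import structures.
From mathcomp Require Import all_boot all_order all_algebra complex.
From mathcomp Require Import all_classical all_reals all_analysis.

Set Implicit Arguments.
Unset Strict Implicit.
Unset Printing Implicit Defensive.

Import Order.TTheory GRing.Theory Num.Theory.
Import numFieldNormedType.Exports.

Local Open Scope classical_set_scope.
Local Open Scope ring_scope.
Local Open Scope complex_scope.
Local Open Scope sesquilinear_scope.

(* B(H) is 'M[R[i]]_d, with X^t* (conjugate transpose) for the adjoint X^*. *)

Section Matrices.
Variable R : realType.

Definition psdmx n (A : 'M[R[i]]_n) : Prop :=
  A \is hermsymmx /\ forall v : 'cV[R[i]]_n, 0 <= (v^t* *m A *m v) 0 0.

Definition density n (rho : 'M[R[i]]_n) : Prop := psdmx rho /\ \tr rho = 1.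

Definition full_density n (rho : 'M[R[i]]_n) : Prop :=
  density rho /\ \rank rho = n.

Definition hs m n (X Y : 'M[R[i]]_(m, n)) : R[i] := \tr (X^t* *m Y).

(* The adjoint of a linear map for [hs], given by its matrix entries
   (Phi^dagger Y)_ij = <E_ij, Phi^dagger Y> = <Phi E_ij, Y>; see [hsadjP]. *)
Definition hsadj n (Phi : 'M[R[i]]_n -> 'M[R[i]]_n) (Y : 'M[R[i]]_n) :
    'M[R[i]]_n :=
  \matrix_(i, j) hs (Phi (delta_mx i j)) Y.

Definition comm n (A X : 'M[R[i]]_n) : 'M[R[i]]_n := A *m X - X *m A.

(* 'M[R[i]]_n carries no topology in the library: convergence is convergence
   of the real and imaginary parts of all entries. *)
Definition mxcvg T (F : set_system T) n (f : T -> 'M[R[i]]_n) (A : 'M[R[i]]_n) :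
    Prop :=
  forall i j, complex.Re (f t i j) @[t --> F] --> complex.Re (A i j) /\
              complex.Im (f t i j) @[t --> F] --> complex.Im (A i j).

(* Rank-one orthogonal projections onto an orthonormal eigenbasis of a normal
   matrix A (the rows of [spectralmx A] are the adjoints of the eigenvectors),
   so that A = \sum_i spectral_diag A 0 i *: eproj A i. Eigenvalues are
   repeated with multiplicity. *)
Definition eproj n (A : 'M[R[i]]_n) (i : 'I_n) : 'M[R[i]]_n :=
  (row i (spectralmx A))^t* *m row i (spectralmx A).

Definition eigval n (A : 'M[R[i]]_n) (i : 'I_n) : R :=
  complex.Re (spectral_diag A 0 i).

(* f(A) for self-adjoint A. *)
Definition mxfun (f : R -> R) n (A : 'M[R[i]]_n) : 'M[R[i]]_n :=
  \sum_i (f (eigval A i))%:C *: eproj A i.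

(* f(A, B)(X) for self-adjoint A and B. *)
Definition mxfun2 (f : R -> R -> R) n (A B X : 'M[R[i]]_n) : 'M[R[i]]_n :=
  \sum_i \sum_k (f (eigval A i) (eigval B k))%:C *: (eproj A i *m X *m eproj B k).

(* f(Phi)(X) for a linear map Phi on matrices, self-adjoint for [hs]: [mxvec]
   identifies ('M_n, hs) isometrically with row vectors, on which Phi acts by
   right multiplication by [lin_mx Phi]. *)
Definition sofun (f : R -> R) n (Phi : 'M[R[i]]_n -> 'M[R[i]]_n)
    (X : 'M[R[i]]_n) : 'M[R[i]]_n :=
  vec_mx (mxvec X *m mxfun f (lin_mx Phi)).

Definition mxpow n (A : 'M[R[i]]_n) (s : R) : 'M[R[i]]_n :=
  mxfun (fun x => x `^ s) A.

Definition mxabs n (X : 'M[R[i]]_n) : 'M[R[i]]_n :=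
  mxfun Num.sqrt (X^t* *m X).

Lemma spectralE n (A : 'M[R[i]]_n) : A \is hermsymmx ->
  A = \sum_i (eigval A i)%:C *: eproj A i.
Proof.
move=> hA; have nA := hermitian_normalmx hA.
have rA := hermitian_spectral_diag_real hA.
rewrite [LHS](orthomx_spectralP nA) (invmx_unitary (spectral_unitarymx A)).
apply/matrixP => i j; rewrite summxE mxE; apply: eq_bigr => k _.
rewrite mul_mx_diag !mxE big_ord1 !mxE.
have -> : (eigval A k)%:C = spectral_diag A 0 k.
  by apply: RRe_real; have /mxOverP := rA; apply.
by rewrite mulrAC mulrC mulrA.
Qed.

Lemma hsadjP n (Phi : {linear 'M[R[i]]_n -> 'M[R[i]]_n}) X Y :
  hs (Phi X) Y = hs X (hsadj Phi Y).
Proof.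
have hsE m1 m2 (A B : 'M[R[i]]_(m1, m2)) :
    hs A B = \sum_i \sum_j (A i j)^*%R * B i j.
  rewrite /hs /mxtrace exchange_big; apply: eq_bigr => j _.
  by rewrite mxE; apply: eq_bigr => i _; rewrite !mxE.
have hsC m1 m2 (A B : 'M[R[i]]_(m1, m2)) : hs A B = (hs B A)^*%R.
  rewrite !hsE rmorph_sum; apply: eq_bigr => i _.
  rewrite rmorph_sum; apply: eq_bigr => j _.
  by rewrite rmorphM /= conjCK mulrC.
rewrite hsC [in LHS](matrix_sum_delta X) [RHS]hsE.
rewrite (raddf_sum Phi) /hs mulmx_sumr.
rewrite (raddf_sum (@mxtrace R[i] n)) (rmorph_sum Num.conj).
apply: eq_bigr => i _ /=.
rewrite (raddf_sum Phi) mulmx_sumr.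
rewrite (raddf_sum (@mxtrace R[i] n)) (rmorph_sum Num.conj).
apply: eq_bigr => j _ /=.
rewrite linearZ /= -scalemxAr mxtraceZ rmorphM /= mxE; congr (_ * _).
by rewrite -[LHS]/((hs _ _)^*%R) -hsC.
Qed.

End Matrices.

Section QuantumMarkovSemigroups.
Variables (R : realType) (d : nat).
Implicit Types (P : R -> {linear 'M[R[i]]_d -> 'M[R[i]]_d})
  (L : {linear 'M[R[i]]_d -> 'M[R[i]]_d}) (sigma rho X Y : 'M[R[i]]_d).

(* All the ampliations of Phi to n x n block matrices are positive. *)
Definition completely_positive (Phi : 'M[R[i]]_d -> 'M[R[i]]_d) : Prop :=
  forall n (B : 'I_n -> 'I_n -> 'M[R[i]]_d),
    psdmx (\mxblock_(k < n, l < n) B k l) ->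
    psdmx (\mxblock_(k < n, l < n) Phi (B k l)).

(* Only the values of P at nonnegative times are meaningful. *)
Record is_qms P : Prop := IsQMS {
  qms0 : forall X, P 0 X = X;
  qmsD : forall s t, 0 <= s -> 0 <= t -> forall X, P (s + t) X = P s (P t X);
  qms_C0 : forall X, mxcvg 0^'+ (fun t => P t X) X;
  qms_cp : forall t, 0 <= t -> completely_positive (P t);
  qms_unital : forall t, 0 <= t -> P t 1%:M = 1%:M }.

Definition is_generator P L : Prop :=
  forall X, mxcvg 0^'+ (fun t => (t^-1)%:C *: (P t X - X)) (L X).

Definition invariant_state P rho : Prop :=
  density rho /\ forall t, 0 <= t -> hsadj (P t) rho = rho.

Definition primitive P sigma : Prop :=
  [/\ invariant_state P sigma,
      forall rho, invariant_state P rho -> rho = sigma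
    & \rank sigma = d].

Definition gns_detailed_balance L sigma : Prop :=
  forall X Y, \tr (sigma *m (L X)^t* *m Y) = \tr (sigma *m X^t* *m L Y).

Record alicki L sigma (J : nat) (V : 'I_J -> 'M[R[i]]_d) (omega : 'I_J -> R) :
    Prop := Alicki {
  alickiE : forall X, L X = \sum_j
    ((expR (- omega j / 2))%:C *: ((V j)^t* *m comm X (V j)) +
     (expR (omega j / 2))%:C *: (comm (V j) X *m (V j)^t*));
  alicki_modular : forall j,
    sigma *m V j *m invmx sigma = (expR (- omega j))%:C *: V j;
  alicki_trace : forall j, \tr (V j) = 0;
  alicki_orth : exists2 a : 'I_J -> R, (forall j, 0 < a j) &
    forall j k, hs (V j) (V k) = if j == k then (a j)%:C else 0;
  alicki_adj : forall j, exists2 j', (V j)^t* = V j' & omega j' = - omega j }.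

End QuantumMarkovSemigroups.

Section TransportMetric.
Variables (R : realType) (d : nat) (p : R) (sigma : 'M[R[i]]_d).
Variables (J : nat) (V : 'I_J -> 'M[R[i]]_d) (omega : 'I_J -> R).
Implicit Types (rho nu A X Y : 'M[R[i]]_d).

Definition hatp : R := p / (p - 1).

Definition Gam (s : R) X : 'M[R[i]]_d :=
  mxpow sigma (s / 2) *m X *m mxpow sigma (s / 2).

Definition pnorm X : R :=
  complex.Re (\tr (mxpow (mxabs (Gam p^-1 X)) p)) `^ p^-1.

Definition Fp rho : R := (p * (p - 1))^-1 * (pnorm (Gam (-1) rho) `^ p - 1).

Definition theta (x y : R) : R :=
  if x == y then x `^ (2 - p)
  else (p - 1) * ((x - y) / (x `^ (p - 1) - y `^ (p - 1))).

(* The operator [rho]_{p,w}. *)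
Definition brac rho (w : R) X : 'M[R[i]]_d :=
  let B := Gam (- hatp^-1) rho in
  Gam hatp^-1
    (mxfun2 theta ((expR (w / (2 * p)))%:C *: B)
                  ((expR (- w / (2 * p)))%:C *: B) (Gam hatp^-1 X)).

Definition Dop rho A : 'M[R[i]]_d :=
  \sum_j hsadj (comm (V j)) (brac rho (omega j) (comm (V j) A)).

(* T_rho, for every full-rank density rho. *)
Definition tangent : set 'M[R[i]]_d := [set A | A \is hermsymmx /\ \tr A = 0].

(* The inverse of [Dop rho] as a linear bijection of [tangent]. *)
Definition Dinv rho nu : 'M[R[i]]_d :=
  xget 0 [set A | tangent A /\ Dop rho A = nu].

(* [hs] is real on pairs of self-adjoint matrices. *)
Definition gmet rho nu1 nu2 : R := complex.Re (hs (Dinv rho nu1) nu2).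

Definition re_entry (gamma : R -> 'M[R[i]]_d) i j (s : R) : R :=
  complex.Re (gamma s i j).

Definition im_entry (gamma : R -> 'M[R[i]]_d) i j (s : R) : R :=
  complex.Im (gamma s i j).

Definition velocity (gamma : R -> 'M[R[i]]_d) (s : R) : 'M[R[i]]_d :=
  \matrix_(i, j) (derive1 (re_entry gamma i j) s +i*
                    derive1 (im_entry gamma i j) s).

(* Smoothness on the closed interval [0, 1] is C^oo on an open neighbourhood;
   values in the full-rank densities are only required on [0, 1]. *)
Definition smooth01 (gamma : R -> 'M[R[i]]_d) : Prop :=
  exists2 e : R, 0 < e & forall n i j t, - e < t < 1 + e ->
    derivable (derive1n n (re_entry gamma i j)) t 1 /\
    derivable (derive1n n (im_entry gamma i j)) t 1.

Definition curve rho0 rho1 (gamma : R -> 'M[R[i]]_d) : Prop :=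
  [/\ smooth01 gamma, forall s, 0 <= s <= 1 -> full_density (gamma s),
      gamma 0 = rho0 & gamma 1 = rho1].

Definition energy (gamma : R -> 'M[R[i]]_d) : \bar R :=
  (\int[lebesgue_measure]_(s in `[0%R, 1%R])
     (gmet (gamma s) (velocity gamma s) (velocity gamma s))%:E)%E.

Definition rdist rho0 rho1 : \bar R :=
  sqrte (ereal_inf (energy @` [set gamma | curve rho0 rho1 gamma])).

(* The transport distance on all densities: [rdist] between full-rank
   densities, and its continuous extension otherwise, that is, the common limit
   of [rdist (u n) (v n)] over all sequences u, v of full-rank densities
   converging to rho0 and rho1. *)
Definition W2 rho0 rho1 : \bar R :=
  if `[< full_density rho0 /\ full_density rho1 >] then rdist rho0 rho1
  else xget 0%E [set l : \bar R | forall u v : nat -> 'M[R[i]]_d,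
    (forall n, full_density (u n)) -> (forall n, full_density (v n)) ->
    mxcvg \oo u rho0 -> mxcvg \oo v rho1 ->
    rdist (u n) (v n) @[n --> \oo] --> l].

Definition phi (x : R) : R :=
  if x == 1 then 1 else (p - 1)^-1 * ((x - x `^ p^-1) / (x `^ p^-1 - 1)).

Definition Delta X : 'M[R[i]]_d := sigma *m X *m invmx sigma.

Definition inner_phi X Y : R[i] := hs X (sofun phi Delta Y *m sigma).

Definition sqnorm_phi X : R[i] := inner_phi X X.

End TransportMetric.

Lemma hsadj_comm (R : realType) d (A Y : 'M[R[i]]_d) :
  hsadj (comm A) Y = comm (A^t*) Y.
Proof.
apply/matrixP => i j; rewrite [LHS]mxE /hs /comm.
have trE (Z : 'M[R[i]]_d) : \tr (delta_mx j i *m Z) = Z i j.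
  rewrite -[delta_mx j i](mul_delta_mx (0 : 'I_1)) -mulmxA mxtrace_mulC.
  by rewrite -rowE -colE /mxtrace big_ord1 !mxE.
have dC : (delta_mx i j : 'M[R[i]]_d)^t* = delta_mx j i.
  by rewrite trmx_delta map_delta_mx.
have tC m n q (B : 'M[R[i]]_(m, n)) (C : 'M[R[i]]_(n, q)) :
    (B *m C)^t* = C^t* *m B^t*.
  by rewrite trmx_mul map_mxM.
have tB m n (B C : 'M[R[i]]_(m, n)) : (B - C)^t* = B^t* - C^t*.
  by apply/matrixP => k l; rewrite !mxE rmorphB.
rewrite tB !tC dC mulmxBl raddfB /=.
rewrite -(mulmxA (delta_mx j i)) trE (mxtrace_mulC _ Y) mulmxA mxtrace_mulC trE.
by rewrite !mxE.
Qed.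

(* Main.v *)
Require Import Defs.
From HB Require Import structures.
From mathcomp Require Import all_boot all_order all_algebra complex.
From mathcomp Require Import all_classical all_reals all_analysis.
From mathcomp Require Import ring lra.

Set Implicit Arguments.
Unset Strict Implicit.
Unset Printing Implicit Defensive.

Import Order.TTheory GRing.Theory Num.Theory.
Import numFieldNormedType.Exports.

Local Open Scope classical_set_scope.
Local Open Scope ring_scope.
Local Open Scope complex_scope.
Local Open Scope sesquilinear_scope.

(** The transport inequality is linearized at the invariant state [sigma].

    For a Hermitian [X] with [\tr (sigma *m X) = 0], put
    [nu = Gam sigma 1 X] and move from [sigma] to the density
    [sigma + e nu]. To second order in [e] the entropy is half of the square
    of the norm of [X] for the inner product defined by [phi] ([Fp_expand]),
    and the squared distance is the metric at [sigma] applied to [nu].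
    The transport inequality thus bounds the metric at [sigma] by [c / 2] times
    that squared norm. The metric is the inverse of the form of
    [Dop p sigma V omega sigma]. Through the dual variable
    [dualA sigma p X] this operator is the generator: it sends the dual
    variable of [X] to [- Gam sigma 1 (L X)] ([Dop_dualA_generator]), while
    [nu] paired with that dual variable gives back the squared norm of [X].
    Passing to the inverse form turns the bound on the metric into the
    Poincare inequality with constant [2 / c] ([poincare_herm]).

    Entropy. The expansion of the trace of a power is exact when written over
    pairs of eigenvalues of the two matrices, with the scalar Taylor remainder
    as a kernel ([trace_taylor], [Fp_taylor]). Only the continuity of the double
    functional calculus [mxfun2] is then needed, which follows from the fact that
    eigenspaces of nearby matrices overlap little unless their eigenvalues are
    close ([resol_overlap], [mxfun2_cont]).

    Distance. Geodesics are avoided by duality. The metric is a Legendre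
    transform ([gmet_ge]), so that a fixed test matrix bounds the energy of
    any curve below ([energy_ge]). The test matrix close to the dual variable of
    [X] gives the sharp constant, provided that the metric operator is close to
    its value at [sigma] along the curve ([Dop_cont]). This holds since a uniform
    bound on that operator over all densities ([Dop_bound]) keeps curves of
    small energy near their starting point ([energy_displacement]).

    The metric is defined through a solution of a linear equation, which exists
    by primitivity: a Hermitian matrix in the kernel of the metric operator
    commutes with all [V j], hence perturbs [sigma] into invariant states
    ([generator_invariant], [commutant_herm], [Dop_surj]).

    All operators at [sigma] are Schur multipliers in an eigenbasis of
    [sigma], and a modular matrix shifts their weights ([schur_mull],
    [schur_mulr]); the identities above reduce to identities between weights
    ([brac_wt_mull], [phi_theta], [taylor2_sym]). Matrices that are not Hermitian
    are split into Hermitian and anti-Hermitian parts, on which the forms of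
    both sides add up ([form_cartesian]). *)

(** * Adjoints and the Hilbert-Schmidt pairing *)

Section Adjoint.
Variable R : realType.

Lemma conjR (a : R) : (a%:C)^*%R = a%:C.
Proof. by apply/CrealP/complex_realP; exists a. Qed.

Lemma adjM m n q (A : 'M[R[i]]_(m, n)) (B : 'M[R[i]]_(n, q)) :
  (A *m B)^t* = B^t* *m A^t*.
Proof. by rewrite trmx_mul map_mxM. Qed.

Lemma adjD m n (A B : 'M[R[i]]_(m, n)) : (A + B)^t* = A^t* + B^t*.
Proof. by rewrite linearD map_mxD. Qed.

Lemma adjB m n (A B : 'M[R[i]]_(m, n)) : (A - B)^t* = A^t* - B^t*.
Proof. by rewrite linearB map_mxB. Qed.

Lemma adjZ m n (a : R) (A : 'M[R[i]]_(m, n)) : (a%:C *: A)^t* = a%:C *: A^t*.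
Proof. by apply/matrixP => i j; rewrite !mxE rmorphM /= conjR. Qed.

Lemma adj_sum m n I (r : seq I) (P : pred I) (F : I -> 'M[R[i]]_(m, n)) :
  (\sum_(i <- r | P i) F i)^t* = \sum_(i <- r | P i) (F i)^t*.
Proof. by rewrite linear_sum map_mx_sum. Qed.

Lemma adj1 n : (1%:M : 'M[R[i]]_n)^t* = 1%:M.
Proof. by rewrite trmx1 map_mx1. Qed.

Lemma hermP n (A : 'M[R[i]]_n) : A \is hermsymmx <-> A^t* = A.
Proof.
split; first by move/is_hermitianmxP; rewrite expr0 scale1r => {2}->.
by move=> hA; apply/is_hermitianmxP; rewrite expr0 scale1r hA.
Qed.

Lemma hsDr m n (X Y Z : 'M[R[i]]_(m, n)) : hs X (Y + Z) = hs X Y + hs X Z.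
Proof. by rewrite /hs mulmxDr mxtraceD. Qed.

Lemma hsDl m n (X Y Z : 'M[R[i]]_(m, n)) : hs (X + Y) Z = hs X Z + hs Y Z.
Proof. by rewrite /hs adjD mulmxDl mxtraceD. Qed.

Lemma hsBr m n (X Y Z : 'M[R[i]]_(m, n)) : hs X (Y - Z) = hs X Y - hs X Z.
Proof. by rewrite /hs mulmxBr raddfB. Qed.

Lemma hsBl m n (X Y Z : 'M[R[i]]_(m, n)) : hs (X - Y) Z = hs X Z - hs Y Z.
Proof. by rewrite /hs adjB mulmxBl raddfB. Qed.

Lemma hsZr m n a (X Y : 'M[R[i]]_(m, n)) : hs X (a *: Y) = a * hs X Y.
Proof. by rewrite /hs -scalemxAr mxtraceZ. Qed.

Lemma hsZl m n (a : R) (X Y : 'M[R[i]]_(m, n)) : hs (a%:C *: X) Y = a%:C * hs X Y.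
Proof. by rewrite /hs adjZ -scalemxAl mxtraceZ. Qed.

Lemma hsNl m n (X Y : 'M[R[i]]_(m, n)) : hs (- X) Y = - hs X Y.
Proof.
rewrite -[- X]sub0r hsBl [X in X - _](_ : _ = 0) ?sub0r//.
by rewrite /hs trmx0 map_mx0 mul0mx mxtrace0.
Qed.

Lemma hsNr m n (X Y : 'M[R[i]]_(m, n)) : hs X (- Y) = - hs X Y.
Proof. by rewrite -scaleN1r hsZr mulN1r. Qed.

Lemma tr_sum (I : finType) n (F : I -> 'M[R[i]]_n) : \tr (\sum_i F i) = \sum_i \tr (F i).
Proof. exact: (raddf_sum (@mxtrace R[i] n)). Qed.

Lemma hs_sumr m n I (r : seq I) (P : pred I) X (F : I -> 'M[R[i]]_(m, n)) :
  hs X (\sum_(i <- r | P i) F i) = \sum_(i <- r | P i) hs X (F i).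
Proof. by rewrite /hs mulmx_sumr raddf_sum. Qed.

Lemma hs_suml m n I (r : seq I) (P : pred I) X (F : I -> 'M[R[i]]_(m, n)) :
  hs (\sum_(i <- r | P i) F i) X = \sum_(i <- r | P i) hs (F i) X.
Proof. by rewrite /hs adj_sum mulmx_suml raddf_sum. Qed.

Lemma hsE m n (A B : 'M[R[i]]_(m, n)) :
  hs A B = \sum_i \sum_j (A i j)^*%R * B i j.
Proof.
rewrite /hs /mxtrace exchange_big; apply: eq_bigr => j _.
by rewrite mxE; apply: eq_bigr => i _; rewrite !mxE.
Qed.

Lemma hsC m n (A B : 'M[R[i]]_(m, n)) : hs A B = (hs B A)^*%R.
Proof.
rewrite !hsE rmorph_sum; apply: eq_bigr => i _.
rewrite rmorph_sum; apply: eq_bigr => j _.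
by rewrite rmorphM /= conjCK mulrC.
Qed.

Lemma hs_adj n (A B : 'M[R[i]]_n) : hs (A^t*) (B^t*) = hs B A.
Proof. by rewrite /hs trmxCK mxtrace_mulC. Qed.

Lemma hs_mull n (A X Y : 'M[R[i]]_n) : hs (A *m X) Y = hs X (A^t* *m Y).
Proof. by rewrite /hs adjM mulmxA. Qed.

Lemma hs_mulr n (A X Y : 'M[R[i]]_n) : hs (X *m A) Y = hs X (Y *m A^t*).
Proof. by rewrite /hs adjM -mulmxA mxtrace_mulC mulmxA. Qed.

(** This makes the final inequality, stated in the partially ordered field
    [R[i]], one between real numbers. *)
Lemma hs_herm_real n (A B : 'M[R[i]]_n) : A^t* = A -> B^t* = B ->
  hs A B = (complex.Re (hs A B))%:C.
Proof.
move=> hA hB; apply/esym/RRe_real/CrealP.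
by rewrite -hsC -[in LHS]hA -[in LHS]hB hs_adj.
Qed.

Lemma hs_ge0 m n (A : 'M[R[i]]_(m, n)) : 0 <= hs A A.
Proof.
rewrite hsE; apply: sumr_ge0 => i _; apply: sumr_ge0 => j _.
by rewrite mulrC mul_conjC_ge0.
Qed.

Lemma hs_eq0 m n (A : 'M[R[i]]_(m, n)) : hs A A = 0 -> A = 0.
Proof.
have ge0 i j : 0 <= (A i j)^*%R * A i j by rewrite mulrC mul_conjC_ge0.
rewrite hsE => /eqP; rewrite psumr_eq0 => [/allP h|i _]; last exact: sumr_ge0.
apply/matrixP => i j; have := h i (mem_index_enum _); rewrite psumr_eq0 //.
move=> /allP/(_ j (mem_index_enum _)); rewrite mulrC mul_conjC_eq0 => /eqP ->.
by rewrite mxE.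
Qed.

Lemma hs_comm n (A X Y : 'M[R[i]]_n) : hs (comm A X) Y = hs X (comm (A^t*) Y).
Proof. by rewrite /comm hsBl hsBr hs_mull hs_mulr. Qed.

Lemma hs_nondegr n (A B : 'M[R[i]]_n) : (forall X, hs X A = hs X B) -> A = B.
Proof. by move=> h; apply/subr0_eq/hs_eq0; rewrite hsBr h subrr. Qed.

End Adjoint.

Section EntrySumNorm.
Variable R : realType.
Import Normc.

Lemma normc_ge0 (z : R[i]) : 0 <= normc z.
Proof. by case: z => a b; rewrite sqrtr_ge0. Qed.

Lemma normc_real (a : R) : normc (a%:C) = `|a|.
Proof. by rewrite /normc /= expr0n addr0 sqrtr_sqr. Qed.

Lemma normc_le_normr (z : R[i]) (a : R) : `|z| <= a%:C -> normc z <= a.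
Proof. by rewrite normc_def lecR; case: z. Qed.

Lemma Re_le_normc (z : R[i]) : `|complex.Re z| <= normc z.
Proof. by have := normc_ge_Re z; rewrite normc_def lecR; case: z. Qed.

Lemma normc_sqr (z : R[i]) : normc z ^+ 2 = complex.Re z ^+ 2 + complex.Im z ^+ 2.
Proof. by case: z => a b; rewrite /normc sqr_sqrtr ?addr_ge0 ?sqr_ge0. Qed.

(** This norm is chosen for perturbation estimates because it is
    submultiplicative by the triangle inequality alone. *)
Definition N1 m n (A : 'M[R[i]]_(m, n)) : R := \sum_i \sum_j normc (A i j).

Lemma N1_ge0 m n (A : 'M[R[i]]_(m, n)) : 0 <= N1 A.
Proof. by do 2!(apply: sumr_ge0 => ? _); apply: normc_ge0. Qed.

Lemma N1D m n (A B : 'M[R[i]]_(m, n)) : N1 (A + B) <= N1 A + N1 B.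
Proof.
rewrite /N1 -big_split /=; apply: ler_sum => i _.
rewrite -big_split /=; apply: ler_sum => j _; rewrite mxE; exact: le_normcD.
Qed.

Lemma N1Z m n a (A : 'M[R[i]]_(m, n)) : N1 (a *: A) = normc a * N1 A.
Proof.
rewrite /N1 mulr_sumr; apply: eq_bigr => i _; rewrite mulr_sumr.
by apply: eq_bigr => j _; rewrite mxE normcM.
Qed.

Lemma N10 m n : N1 (0 : 'M[R[i]]_(m, n)) = 0.
Proof.
rewrite /N1 big1// => i _; rewrite big1// => j _.
by rewrite mxE; exact: normc0.
Qed.

Lemma N1N m n (A : 'M[R[i]]_(m, n)) : N1 (- A) = N1 A.
Proof.
rewrite /N1; apply: eq_bigr => i _; apply: eq_bigr => j _.
by rewrite mxE (@normcN R).
Qed.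

Lemma N1_sum m n I (r : seq I) (P : pred I) (F : I -> 'M[R[i]]_(m, n)) :
  N1 (\sum_(i <- r | P i) F i) <= \sum_(i <- r | P i) N1 (F i).
Proof.
elim/big_ind2 : _ => [|A a B b hA hB|//]; first by rewrite N10.
by rewrite (le_trans (N1D _ _))// lerD.
Qed.

Lemma normc_sum I (r : seq I) (P : pred I) (F : I -> R[i]) :
  normc (\sum_(i <- r | P i) F i) <= \sum_(i <- r | P i) normc (F i).
Proof.
elim/big_ind2 : _ => [|A a B b hA hB|//]; first by rewrite (@normc0 R).
by rewrite (le_trans (le_normcD _ _))// lerD.
Qed.

Lemma N1M m n q (A : 'M[R[i]]_(m, n)) (B : 'M[R[i]]_(n, q)) :
  N1 (A *m B) <= N1 A * N1 B.
Proof.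
rewrite /N1 mulr_suml; apply: ler_sum => i _.
apply: (@le_trans _ _ (\sum_k \sum_j normc (A i j) * normc (B j k))).
  apply: ler_sum => k _; rewrite mxE (le_trans (normc_sum _ _ _))//.
  by apply: ler_sum => j _; rewrite normcM.
rewrite exchange_big /= mulr_suml; apply: ler_sum => j _.
rewrite -mulr_sumr ler_wpM2l ?normc_ge0//.
rewrite (bigD1 j)//= lerDl; apply: sumr_ge0 => l _.
by apply: sumr_ge0 => ? _; exact: normc_ge0.
Qed.

Lemma normc_entry_le m n (A : 'M[R[i]]_(m, n)) i j : normc (A i j) <= N1 A.
Proof.
rewrite /N1 (bigD1 i)//= (bigD1 j)//= -addrA lerDl addr_ge0//.
  by apply: sumr_ge0 => ? _; exact: normc_ge0.
by do 2!(apply: sumr_ge0 => ? _); apply: normc_ge0.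
Qed.

Lemma N1_eq0 m n (A : 'M[R[i]]_(m, n)) : N1 A = 0 -> A = 0.
Proof.
move=> A0; apply/matrixP => i j; rewrite mxE; apply: eq0_normc.
by apply/eqP; rewrite eq_le normc_ge0 andbT -A0 normc_entry_le.
Qed.

Lemma N1_le_bound m n (A : 'M[R[i]]_(m, n)) (a : R) :
  (forall i j, normc (A i j) <= a) -> N1 A <= (m * n)%:R * a.
Proof.
move=> h; apply: (@le_trans _ _ (\sum_(i < m) \sum_(j < n) a)).
  by do 2!(apply: ler_sum => ? _).
by rewrite !sumr_const !card_ord -mulrnA mulr_natl mulnC.
Qed.

Lemma normc_conj (z : R[i]) : normc (z^*%R) = normc z.
Proof. by case: z => a b; rewrite /normc /= sqrrN. Qed.

Lemma N1_adj m n (A : 'M[R[i]]_(m, n)) : N1 (A^t*) = N1 A.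
Proof.
rewrite /N1 exchange_big; apply: eq_bigr => i _; apply: eq_bigr => j _.
by rewrite !mxE normc_conj.
Qed.

Lemma normc_hs m n (A B : 'M[R[i]]_(m, n)) : normc (hs A B) <= N1 A * N1 B.
Proof.
rewrite hsE (le_trans (normc_sum _ _ _))// /N1 mulr_suml; apply: ler_sum => i _.
rewrite (le_trans (normc_sum _ _ _))// mulr_suml; apply: ler_sum => j _.
by rewrite normcM normc_conj ler_wpM2l ?normc_ge0// normc_entry_le.
Qed.

Lemma Re_hs_le m n (A B : 'M[R[i]]_(m, n)) : complex.Re (hs A B) <= N1 A * N1 B.
Proof.
by rewrite (le_trans (ler_norm _))// (le_trans (Re_le_normc _))// normc_hs.
Qed.

Lemma N1_le_hs n (A : 'M[R[i]]_n) :
  N1 A <= (n * n)%:R * Num.sqrt (complex.Re (hs A A)).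
Proof.
have hsR : complex.Re (hs A A) = \sum_i \sum_j normc (A i j) ^+ 2.
  rewrite hsE raddf_sum; apply: eq_bigr => i _; rewrite raddf_sum.
  apply: eq_bigr => j _; rewrite normc_sqr; case: (A i j) => a b /=.
  by rewrite mulNr opprK !expr2.
apply: N1_le_bound => i j; rewrite -[leLHS](@ger0_norm R) ?normc_ge0//.
rewrite -sqrtr_sqr ler_wsqrtr// hsR (bigD1 i)//= (bigD1 j)//= -addrA lerDl.
by rewrite addr_ge0// ?sumr_ge0// => ? _; rewrite ?sumr_ge0// => *; rewrite sqr_ge0.
Qed.

End EntrySumNorm.

(** * Spectral resolutions *)

Section Resolutions.
Variable R : realType.

(** A spectral decomposition over an arbitrary finite index type. The
    eigenprojections picked by [eproj] are one choice among many when
    eigenvalues coincide, and the modular operator is diagonalized by pairs of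
    indices; working with any decomposition covers both situations. *)
Record resol (I : finType) n (A : 'M[R[i]]_n) (a : I -> R) (P : I -> 'M[R[i]]_n) :
    Prop := Resol {
  resol_herm : forall i, (P i)^t* = P i;
  resol_mul : forall i j, P i *m P j = if i == j then P i else 0;
  resol_sum1 : \sum_i P i = 1%:M;
  resolE : A = \sum_i (a i)%:C *: P i }.

Lemma eprojE n (A : 'M[R[i]]_n) i k l :
  eproj A i k l = (spectralmx A i k)^*%R * spectralmx A i l.
Proof. by rewrite !mxE big_ord1 !mxE. Qed.

Lemma row_spectralM n (A : 'M[R[i]]_n) i j :
  row i (spectralmx A) *m (row j (spectralmx A))^t* = (i == j)%:R%:M.
Proof.
have /unitarymxP hU := spectral_unitarymx A.
apply/matrixP => k l; rewrite !ord1 [RHS]mxE eqxx mulr1n.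
have /matrixP/(_ i j) := hU; rewrite [RHS]mxE => <-; rewrite !mxE.
by apply: eq_bigr => m _; rewrite !mxE.
Qed.

Lemma resol_eproj n (A : 'M[R[i]]_n) : A \is hermsymmx ->
  resol A (eigval A) (eproj A).
Proof.
move=> hA; split; last exact: spectralE.
- by move=> i; rewrite /eproj adjM trmxCK.
- move=> i j; rewrite /eproj mulmxA -(mulmxA _ (row i _)) row_spectralM.
  by case: eqVneq => [->|_]; rewrite ?mulmx1 // mul_mx_scalar scale0r mul0mx.
- have /unitarymxP/mulmx1C hU := spectral_unitarymx A.
  rewrite -hU; apply/matrixP => k l; rewrite summxE mxE.
  by apply: eq_bigr => i _; rewrite eprojE !mxE.
Qed.

Section OneResolution.
Variables (I : finType) (n : nat) (A : 'M[R[i]]_n) (a : I -> R).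
Variable P : I -> 'M[R[i]]_n.
Hypothesis rA : resol A a P.

Lemma resol_mulr i : A *m P i = (a i)%:C *: P i.
Proof.
rewrite (resolE rA) mulmx_suml (bigD1 i)//= big1 ?addr0 => [|j ji].
  by rewrite -scalemxAl (resol_mul rA) eqxx.
by rewrite -scalemxAl (resol_mul rA) (negbTE ji) scaler0.
Qed.

Lemma resol_mull i : P i *m A = (a i)%:C *: P i.
Proof.
rewrite (resolE rA) mulmx_sumr (bigD1 i)//= big1 ?addr0 => [|j ji].
  by rewrite -scalemxAr (resol_mul rA) eqxx.
by rewrite -scalemxAr (resol_mul rA) eq_sym (negbTE ji) scaler0.
Qed.

Lemma resol_hermsym : A^t* = A.
Proof.
by rewrite (resolE rA) adj_sum; apply: eq_bigr => i _; rewrite adjZ (resol_herm rA).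
Qed.

Lemma resol_fun (f : R -> R) : resol (\sum_i (f (a i))%:C *: P i) (f \o a) P.
Proof. by case: rA => *; split. Qed.

Lemma resolZ (c : R) : resol (c%:C *: A) (fun i => c * a i) P.
Proof.
case: rA => h1 h2 h3 ->; split=> //; rewrite scaler_sumr.
by apply: eq_bigr => i _; rewrite scalerA rmorphM.
Qed.

Lemma resol_expand m (X : 'M[R[i]]_(n, m)) : X = \sum_i P i *m X.
Proof. by rewrite -mulmx_suml (resol_sum1 rA) mul1mx. Qed.

Lemma resol_expandr m (X : 'M[R[i]]_(m, n)) : X = \sum_i X *m P i.
Proof. by rewrite -mulmx_sumr (resol_sum1 rA) mulmx1. Qed.

Lemma resol_tr_ge0 i : 0 <= \tr (P i).
Proof.
have := hs_ge0 (P i).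
by rewrite /hs (resol_herm rA) (resol_mul rA) eqxx.
Qed.

(** In a Hermitian idempotent, the square of the modulus of an entry is at most
    the diagonal entry of its row, which is at most 1. *)
Lemma N1_resol i : N1 (P i) <= (n * n)%:R.
Proof.
rewrite -[leRHS]mulr1; apply: N1_le_bound => k l; apply: normc_le_normr.
have diag m : P i m m = \sum_q `|P i m q| ^+ 2.
  have := resol_mul rA i i; rewrite eqxx => /matrixP/(_ m m) <-.
  rewrite mxE; apply: eq_bigr => q _; rewrite normCK; congr (_ * _).
  by rewrite -[in LHS](resol_herm rA) !mxE.
have entry m q : `|P i m q| ^+ 2 <= P i m m.
  by rewrite [leRHS]diag (bigD1 q)//= lerDl sumr_ge0// => *; rewrite exprn_ge0.
have diag_ge0 m : 0 <= P i m m by rewrite diag sumr_ge0// => *; rewrite exprn_ge0.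
have diag_le1 : P i k k <= 1.
  have := entry k k; rewrite ger0_norm// expr2.
  have [->|k0] := eqVneq (P i k k) 0; first by rewrite ler01.
  by rewrite -[X in _ <= X -> _]mul1r ler_pM2r// lt_def k0 diag_ge0.
rewrite -(@ler_pXn2r _ 2)// ?nnegrE// ?expr1n ?ler01//.
by rewrite (le_trans (entry k l)).
Qed.

End OneResolution.

(** All comparisons between two spectral decompositions rest on this identity:
    eigenspaces of [A] and [B] overlap little unless the eigenvalues are close. *)
Lemma resol_overlap (I K : finType) n (A B : 'M[R[i]]_n) a P b Q
  (rA : @resol I n A a P) (rB : @resol K n B b Q) i k :
  P i *m (A - B) *m Q k = (a i - b k)%:C *: (P i *m Q k).
Proof.
rewrite mulmxBr mulmxBl (resol_mull rA) -(mulmxA _ B) (resol_mulr rB).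
by rewrite -scalemxAl -scalemxAr rmorphB scalerBl.
Qed.

Lemma resol_overlap0 (I K : finType) n (A : 'M[R[i]]_n) a P b Q
  (rA : @resol I n A a P) (rB : @resol K n A b Q) (f : R -> R) i k :
  (f (a i))%:C *: (P i *m Q k) = (f (b k))%:C *: (P i *m Q k).
Proof.
have := resol_overlap rA rB i k; rewrite subrr mulmx0 mul0mx => /esym/eqP.
rewrite scaler_eq0 => /orP[|/eqP->]; last by rewrite !scaler0.
by rewrite -(rmorph0 (real_complex R)) => /eqP/complexI/subr0_eq ->.
Qed.

(** The functional calculus does not depend on the decomposition: where two
    decompositions of the same matrix overlap, the eigenvalues agree. *)
Lemma resol_mxfun (I : finType) n (A : 'M[R[i]]_n) a P (rA : @resol I n A a P) f :
  mxfun f A = \sum_i (f (a i))%:C *: P i.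
Proof.
have rE : resol A (eigval A) (eproj A).
  by apply: resol_eproj; apply/hermP; exact: (resol_hermsym rA).
rewrite /mxfun [LHS](resol_expandr rA) [RHS](resol_expand rE).
under eq_bigr do rewrite mulmx_suml.
rewrite exchange_big; apply: eq_bigr => k _ /=.
rewrite mulmx_sumr; apply: eq_bigr => i _.
by rewrite -scalemxAl -scalemxAr (resol_overlap0 rE rA).
Qed.

Lemma resol_of_mxfun (I : finType) n (A : 'M[R[i]]_n) a P
  (rA : @resol I n A a P) f : resol (mxfun f A) (f \o a) P.
Proof. by rewrite (resol_mxfun rA); exact: (resol_fun rA). Qed.

Lemma resol_mxfun2 (I K : finType) n (A B : 'M[R[i]]_n) a P b Q
  (rA : @resol I n A a P) (rB : @resol K n B b Q) f X :
  mxfun2 f A B X = \sum_i \sum_k (f (a i) (b k))%:C *: (P i *m X *m Q k).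
Proof.
have rE : resol A (eigval A) (eproj A).
  by apply: resol_eproj; apply/hermP; exact: (resol_hermsym rA).
have rF : resol B (eigval B) (eproj B).
  by apply: resol_eproj; apply/hermP; exact: (resol_hermsym rB).
rewrite /mxfun2.
transitivity (\sum_i \sum_k \sum_j \sum_l (f (eigval A i) (eigval B k))%:C *:
    (eproj A i *m P j *m X *m Q l *m eproj B k)).
  apply: eq_bigr => i _; apply: eq_bigr => k _.
  rewrite {1}(resol_expand rA X) mulmx_sumr mulmx_suml scaler_sumr.
  apply: eq_bigr => j _.
  rewrite {1}(resol_expandr rB (P j *m X)) mulmx_sumr mulmx_suml scaler_sumr.
  by apply: eq_bigr => l _; rewrite !mulmxA.
transitivity (\sum_j \sum_l \sum_i \sum_k (f (a j) (b l))%:C *: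
    (eproj A i *m P j *m X *m Q l *m eproj B k)); last first.
  apply: eq_bigr => j _; apply: eq_bigr => l _.
  rewrite {1}(resol_expand rE (P j *m X *m Q l)) scaler_sumr; apply: eq_bigr => i _.
  rewrite [in RHS](resol_expandr rF (eproj A i *m (P j *m X *m Q l))) scaler_sumr; apply: eq_bigr => k _.
  by rewrite !mulmxA.
under eq_bigr do rewrite exchange_big; rewrite exchange_big /=.
apply: eq_bigr => j _.
under eq_bigr do rewrite exchange_big; rewrite exchange_big /=.
apply: eq_bigr => l _; apply: eq_bigr => i _; apply: eq_bigr => k _.
have hA := resol_overlap0 rE rA (f^~ (eigval B k)) i j.
have hB := resol_overlap0 rB rF (f (a j)) l k.
rewrite -(mulmxA _ (Q l)).
rewrite /= in hA; rewrite 2!scalemxAl hA -2!scalemxAl [in LHS]scalemxAr -hB.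
by rewrite -scalemxAr.
Qed.

End Resolutions.

(** * Perturbation of the double functional calculus *)

Section Perturbation.
Variable R : realType.
Import Normc.

Lemma N1_overlap (I K : finType) n (A B : 'M[R[i]]_n) a P b Q
  (rA : @resol R I n A a P) (rB : @resol R K n B b Q) i k :
  `|a i - b k| * N1 (P i *m Q k) <= (n * n)%:R ^+ 2 * N1 (A - B).
Proof.
rewrite -normc_real -N1Z -(resol_overlap rA rB) (le_trans (N1M _ _))//.
rewrite expr2 mulrAC ler_pM ?N1_ge0 ?(N1_resol rB)//.
by rewrite (le_trans (N1M _ _))// ler_wpM2r ?N1_ge0 ?(N1_resol rA).
Qed.

Lemma N1_eproj_ge1 n (A : 'M[R[i]]_n) i : A \is hermsymmx -> 1 <= N1 (eproj A i).
Proof.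
move=> hA; have rA := resol_eproj hA.
have P0 : 0 < N1 (eproj A i).
  rewrite lt_def N1_ge0 andbT; apply/eqP => /N1_eq0 P0.
  have := row_spectralM A i i; rewrite eqxx => h.
  have : row i (spectralmx A) *m eproj A i *m (row i (spectralmx A))^t* = 1%:M.
    by rewrite /eproj mulmxA h mul1mx h.
  rewrite P0 mulmx0 mul0mx => /matrixP/(_ 0 0); rewrite !mxE eqxx => /eqP.
  by rewrite eq_sym oner_eq0.
rewrite -(ler_pM2r P0) mul1r; have := N1M (eproj A i) (eproj A i).
by rewrite (resol_mul rA) eqxx.
Qed.

(** Otherwise the eigenprojection of [A] would be almost orthogonal to all those
    of [B], which sum to the identity. *)
Lemma eigval_near n (A B : 'M[R[i]]_n) (eta : R) : A \is hermsymmx ->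
  B \is hermsymmx -> n%:R * ((n * n)%:R ^+ 2 * N1 (A - B)) < eta ->
  forall i, exists k, `|eigval A i - eigval B k| < eta.
Proof.
move=> hA hB hAB i; apply: contrapT => /forallNP far.
have rA := resol_eproj hA; have rB := resol_eproj hB.
have eta0 : 0 < eta.
  by rewrite (le_lt_trans _ hAB)// !mulr_ge0 ?exprn_ge0 ?N1_ge0 ?ler0n.
have /ler_wpM2l := N1_eproj_ge1 i hA => /(_ eta (ltW eta0)); rewrite mulr1.
apply/negP; rewrite -ltNge (le_lt_trans _ hAB)//.
rewrite [X in N1 X](resol_expandr rB) (le_trans (ler_wpM2l (ltW eta0) (N1_sum _ _ _)))//.
rewrite mulr_sumr -[X in _ <= X%:R * _]card_ord -sum1_card natr_sum mulr_suml.
apply: ler_sum => k _; rewrite mul1r (le_trans _ (N1_overlap rA rB i k))//.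
by rewrite ler_wpM2r ?N1_ge0// leNgt; apply/negP; exact: far.
Qed.

(** Continuity at a single point, with a radius that can be made uniform over
    the finitely many pairs of eigenvalues. *)
Definition cts2 (f : R -> R -> R) (x0 y0 : R) : Prop :=
  forall e, 0 < e -> exists2 del, 0 < del &
    forall x y, `|x - x0| < del -> `|y - y0| < del -> `|f x y - f x0 y0| <= e.

Lemma unif_radius (T : eqType) (s : seq T) (Q : T -> R -> Prop) :
  (forall t r r', 0 < r' -> r' <= r -> Q t r -> Q t r') ->
  (forall t, exists2 r, 0 < r & Q t r) ->
  exists2 r, 0 < r & forall t, t \in s -> Q t r.
Proof.
move=> mono ex; elim: s => [|t s [r r0 hr]]; first by exists 1.
have [r' r'0 hr'] := ex t; exists (Num.min r r'); first by rewrite lt_min r0.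
move=> u; rewrite inE => /orP[/eqP->|us].
  by apply: mono hr' => //; rewrite ?lt_min ?r0// ge_min lexx orbT.
by apply: mono (hr _ us) => //; rewrite ?lt_min ?r0// ge_min lexx.
Qed.

Lemma bigmax_bound (T : finType) (F : T -> R) : exists2 C, 0 < C & forall t, F t <= C.
Proof.
exists (1 + \sum_t `|F t|) => [|t].
  by rewrite ltr_pwDl// sumr_ge0.
rewrite (le_trans (ler_norm _))// (bigD1 t)//= addrCA lerDl addr_ge0//.
exact: sumr_ge0.
Qed.

(** Inserting the resolutions of [A0] and [B0] next to those of [A] and [B] turns
    the difference of the two calculi into differences of values of [f]. *)
Lemma mxfun2_diff (I K I' K' : finType) n (A B A0 B0 : 'M[R[i]]_n) a P b Q a0 P0 b0 Q0
    (rA : @resol R I n A a P) (rB : @resol R K n B b Q)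
    (rA0 : @resol R I' n A0 a0 P0) (rB0 : @resol R K' n B0 b0 Q0) f Y :
  mxfun2 f A B Y - mxfun2 f A0 B0 Y =
  \sum_i \sum_k \sum_m \sum_l (f (a i) (b k) - f (a0 m) (b0 l))%:C *:
    (P i *m P0 m *m Y *m (Q0 l *m Q k)).
Proof.
transitivity (\sum_i \sum_k \sum_m \sum_l
    ((f (a i) (b k))%:C *: (P i *m P0 m *m Y *m (Q0 l *m Q k)) -
     (f (a0 m) (b0 l))%:C *: (P i *m P0 m *m Y *m (Q0 l *m Q k)))); last first.
  by do 4!(apply: eq_bigr => ? _); rewrite rmorphB scalerBl.
under eq_bigr do under eq_bigr do under eq_bigr do rewrite sumrB.
under eq_bigr do under eq_bigr do rewrite sumrB.
under eq_bigr do rewrite sumrB.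
rewrite sumrB; congr (_ - _).
  rewrite (resol_mxfun2 rA rB); apply: eq_bigr => i _; apply: eq_bigr => k _.
  rewrite [in LHS](resol_expand rA0 Y) mulmx_sumr mulmx_suml scaler_sumr.
  apply: eq_bigr => m _.
  rewrite [in LHS](resol_expandr rB0 (P0 m *m Y)) mulmx_sumr mulmx_suml scaler_sumr.
  by apply: eq_bigr => l _; rewrite !mulmxA.
rewrite (resol_mxfun2 rA0 rB0).
under [RHS]eq_bigr do rewrite exchange_big; rewrite [RHS]exchange_big /=.
apply: eq_bigr => m _.
under [RHS]eq_bigr do rewrite exchange_big; rewrite [RHS]exchange_big /=.
apply: eq_bigr => l _.
rewrite [in LHS](resol_expand rA (P0 m *m Y *m Q0 l)) scaler_sumr; apply: eq_bigr => i _.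
rewrite [in LHS](resol_expandr rB (P i *m (P0 m *m Y *m Q0 l))) scaler_sumr.
by apply: eq_bigr => k _; rewrite !mulmxA.
Qed.

(** Eigenprojections need not depend continuously on the matrix, yet the
    functional calculus does: in the expansion of the difference over pairs of
    old and new eigenspaces, either the eigenvalues are close and the values
    of [f] are, or the eigenspaces hardly overlap. *)
Lemma mxfun2_cont n (A0 B0 Y : 'M[R[i]]_n) f : A0 \is hermsymmx -> B0 \is hermsymmx ->
  (forall i k, cts2 f (eigval A0 i) (eigval B0 k)) ->
  forall e, 0 < e -> exists2 del, 0 < del &
    forall A B, A \is hermsymmx -> B \is hermsymmx ->
      N1 (A - A0) < del -> N1 (B - B0) < del ->
      N1 (mxfun2 f A B Y - mxfun2 f A0 B0 Y) <= e.
Proof.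
move=> hA0 hB0 ctsf e e0.
pose c : R := (n * n)%:R + 1; pose y := N1 Y + 1.
have c1 : 1 <= c by rewrite lerDr ler0n.
have c0 : 0 < c by rewrite (lt_le_trans ltr01).
have cn : n%:R <= c.
  by rewrite (@le_trans _ _ (n * n)%:R) ?lerDl// ler_nat; case: (n) => // m; rewrite leq_pmull.
have y0 : 0 < y by rewrite ltr_wpDl ?N1_ge0.
have [C C0 hC] := bigmax_bound (fun ik : 'I_n * 'I_n =>
  `|f (eigval A0 ik.1) (eigval B0 ik.2)| + 1).
pose e' := Num.min 1 (e / (c ^+ 8 * y)).
have e'0 : 0 < e' by rewrite lt_min ltr01 divr_gt0// mulr_gt0// exprn_gt0.
have [eta eta0 heta] := @unif_radius _ (enum [set: 'I_n * 'I_n])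
  (fun ik r => forall x y, `|x - eigval A0 ik.1| < r -> `|y - eigval B0 ik.2| < r ->
     `|f x y - f (eigval A0 ik.1) (eigval B0 ik.2)| <= e')
  (fun ik r r' r'0 r'r h x y hx hy => h x y (lt_le_trans hx r'r) (lt_le_trans hy r'r))
  (fun ik => ctsf ik.1 ik.2 _ e'0).
have {}heta i k x z : `|x - eigval A0 i| < eta -> `|z - eigval B0 k| < eta ->
    `|f x z - f (eigval A0 i) (eigval B0 k)| <= e'.
  by apply: (heta (i, k)); rewrite mem_enum inE.
(* The first bound brings every eigenvalue near an old one; the second makes
   the terms with distant eigenvalues, where [f] varies by at most 2 C, small. *)
pose del := Num.min (eta / c ^+ 3) (eta * e / (2 * C * c ^+ 8 * y)).
exists del.
  by rewrite lt_min !divr_gt0 ?mulr_gt0 ?exprn_gt0.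
move=> A B hA hB dA dB.
have rA := resol_eproj hA; have rB := resol_eproj hB.
have rA0 := resol_eproj hA0; have rB0 := resol_eproj hB0.
have near (Z Z0 : 'M[R[i]]_n) : Z \is hermsymmx -> Z0 \is hermsymmx -> N1 (Z - Z0) < del ->
    forall i, exists k, `|eigval Z i - eigval Z0 k| < eta.
  move=> hZ hZ0 dZ; apply: eigval_near => //.
  rewrite (@le_lt_trans _ _ (c * (c ^+ 2 * N1 (Z - Z0))))//.
    rewrite ler_pM ?ler0n ?mulr_ge0 ?exprn_ge0 ?N1_ge0 ?ler0n//.
    by rewrite ler_wpM2r ?N1_ge0// lerXn2r ?nnegrE ?ler0n ?(ltW c0)// lerDl.
  rewrite mulrA -exprS mulrC -ltr_pdivlMr ?exprn_gt0// (lt_le_trans dZ)//.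
  by rewrite ge_min lexx.
have fbd i k : `|f (eigval A i) (eigval B k)| <= C.
  have [m hm] := near _ _ hA hA0 dA i; have [l hl] := near _ _ hB hB0 dB k.
  rewrite (le_trans _ (hC (m, l)))//= -lerBlDl (le_trans (lerB_dist _ _))//.
  by rewrite (le_trans (heta _ _ _ _ hm hl))// ge_min lexx.
have f0bd m l : `|f (eigval A0 m) (eigval B0 l)| <= C.
  by rewrite (le_trans _ (hC (m, l)))//= lerDl.
have Pc (Z : 'M[R[i]]_n) i : Z \is hermsymmx -> N1 (eproj Z i) <= c.
  by move=> hZ; rewrite (le_trans (N1_resol (resol_eproj hZ) _))// lerDl.
have PPc (Z Z' : 'M[R[i]]_n) i k : Z \is hermsymmx -> Z' \is hermsymmx ->
    N1 (eproj Z i *m eproj Z' k) <= c ^+ 2.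
  by move=> hZ hZ'; rewrite (le_trans (N1M _ _))// expr2 ler_pM ?N1_ge0 ?Pc.
have far (Z Z0 : 'M[R[i]]_n) i m : Z \is hermsymmx -> Z0 \is hermsymmx -> N1 (Z - Z0) < del ->
    eta <= `|eigval Z i - eigval Z0 m| ->
    2 * C * N1 (eproj Z i *m eproj Z0 m) <= e / (c ^+ 6 * y).
  move=> hZ hZ0 dZ hfar.
  have := N1_overlap (resol_eproj hZ) (resol_eproj hZ0) i m.
  move=> /(le_trans (ler_wpM2r (N1_ge0 _) hfar)) h.
  have {}h : eta * N1 (eproj Z i *m eproj Z0 m) <= c ^+ 2 * del.
    rewrite (le_trans h)// ler_pM ?exprn_ge0 ?N1_ge0 ?ler0n ?(ltW dZ)//.
    by rewrite lerXn2r ?nnegrE ?ler0n ?(ltW c0)// lerDl.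
  rewrite -(ler_pM2l eta0) mulrCA.
  rewrite (@le_trans _ _ (2 * C * (c ^+ 2 * del)))//.
    by rewrite ler_pM2l ?mulr_gt0.
  rewrite (@le_trans _ _ (2 * C * (c ^+ 2 * (eta * e / (2 * C * c ^+ 8 * y)))))//.
    by rewrite ler_pM2l ?mulr_gt0// ler_pM2l ?exprn_gt0// ge_min lexx orbT.
  rewrite le_eqVlt; apply/orP; left; apply/eqP.
  by field; rewrite !gt_eqF.
have Nfar (X : 'M[R[i]]_n) : N1 X <= c ^+ 2 ->
    forall Z, 2 * C * N1 Z <= e / (c ^+ 6 * y) ->
    2 * C * (N1 Z * (N1 Y * N1 X)) <= e / c ^+ 4.
  move=> hX Z hZ; rewrite !mulrA.
  rewrite (@le_trans _ _ (e / (c ^+ 6 * y) * y * c ^+ 2))//.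
    have k0 : 0 <= 2 * C by rewrite mulr_ge0 ?(ltW C0).
    have k1 : 0 <= 2 * C * N1 Z by rewrite mulr_ge0 ?N1_ge0.
    have hy : N1 Y <= y by rewrite lerDl.
    exact: ler_pM (mulr_ge0 k1 (N1_ge0 _)) (N1_ge0 _) (ler_pM k1 (N1_ge0 _) (hZ) hy) hX.
  rewrite le_eqVlt; apply/orP; left; apply/eqP.
  by field; rewrite !gt_eqF.
rewrite (mxfun2_diff rA rB rA0 rB0).
have term i k m l : N1 ((f (eigval A i) (eigval B k) -
      f (eigval A0 m) (eigval B0 l))%:C *:
    (eproj A i *m eproj A0 m *m Y *m (eproj B0 l *m eproj B k))) <= e / c ^+ 4.
  rewrite N1Z normc_real.
  have N1MM (X X' : 'M[R[i]]_n) : N1 (X *m Y *m X') <= N1 X * (N1 Y * N1 X').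
    rewrite (le_trans (N1M _ _))// mulrA ler_wpM2r ?N1_ge0 ?N1M//.
  have f2C : `|f (eigval A i) (eigval B k) - f (eigval A0 m) (eigval B0 l)| <= 2 * C.
    by rewrite (le_trans (ler_normB _ _))// mulr_natl mulr2n lerD.
  have [nA|fA] := ltP `|eigval A i - eigval A0 m| eta; last first.
    rewrite (le_trans (ler_pM _ (N1_ge0 _) f2C (N1MM _ _)))//.
    by apply: Nfar; [exact: PPc|exact: far].
  have [nB|fB] := ltP `|eigval B k - eigval B0 l| eta; last first.
    rewrite (le_trans (ler_pM _ (N1_ge0 _) f2C (N1MM _ _)))//.
    rewrite [X in 2 * C * X]mulrCA [N1 (_ *m _) * N1 (eproj B0 l *m _)]mulrC.
    rewrite [X in 2 * C * X]mulrCA; apply: Nfar; first exact: PPc.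
    rewrite -N1_adj adjM (resol_herm rB) (resol_herm rB0); exact: far.
  rewrite (le_trans (ler_pM _ (N1_ge0 _) (heta _ _ _ _ nA nB) (N1MM _ _)))//.
  rewrite (@le_trans _ _ (e / (c ^+ 8 * y) * (c ^+ 2 * (y * c ^+ 2))))//.
    rewrite ler_pM ?(ltW e'0) ?mulr_ge0 ?N1_ge0// ?ge_min ?lexx ?orbT//.
    apply: ler_pM; rewrite ?N1_ge0 ?PPc ?mulr_ge0 ?N1_ge0//.
    by apply: ler_pM; rewrite ?N1_ge0 ?PPc// lerDl.
  rewrite le_eqVlt; apply/orP; left; apply/eqP.
  by field; rewrite !gt_eqF.
have sumbd (F : 'I_n -> 'M[R[i]]_n) (b : R) : 0 <= b ->
    (forall i, N1 (F i) <= b) -> N1 (\sum_i F i) <= c * b.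
  move=> b0 hF; rewrite (le_trans (N1_sum _ _ _))//.
  rewrite (le_trans (ler_sum _ (fun i _ => hF i)))// sumr_const card_ord -mulr_natl.
  by rewrite ler_wpM2r.
have -> : e = c * (c * (c * (c * (e / c ^+ 4)))) by field; rewrite gt_eqF.
have q0 : 0 <= e / c ^+ 4 by rewrite divr_ge0 ?exprn_ge0 ?(ltW c0) ?(ltW e0).
have c0' := ltW c0.
do 4!(apply: (sumbd) => [|?]; first by do ?[exact: q0 | apply: mulr_ge0 => //]).
exact: term.
Qed.

End Perturbation.

(** * The scalar kernels *)

Section ScalarCalculus.
Variable R : realType.
Implicit Types x y z r : R.

Lemma powR_cts r x : 0 < x -> {for x, continuous (fun z => z `^ r)}.
Proof.
move=> x0; apply: differentiable_continuous; apply/derivable1_diffP.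
by have [] := is_derive1_powR r x0.
Qed.

Lemma MVT_between (f df : R -> R) x y : 0 < x -> 0 < y -> x != y ->
  (forall z, 0 < z -> is_derive z 1 f (df z)) ->
  exists2 c, Num.min x y < c < Num.max x y & f x - f y = df c * (x - y).
Proof.
move=> x0 y0 xy dfE; wlog lt_xy : x y x0 y0 xy / x < y => [H|].
  have [xLy|] := boolP (x < y); first exact: H.
  rewrite -leNgt => yx.
  have [||c cyx E] := H y x y0 x0; rewrite ?(eq_sym y)// ?lt_def ?xy//.
  exists c; first by rewrite minC maxC.
  by rewrite -opprB E -mulrN opprB.
have [z||c] := @MVT R f df x y lt_xy.
- by rewrite in_itv /= => /andP[xz _]; apply: dfE; rewrite (lt_trans x0).
- apply: derivable_within_continuous => z; rewrite in_itv /= => /andP[xz _].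
  by have [] := dfE z (lt_le_trans x0 xz).
rewrite in_itv /= => cxy E; exists c; first by rewrite min_l ?max_r ?ltW.
by rewrite -opprB E -mulrN opprB.
Qed.

Lemma powR_sub r x y : 0 < x -> 0 < y -> x != y ->
  exists2 c, Num.min x y < c < Num.max x y &
    x `^ r - y `^ r = r * c `^ (r - 1) * (x - y).
Proof.
move=> x0 y0 xy.
exact: (@MVT_between (fun z => z `^ r) (fun z => r * z `^ (r - 1)) x y).
Qed.

Lemma min_gt0 x y : 0 < x -> 0 < y -> 0 < Num.min x y.
Proof. by move=> x0 y0; rewrite lt_min x0. Qed.

Lemma cts2_cvg (f : R -> R -> R) x0 y0 :
  f z.1 z.2 @[z --> (x0, y0)] --> f x0 y0 -> cts2 f x0 y0.
Proof.
move=> /cvgrPdist_le h e e0; have /nbhs_ballP[del /= del0 hdel] := h e e0.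
exists del => // x y hx hy; rewrite distrC.
by apply: (hdel (x, y)); split; rewrite /ball /= distrC.
Qed.

Lemma cts2_near (f g : R -> R -> R) x0 y0 (d : R) : 0 < d ->
  (forall x y, `|x - x0| < d -> `|y - y0| < d -> f x y = g x y) ->
  cts2 g x0 y0 -> cts2 f x0 y0.
Proof.
move=> d0 fg h e e0; have [del del0 hdel] := h e e0.
exists (Num.min d del); first by rewrite lt_min d0.
move=> x y; rewrite !lt_min => /andP[x1 x2] /andP[y1 y2].
by rewrite !fg ?subrr ?normr0//; apply: hdel.
Qed.

(** Divided differences are values of a continuous function at intermediate
    points, which gives their continuity on the diagonal. *)
Lemma cts2_diag (f : R -> R -> R) (g : R -> R) x0 : 0 < x0 ->
  {for x0, continuous g} ->
  (forall x y, 0 < x -> 0 < y ->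
     exists2 c, Num.min x y <= c <= Num.max x y & f x y = g c) ->
  cts2 f x0 x0.
Proof.
move=> x00 /cvgrPdist_le ctsg fg e e0.
have /nbhs_ballP[del /= del0 hdel] := ctsg e e0.
exists (Num.min del x0); first by rewrite lt_min del0.
have pos z : `|z - x0| < Num.min del x0 -> 0 < z.
  by rewrite lt_min => /andP[_]; rewrite ltr_norml => /andP[]; lra.
move=> x y hx hy; have [c cxy ->] := fg x y (pos _ hx) (pos _ hy).
have [c' cxx ->] := fg x0 x0 x00 x00.
have -> : c' = x0 by apply/eqP; rewrite eq_le andbC; move: cxx; rewrite minxx maxxx.
rewrite distrC; apply: hdel; rewrite /ball /= distrC.
move: cxy hx hy; rewrite ge_min le_max !lt_min !ltr_norml.
move=> /andP[/orP[]? /orP[]?] /andP[/andP[? ?] _] /andP[/andP[? ?] _];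
  by apply/andP; split; lra.
Qed.

Section Kernels.
Variable p : R.
Hypotheses (p1 : 1 < p) (p2 : p <= 2).

Local Notation th := (theta p).

(** As a value of a power at an intermediate point, [theta] is positive, bounded
    by the power of the larger argument, and continuous on the diagonal. *)
Lemma theta_mean x y : 0 < x -> 0 < y ->
  exists2 c, Num.min x y <= c <= Num.max x y & th x y = c `^ (2 - p).
Proof.
move=> x0 y0; rewrite /theta; case: eqVneq => [->|xy].
  by exists y => //; rewrite minxx maxxx lexx.
have [c cxy ->] := powR_sub (p - 1) x0 y0 xy.
have c0 : 0 < c by have /andP[+ _] := cxy; apply: lt_trans; exact: min_gt0.
exists c; first by have /andP[/ltW-> /ltW->] := cxy.
have -> : 2 - p = - (p - 1 - 1) by ring.
have cn : c `^ (p - 1 - 1) != 0 by rewrite gt_eqF ?powR_gt0.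
rewrite powRN; field.
by rewrite cn !subr_eq0 xy ?andbT gt_eqF.
Qed.

Lemma theta_gt0 x y : 0 < x -> 0 < y -> 0 < th x y.
Proof.
move=> x0 y0; have [c /andP[cxy _] ->] := theta_mean x0 y0.
by rewrite powR_gt0// (lt_le_trans _ cxy)// min_gt0.
Qed.

Lemma theta_le x y M : 0 < x -> 0 < y -> x <= M -> y <= M -> th x y <= M `^ (2 - p).
Proof.
move=> x0 y0 xM yM; have [c /andP[cxy cM] ->] := theta_mean x0 y0.
have c0 : 0 < c by rewrite (lt_le_trans _ cxy)// min_gt0.
have {}cM : c <= M by rewrite (le_trans cM)// ge_max xM.
by apply: ge0_ler_powR; rewrite ?nnegrE ?subr_ge0// ltW// (lt_le_trans c0).
Qed.

Lemma theta_sym x y : th x y = th y x.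
Proof.
rewrite /theta eq_sym; case: eqP => [->//|_].
by rewrite -(opprB y x) -(opprB (y `^ (p - 1))) invrN mulrNN.
Qed.

(** Homogeneity is what makes the twists of the metric by the modular frequencies
    compatible with the generator. *)
Lemma theta_homog k x y : 0 < k -> 0 < x -> 0 < y ->
  th (k * x) (k * y) = k `^ (2 - p) * th x y.
Proof.
move=> k0 x0 y0; rewrite /theta (inj_eq (mulfI (lt0r_neq0 k0))).
case: eqP => [_|/eqP xy]; first by rewrite powRM ?ltW.
rewrite !powRM ?(ltW k0) ?(ltW x0) ?(ltW y0)//.
have -> : k `^ (2 - p) = k / k `^ (p - 1).
  have -> : 2 - p = 1 - (p - 1) by ring.
  by rewrite powRB ?(gt_eqF k0) ?implybT// powRr1 ?(ltW k0).
have [c cxy E] := powR_sub (p - 1) x0 y0 xy.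
have c0 : 0 < c by have /andP[+ _] := cxy; apply: lt_trans; exact: min_gt0.
rewrite -!mulrBr E; field.
have cn : c `^ (p - 1 - 1) != 0 by rewrite gt_eqF ?powR_gt0.
have kn : k `^ (p - 1) != 0 by rewrite gt_eqF ?powR_gt0.
have pn : p - 1 != 0 by rewrite gt_eqF ?subr_gt0.
have xn : x - y != 0 by rewrite subr_eq0.
by do ?[apply/andP; split].
Qed.

Lemma cts2_powR r x0 y0 : 0 < x0 ->
  z.1 `^ r @[z --> (x0, y0)] --> x0 `^ r.
Proof.
move=> x00; apply: (@cvg_comp _ _ _ (fun z : R * R => z.1) (fun x => x `^ r)).
  exact: cvg_fst.
exact: powR_cts.
Qed.

Lemma cts2_powR2 r x0 y0 : 0 < y0 ->
  z.2 `^ r @[z --> (x0, y0)] --> y0 `^ r.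
Proof.
move=> y00; apply: (@cvg_comp _ _ _ (fun z : R * R => z.2) (fun x => x `^ r)).
  exact: cvg_snd.
exact: powR_cts.
Qed.

Lemma near_neq x0 y0 : x0 != y0 -> 0 < `|x0 - y0| / 2 /\
  forall x y, `|x - x0| < `|x0 - y0| / 2 -> `|y - y0| < `|x0 - y0| / 2 -> x != y.
Proof.
move=> xy; split; first by rewrite divr_gt0// normr_gt0 subr_eq0.
move=> x y hx hy; apply: contraTneq hx => xy'; rewrite -leNgt; rewrite -xy' in hy.
have := ler_distD x x0 y0; rewrite (distrC x0 x).
by move: hy; set a := `|x - y0|; set b := `|x - x0|; set c := `|x0 - y0|; lra.
Qed.

Lemma theta_cts x0 y0 : 0 < x0 -> 0 < y0 -> cts2 th x0 y0.
Proof.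
move=> x00 y00; have [<-|xy] := eqVneq x0 y0.
  apply: (@cts2_diag th (fun z => z `^ (2 - p))) => // [|x y]; first exact: powR_cts.
  exact: theta_mean.
have [d0 hd] := near_neq xy.
apply: (@cts2_near _ (fun x y => (p - 1) * ((x - y) / (x `^ (p - 1) - y `^ (p - 1)))) _ _ _ d0).
  by move=> x y hx hy; rewrite /theta (negbTE (hd _ _ hx hy)).
apply: cts2_cvg; apply: cvgM; first exact: cvg_cst.
apply: cvgM; first by apply: cvgB; [exact: cvg_fst|exact: cvg_snd].
apply: cvgV; last by apply: cvgB; [exact: cts2_powR|exact: cts2_powR2].
have [c cxy ->] := powR_sub (p - 1) x00 y00 xy.
have c0 : 0 < c by have /andP[+ _] := cxy; apply: lt_trans; exact: min_gt0.
have cn : c `^ (p - 1 - 1) != 0 by rewrite gt_eqF ?powR_gt0.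
have pn : p - 1 != 0 by rewrite gt_eqF ?subr_gt0.
by rewrite !mulf_neq0// subr_eq0.
Qed.

(** The second-order Taylor remainder of [x `^ p] at [y], divided by the square
    of the increment. *)
Definition taylor2 x y : R :=
  if x == y then p * (p - 1) / 2 * x `^ (p - 2)
  else (x `^ p - y `^ p - (x - y) * (p * y `^ (p - 1))) / (x - y) ^+ 2.

Lemma taylor2_mean x y : 0 < x -> 0 < y -> exists2 c,
  Num.min x y <= c <= Num.max x y & taylor2 x y = p * (p - 1) / 2 * c `^ (p - 2).
Proof.
move=> x0 y0; rewrite /taylor2; case: eqVneq => [->|xy].
  by exists y => //; rewrite minxx maxxx lexx.
set k := _ / _.
have xy0 : x - y != 0 by rewrite subr_eq0.
(* k is chosen so that the second-order remainder G vanishes at x *)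
pose G z := z `^ p - (z - y) * (p * y `^ (p - 1)) - k * (z - y) ^+ 2.
have dG z : 0 < z -> is_derive z 1 G (p * z `^ (p - 1) - p * y `^ (p - 1)
    - k * 2 * (z - y)).
  move=> z0; have := is_derive1_powR p z0 => dz; rewrite /G.
  apply: is_derive_eq; rewrite /GRing.scale /=.
  by ring.
have [c cxy] := MVT_between x0 y0 xy dG.
have -> : G x - G y = 0.
  by rewrite /G /k; field.
move=> /esym/eqP; rewrite mulf_eq0 (negbTE xy0) orbF => /eqP E.
have c0 : 0 < c by have /andP[+ _] := cxy; apply: lt_trans; exact: min_gt0.
have cy : c != y.
  by apply: contraTneq cxy => ->; rewrite gt_min lt_max !ltxx !orbF; case: ltgtP.
have [b bcy E'] := powR_sub (p - 1) c0 y0 cy.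
exists b.
  move: bcy cxy; rewrite !gt_min !lt_max ge_min le_max.
  by move=> /andP[/orP[]? /orP[]?] /andP[/orP[]? /orP[]?]; apply/andP; split;
    apply/orP; lra.
have cy0 : c - y != 0 by rewrite subr_eq0.
apply: (mulIf cy0); have -> : p - 2 = p - 1 - 1 by ring.
have -> : p * (p - 1) / 2 * b `^ (p - 1 - 1) * (c - y) =
  p * ((p - 1) * b `^ (p - 1 - 1) * (c - y)) / 2 by ring.
by rewrite -E'; lra.
Qed.

Lemma taylor2_cts x0 y0 : 0 < x0 -> 0 < y0 -> cts2 taylor2 x0 y0.
Proof.
move=> x00 y00; have [<-|xy] := eqVneq x0 y0.
  have cg : {for x0, continuous (fun c => p * (p - 1) / 2 * c `^ (p - 2))}.
    by apply: cvgM; [exact: cvg_cst|exact: powR_cts].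
  by apply: (@cts2_diag taylor2 _ _ x00 cg) => x y; exact: taylor2_mean.
have [d0 hd] := near_neq xy.
apply: (@cts2_near _ (fun x y =>
  (x `^ p - y `^ p - (x - y) * (p * y `^ (p - 1))) / (x - y) ^+ 2) _ _ _ d0).
  by move=> x y hx hy; rewrite /taylor2 (negbTE (hd _ _ hx hy)).
apply: cts2_cvg.
have cB : z.1 - z.2 @[z --> (x0, y0)] --> x0 - y0.
  by apply: cvgB; [exact: cvg_fst|exact: cvg_snd].
apply: cvgM; last first.
  apply: cvgV; first by rewrite expf_neq0// subr_eq0.
  by rewrite expr2; apply: cvgM; exact: cB.
apply: cvgB; first by apply: cvgB; [exact: cts2_powR|exact: cts2_powR2].
by apply: cvgM => //; apply: cvgM; [exact: cvg_cst|exact: cts2_powR2].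
Qed.

(** Symmetrizing the remainder kernel leaves the divided difference of the
    derivative, which is the inverse of [theta]. *)
Lemma taylor2_sym x y : 0 < x -> 0 < y ->
  (p * (p - 1))^-1 * (taylor2 x y + taylor2 y x) = (th x y)^-1.
Proof.
move=> x0 y0; have p0 : 0 < p by rewrite (lt_trans _ p1).
have pn : p - 1 != 0 by rewrite gt_eqF ?subr_gt0.
rewrite /taylor2 /theta (eq_sym y x); case: eqVneq => [->|xy].
  by rewrite -powRN opprB; field; rewrite pn gt_eqF.
have [c cxy E] := powR_sub (p - 1) x0 y0 xy.
have c0 : 0 < c by have /andP[+ _] := cxy; apply: lt_trans; exact: min_gt0.
have E0 : x `^ (p - 1) - y `^ (p - 1) != 0.
  have cn : c `^ (p - 1 - 1) != 0 by rewrite gt_eqF ?powR_gt0.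
  by rewrite E !mulf_neq0// ?subr_eq0// gt_eqF ?subr_gt0.
have xn : x - y != 0 by rewrite subr_eq0.
have yn : y - x != 0 by rewrite subr_eq0 eq_sym.
by field; rewrite E0 pn xn yn gt_eqF.
Qed.

(** The weight of the inner product defined by [phi], with [x `^ p] and [y `^ p]
    for the eigenvalues of [sigma]. *)
Lemma phi_theta x y : 0 < x -> 0 < y ->
  y `^ p * phi p ((x / y) `^ p) = x * y / th x y.
Proof.
move=> x0 y0; have p0 : 0 < p by rewrite (lt_trans _ p1).
have y0' := lt0r_neq0 y0.
have ypE z : 0 < z -> z `^ p = z * z `^ (p - 1) by move=> z0; rewrite mulr_powRB1// ltW.
have xy1 : ((x / y) `^ p == 1) = (x == y).
  rewrite powR_eq1 ltNge divr_ge0 ?(ltW x0) ?(ltW y0)//= [p == 0]gt_eqF// orbF.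
  by rewrite -[in RHS](mul1r y) -{2}(mulfVK y0' x) (inj_eq (mulIf y0')).
have pK z : 0 < z -> (z `^ p) `^ p^-1 = z.
  by move=> z0; rewrite -powRrM mulfV ?gt_eqF// powRr1 ?ltW.
rewrite /phi /theta xy1 pK ?divr_gt0//.
case: eqVneq => [->|xy].
  rewrite mulr1 -powRN opprB -[X in X * _]expr2 -powR_mulrn ?ltW// -powRD; last first.
    by rewrite y0' implybT.
  by congr (_ `^ _); ring.
have yV : y^-1 `^ p = (y `^ p)^-1.
  by rewrite -(powR_inv1 (ltW y0)) -powRrM mulN1r powRN.
rewrite powRM ?invr_ge0 ?(ltW x0) ?(ltW y0)// yV !ypE//.
have [c cxy E] := powR_sub (p - 1) x0 y0 xy.
have c0 : 0 < c by have /andP[+ _] := cxy; apply: lt_trans; exact: min_gt0.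
have E0 : x `^ (p - 1) - y `^ (p - 1) != 0.
  have cn : c `^ (p - 1 - 1) != 0 by rewrite gt_eqF ?powR_gt0.
  by rewrite E !mulf_neq0// ?subr_eq0// gt_eqF ?subr_gt0.
have pn : p - 1 != 0 by rewrite gt_eqF ?subr_gt0.
have xn : x - y != 0 by rewrite subr_eq0.
have yn : y `^ (p - 1) != 0 by rewrite gt_eqF ?powR_gt0.
by field; do ?[apply/andP; split].
Qed.

End Kernels.

End ScalarCalculus.

(** * Lower bounds for energy integrals *)

Section EnergyIntegral.
Variable R : realType.
Local Notation mu := (@lebesgue_measure R).
Import HBNNSimple.

(** The supremum of simple functions that defines the integral of a nonnegative
    function is monotone whether or not the larger function is measurable. The
    larger function will be the energy density of a curve, which involves the
    inverse of the metric operator. *)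
Lemma ge0_le_subset_integral (d : measure_display) (T : measurableType d)
    (nu : {measure set T -> \bar R}) (D E : set T) (f g : T -> \bar R) : D `<=` E ->
  (forall x, D x -> (0 <= f x <= g x)%E) -> (forall x, E x -> (0 <= g x)%E) ->
  (\int[nu]_(x in D) f x <= \int[nu]_(x in E) g x)%E.
Proof.
move=> DE fg g0; rewrite !ge0_integralE//; last first.
  by move=> x Dx; have /andP[] := fg x Dx.
apply: ge_ereal_sup => _ [h/= hf] <-; apply: le_ereal_sup_tmp.
exists (sintegral nu h) => //; exists h => // x; apply: (le_trans (hf x)).
rewrite /patch; case: ifPn => [/[!inE] Dx|_].
  by rewrite mem_set; [have /andP[] := fg x Dx|exact: DE].
by case: ifPn => // /[!inE] Ex; exact: g0.
Qed.

(** The fundamental theorem of calculus applies to the smooth minorant; its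
    positive part is compared with [g] on the open interval. *)
Lemma integral_ge_increment (e : R) (g u du : R -> R) (M t : R) :
  0 < e -> 0 < t -> t <= 1 ->
  (forall s, - e < s < 1 + e -> is_derive s 1 u (du s)) ->
  (forall s, - e < s < 1 + e -> {for s, continuous du}) ->
  (forall s, 0 <= s <= 1 -> 0 <= g s) ->
  (forall s, 0 < s < 1 -> du s - M <= g s) ->
  ((u t - u 0 - M * t)%:E <= \int[mu]_(s in `[0%R, 1%R]) (g s)%:E)%E.
Proof.
move=> e0 t0 t1 hu cdu g0 hg.
have dom (s : R) : 0 <= s <= t -> - e < s < 1 + e.
  by move=> /andP[h1 h2]; apply/andP; split; lra.
pose f s := du s - M; pose F s := u s - M * s.
have dF (s : R) : - e < s < 1 + e -> is_derive s 1 F (f s).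
  move=> hs; have := hu s hs => hus; rewrite /F /f.
  by apply: is_derive_eq; rewrite /GRing.scale /= mulr1.
have cF (s : R) : 0 <= s <= t -> {for s, continuous F}.
  move=> /dom hs; apply: differentiable_continuous; apply/derivable1_diffP.
  by have [] := dF s hs.
have cf : {within `[0, t], continuous f}.
  apply: continuous_in_subspaceT => s; rewrite inE /= in_itv /= => /dom hs.
  by apply: cvgB; [exact: cdu|exact: cvg_cst].
have mf : mu.-integrable `[0, t] (EFin \o f).
  by apply: continuous_compact_integrable => //; exact: segment_compact.
have FTC : (\int[mu]_(s in `[0%R, t]) (f s)%:E = (F t)%:E - (F 0)%:E)%E.
  apply: continuous_FTC2 => //.
  - split.
    + move=> s; rewrite in_itv /= => /andP[s0 st].
      by have [] : is_derive s 1 F (f s) by apply: dF; apply: dom; rewrite !ltW.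
    + by apply: cvg_at_right_filter; apply: cF; rewrite lexx ltW.
    + by apply: cvg_at_left_filter; apply: cF; rewrite lexx ltW.
  - move=> s; rewrite in_itv /= => /andP[s0 st]; rewrite derive1E.
    by have [_] : is_derive s 1 F (f s) by apply: dF; apply: dom; rewrite !ltW.
have -> : u t - u 0 - M * t = F t - F 0 by rewrite /F; ring.
rewrite EFinB -FTC integralE.
apply: (@le_trans _ _ (integral mu `[0, t] (EFin \o f)^\+%E)).
  by rewrite geeDl// oppe_le0 integral_ge0.
rewrite (@integral_itv_bndoo _ _ _ _ true false); last first.
  apply: measurable_realfun.measurable_funepos; apply: measurable_funS (measurable_int _ mf) => //.
  exact: subset_itv_oo_cc.
apply: ge0_le_subset_integral => [s|s|s] /=; rewrite !in_itv /=.
- by move=> /andP[s0 st]; rewrite !ltW// (lt_le_trans st).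
- move=> /andP[s0 st]; rewrite funepos_ge0 /= funeposE -EFin_max lee_fin.
  have s1 : s < 1 by rewrite (lt_le_trans st).
  by rewrite ge_max hg ?g0 ?s0 ?s1 ?ltW.
- by move=> hs; rewrite lee_fin g0.
Qed.

End EnergyIntegral.

(** * Functionals conserved by a semigroup *)

Section Invariance.
Variable R : realType.
Import Normc.

Lemma cvg0_sum T (F : set_system T) (FF : Filter F) (I : finType) (f : I -> T -> R) :
  (forall i, f i t @[t --> F] --> 0) -> (\sum_i f i t) @[t --> F] --> (0 : R).
Proof.
move=> h; elim: (index_enum I) => [|i r IHr].
  by under eq_fun do rewrite big_nil; exact: cvg_cst.
under eq_fun do rewrite big_cons.
have := cvgD (h i) IHr; rewrite addr0 => H; exact: H.
Qed.

Lemma normc_le_ReIm (z : R[i]) : normc z <= `|complex.Re z| + `|complex.Im z|.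
Proof.
have -> : z = (complex.Re z)%:C + 'i%C * (complex.Im z)%:C by exact: complexE.
rewrite (le_trans (le_normcD _ _))// normcM !normc_real.
have -> : normc ('i%C : R[i]) = 1.
  by rewrite /normc expr0n add0r expr1n sqrtr1.
by rewrite mul1r -complexE.
Qed.

Lemma mxcvg_N1 T (F : set_system T) (FF : Filter F) n (f : T -> 'M[R[i]]_n) A :
  mxcvg F f A -> N1 (f t - A) @[t --> F] --> (0 : R).
Proof.
move=> h; rewrite /N1; apply: cvg0_sum => i; apply: cvg0_sum => j.
have [hr hi] := h i j.
apply: (@squeeze_cvgr _ _ _ _ (cst 0) (fun t =>
  `|complex.Re (f t i j) - complex.Re (A i j)| +
  `|complex.Im (f t i j) - complex.Im (A i j)|)).
- near=> t; rewrite normc_ge0 /= (le_trans (normc_le_ReIm _))//.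
  by rewrite !mxE !raddfB.
- exact: cvg_cst.
have cvg0 (u : T -> R) l : u t @[t --> F] --> l -> `|u t - l| @[t --> F] --> (0 : R).
  by move=> hu; have := cvg_norm (cvgB hu (cvg_cst l)); rewrite subrr normr0 => H; exact: H.
have := cvgD (cvg0 _ _ hr) (cvg0 _ _ hi); rewrite addr0 => H; exact: H.
Unshelve. all: by end_near. Qed.

Lemma mx_expand n (Phi : {linear 'M[R[i]]_n -> 'M[R[i]]_n}) X :
  Phi X = \sum_i \sum_j X i j *: Phi (delta_mx i j).
Proof.
rewrite {1}(matrix_sum_delta X) linear_sum; apply: eq_bigr => i _.
by rewrite linear_sum; apply: eq_bigr => j _; rewrite linearZ.
Qed.

Lemma N1_linear n (Phi : {linear 'M[R[i]]_n -> 'M[R[i]]_n}) X :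
  N1 (Phi X) <= N1 X * \sum_i \sum_j N1 (Phi (delta_mx i j)).
Proof.
rewrite mx_expand (le_trans (N1_sum _ _ _))//.
rewrite mulr_sumr; apply: ler_sum => i _; rewrite (le_trans (N1_sum _ _ _))//.
rewrite mulr_sumr; apply: ler_sum => j _.
by rewrite N1Z ler_wpM2r ?N1_ge0// normc_entry_le.
Qed.

Variable d : nat.
Variables (P : R -> {linear 'M[R[i]]_d -> 'M[R[i]]_d}).
Variables (L : {linear 'M[R[i]]_d -> 'M[R[i]]_d}).
Hypotheses (qmsP : is_qms P) (genL : is_generator P L).

(** The pointwise definition of the generator is uniform on bounded sets,
    because the matrix units span a finite-dimensional space. *)
Lemma generator_uniform (e : R) : 0 < e -> exists2 del, 0 < del &
  forall h, 0 < h < del -> forall X, N1 (P h X - X - h%:C *: L X) <= h * (e * N1 X).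
Proof.
move=> e0.
pose K h := \sum_i \sum_j N1 ((h^-1)%:C *: (P h (delta_mx i j) - delta_mx i j)
  - L (delta_mx i j)).
have K0 : K h @[h --> 0^'+] --> (0 : R).
  by do 2!apply: cvg0_sum => ?; apply: mxcvg_N1; exact: genL.
have : \forall h \near 0^'+, `|K h| <= e by exact: cvgr0_norm_le.
rewrite near_withinE => /nbhs_ballP[del /= del0 hdel].
exists del => // h /andP[h0 hd] X; have hK : K h <= e.
  rewrite (le_trans (ler_norm _))//; apply: hdel => //=.
  by rewrite /ball /= sub0r normrN gtr0_norm.
have hn0 : (h%:C : R[i]) != 0 by rewrite fmorph_eq0 gt_eqF.
rewrite (_ : _ - _ = h%:C *: \sum_i \sum_j X i j *:
    ((h^-1)%:C *: (P h (delta_mx i j) - delta_mx i j) - L (delta_mx i j))); last first.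
  rewrite [in P h X]mx_expand [in L X]mx_expand [in X in _ - X - _](matrix_sum_delta X).
  rewrite -sumrB scaler_sumr -sumrB scaler_sumr; apply: eq_bigr => i _.
  rewrite -sumrB scaler_sumr -sumrB scaler_sumr; apply: eq_bigr => j _.
  have hXh : h%:C * X i j * (h^-1)%:C = X i j.
    by rewrite mulrAC fmorphV mulfV// mul1r.
  by rewrite !scalerBr !scalerA ?mulrA hXh.
rewrite N1Z normc_real gtr0_norm// ler_pM2l//.
apply: (@le_trans _ _ (N1 X * K h)); last by rewrite mulrC ler_wpM2r ?N1_ge0.
rewrite (le_trans (N1_sum _ _ _))// /K mulr_sumr; apply: ler_sum => i _.
rewrite (le_trans (N1_sum _ _ _))// mulr_sumr; apply: ler_sum => j _.
by rewrite N1Z ler_wpM2r ?N1_ge0// normc_entry_le.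
Qed.

Lemma qms_iter h k X : 0 <= h -> P (k%:R * h) X = iter k (P h) X.
Proof.
move=> h0; elim: k => [|k IHk]; first by rewrite mul0r (qms0 qmsP).
by rewrite -natr1 mulrDl mul1r addrC (qmsD qmsP) ?mulr_ge0// IHk.
Qed.

(** Over [n] steps of length [t / n], a functional that annihilates the range of
    the generator changes by [n] times [o(t / n)]: the iterates stay bounded,
    since one step expands norms by at most [1 + C t / n]. *)
Lemma generator_invariant rho : (forall X, hs (L X) rho = 0) ->
  forall t, 0 <= t -> hsadj (P t) rho = rho.
Proof.
move=> hL t t0; apply: hs_nondegr => X; rewrite -hsadjP.
move: t0; rewrite le_eqVlt => /orP[/eqP<-|t0]; first by rewrite (qms0 qmsP).
pose l := \sum_i \sum_j N1 (L (delta_mx i j)).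
have l0 : 0 <= l by do 2!(apply: sumr_ge0 => ? _); apply: N1_ge0.
pose B := expR (t * (1 + l)) * N1 X.
have B0 : 0 <= B by rewrite mulr_ge0 ?expR_ge0 ?N1_ge0.
have key (e : R) : 0 < e -> e <= 1 ->
    normc (hs (P t X) rho - hs X rho) <= e * (t * B * N1 rho).
  move=> e0 e1; have [del del0 hdel] := generator_uniform e0.
  have [n hn] : exists n : nat, t / del < n.+1%:R.
    exists (Num.bound (t / del)); apply: lt_le_trans (archi_boundP _) _.
      by rewrite divr_ge0// ltW.
    by rewrite ler_nat.
  pose h := t / n.+1%:R; have h0 : 0 < h by rewrite divr_gt0.
  have hh : 0 < h < del.
    by rewrite h0 /= /h ltr_pdivrMr// mulrC -ltr_pdivrMr.
  have hn1 : n.+1%:R * h = t by rewrite /h mulrC divfK// pnatr_eq0.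
  have step Y : N1 (P h Y) <= (1 + h * (1 + l)) * N1 Y.
    have -> : P h Y = (P h Y - Y - h%:C *: L Y) + (Y + h%:C *: L Y).
      by rewrite -[P h Y - Y - _]addrA -opprD subrK.
    rewrite (le_trans (N1D _ _))// (le_trans (lerD (hdel h hh Y) (N1D _ _)))//.
    rewrite N1Z normc_real gtr0_norm//.
    have LY : N1 (L Y) <= N1 Y * l by exact: N1_linear.
    have q1 : h * (e * N1 Y) <= h * N1 Y.
      by rewrite ler_pM2l// ler_piMl ?N1_ge0.
    have q2 : h * N1 (L Y) <= h * (N1 Y * l) by rewrite ler_pM2l.
    by rewrite mulrDl mul1r; lra.
  have bound k : (k <= n.+1)%N -> N1 (iter k (P h) X) <= B.
    move=> kn; apply: (@le_trans _ _ ((1 + h * (1 + l)) ^+ k * N1 X)).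
      elim: k {kn} => [|k IHk]; first by rewrite mul1r.
      rewrite iterS (le_trans (step _))// exprS -mulrA ler_wpM2l// addr_ge0//.
      by rewrite mulr_ge0 ?addr_ge0// ltW.
    rewrite ler_wpM2r ?N1_ge0//.
    apply: (@le_trans _ _ (expR (h * (1 + l)) ^+ k)).
      by rewrite lerXn2r ?nnegrE ?expR_ge0 ?expR_ge1Dx// addr_ge0// mulr_ge0 ?addr_ge0// ltW.
    rewrite -expRM_natl ler_expR mulrA ler_wpM2r ?addr_ge0//.
    by rewrite -[leRHS]hn1 ler_wpM2r ?ler_nat// ltW.
  rewrite -hn1 (qms_iter _ _ (ltW h0)).
  have inc k : (k <= n.+1)%N ->
      normc (hs (iter k (P h) X) rho - hs X rho) <= k%:R * (h * (e * B) * N1 rho).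
    elim: k => [_|k IHk kn]; first by rewrite subrr (@normc0 R) mul0r.
    rewrite -natr1 mulrDl mul1r.
    have -> : hs (iter k.+1 (P h) X) rho - hs X rho =
        (hs (iter k (P h) X) rho - hs X rho) +
        hs (P h (iter k (P h) X) - iter k (P h) X - h%:C *: L (iter k (P h) X)) rho.
      by rewrite iterS [in RHS]hsBl [in RHS]hsBl hsZl hL mulr0 subr0; ring.
    rewrite (le_trans (le_normcD _ _))// lerD ?IHk ?(ltnW kn)//.
    rewrite (le_trans (normc_hs _ _))// ler_wpM2r ?N1_ge0//.
    rewrite (le_trans (hdel _ hh _))// ler_pM2l// ler_pM2l//.
    by rewrite bound// ltnW.
  rewrite (le_trans (inc _ (leqnn _)))// hn1.
  have -> : n.+1%:R * (h * (e * B) * N1 rho) = e * (n.+1%:R * h * B * N1 rho) by ring.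
  by rewrite hn1.
apply/subr0_eq/eq0_normc/eqP; rewrite eq_le normc_ge0 andbT.
set x := normc _; set C := t * B * N1 rho.
have C0 : 0 <= C by rewrite mulr_ge0 ?N1_ge0// mulr_ge0// ltW.
rewrite leNgt; apply/negP => x0.
pose e := Num.min 1 (x / (2 * (C + 1))).
have e0 : 0 < e by rewrite lt_min ltr01 divr_gt0// mulr_gt0// ltr_pwDr.
have := key e e0; rewrite ge_min lexx => /(_ isT); apply/negP; rewrite -ltNge.
apply: (@le_lt_trans _ _ (x / (2 * (C + 1)) * C)).
  by rewrite ler_wpM2r// ge_min lexx orbT.
by rewrite mulrAC ltr_pdivrMr ?mulr_gt0 ?ltr_pwDr// ltr_pM2l//; lra.
Qed.

End Invariance.

(** * Positive matrices and Schur multipliers *)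

Section Positivity.
Variable R : realType.

Lemma resol_rowE n (A : 'M[R[i]]_n) i : A \is hermsymmx ->
  let r := row i (spectralmx A) in r *m A *m r^t* = (eigval A i)%:C%:M.
Proof.
move=> hA r; have rA := resol_eproj hA.
have -> : r *m A = (eigval A i)%:C *: r.
  have -> : r = r *m eproj A i.
    by rewrite /eproj mulmxA row_spectralM eqxx mul1mx.
  by rewrite -mulmxA (resol_mull rA) -scalemxAr.
by rewrite -scalemxAl row_spectralM eqxx scalemx1.
Qed.

Lemma psd_eigval_ge0 n (A : 'M[R[i]]_n) i : psdmx A -> 0 <= eigval A i.
Proof.
move=> [hA pA]; have := pA ((row i (spectralmx A))^t*).
by rewrite trmxCK resol_rowE// mxE eqxx mulr1n lecR.
Qed.

Lemma psd_eigval_gt0 n (A : 'M[R[i]]_n) i : psdmx A -> \rank A = n ->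
  0 < eigval A i.
Proof.
move=> pA rkA; rewrite lt_def psd_eigval_ge0// andbT.
have hA := pA.1; apply/eqP => a0.
have uA : A \in unitmx by rewrite -row_free_unit /row_free rkA.
have := resol_mulr (resol_eproj hA) i; rewrite a0 scale0r => /(congr1 (mulmx (invmx A))).
rewrite mulKmx// mulmx0 => P0; have := N1_eproj_ge1 i hA.
by rewrite P0 N10 ler10.
Qed.

Lemma psd_conj m n (A : 'M[R[i]]_n) (S : 'M[R[i]]_(n, m)) :
  psdmx A -> psdmx (S^t* *m A *m S).
Proof.
move=> [hA pA]; split=> [|v].
  by apply/hermP; rewrite !adjM trmxCK (proj1 (hermP _) hA) mulmxA.
by have := pA (S *m v); rewrite adjM !mulmxA.
Qed.

Lemma resol_gt0_psd (I : finType) n (A : 'M[R[i]]_n) a P (rA : @resol R I n A a P) :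
  (forall i, 0 < a i) -> psdmx A /\ \rank A = n.
Proof.
move=> a0; split; first split.
- by apply/hermP; exact: resol_hermsym rA.
- move=> v; rewrite (resolE rA) mulmx_sumr mulmx_suml summxE sumr_ge0// => i _.
  rewrite -scalemxAr -scalemxAl mxE mulr_ge0 ?lecR ?(ltW (a0 i))//.
  have -> : v^t* *m P i *m v = (P i *m v)^t* *m (P i *m v).
    by rewrite adjM (resol_herm rA) mulmxA -[_ *m P i *m P i]mulmxA (resol_mul rA) eqxx.
  by have := hs_ge0 (P i *m v); rewrite /hs /mxtrace big_ord1.
apply: mxrank_unit; pose B := \sum_i (a i)^-1%:C *: P i.
suff /mulmx1_unit[] : A *m B = 1%:M by [].
rewrite /B mulmx_sumr -(resol_sum1 rA); apply: eq_bigr => i _.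
rewrite -scalemxAr (resol_mulr rA) scalerA -rmorphM mulVf ?scale1r//.
by rewrite gt_eqF.
Qed.

Lemma tr_eproj n (A : 'M[R[i]]_n) i : \tr (eproj A i) = 1.
Proof. by rewrite /eproj mxtrace_mulC row_spectralM eqxx mxtrace1. Qed.

Lemma eigval_le_trace n (A : 'M[R[i]]_n) i : psdmx A ->
  eigval A i <= complex.Re (\tr A).
Proof.
move=> pA; have hA := pA.1; have rA := resol_eproj hA.
rewrite [X in \tr X](resolE rA) tr_sum raddf_sum /=.
rewrite (eq_bigr (eigval A)) => [|k _].
  by rewrite (bigD1 i)//= lerDl sumr_ge0// => k _; exact: psd_eigval_ge0.
by rewrite mxtraceZ tr_eproj mulr1.
Qed.

(** Positive definiteness by eigenvalues, the form in which functions on the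
    positive reals are applied to a matrix. *)
Definition pdmx n (A : 'M[R[i]]_n) : Prop :=
  A \is hermsymmx /\ forall i, 0 < eigval A i.

Lemma full_density_pd n (A : 'M[R[i]]_n) : full_density A -> pdmx A.
Proof.
move=> [[pA _] rkA]; split; first exact: pA.1.
by move=> i; exact: psd_eigval_gt0.
Qed.

Lemma pd_psd n (A : 'M[R[i]]_n) : pdmx A -> psdmx A /\ \rank A = n.
Proof. by move=> [hA a0]; exact: (resol_gt0_psd (resol_eproj hA) a0). Qed.

Lemma pd_conj n (A S : 'M[R[i]]_n) : pdmx A -> S \in unitmx -> S^t* = S ->
  pdmx (S *m A *m S).
Proof.
move=> pA uS hS; have [psA rkA] := pd_psd pA.
have psSA : psdmx (S *m A *m S) by rewrite -[X in X *m A]hS; exact: psd_conj.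
split; first exact: psSA.1.
move=> i; apply: psd_eigval_gt0 => //.
by rewrite mxrankMfree ?row_free_unit// -mxrank_tr trmx_mul mxrankMfree
  ?row_free_unit ?unitmx_tr// mxrank_tr.
Qed.

Lemma pdZ n (A : 'M[R[i]]_n) (c : R) : 0 < c -> pdmx A -> pdmx (c%:C *: A).
Proof.
move=> c0 [hA a0]; have rA := resolZ (resol_eproj hA) c.
have [ps rk] := resol_gt0_psd rA (fun i => mulr_gt0 c0 (a0 i)).
by split; [exact: ps.1|move=> i; exact: psd_eigval_gt0].
Qed.

End Positivity.

Section SchurMultipliers.
Variables (R : realType) (n : nat).
Implicit Types (A B X Y V : 'M[R[i]]_n) (f g : R -> R -> R).

Lemma hs_mxfun2 f A B X Y : A \is hermsymmx -> B \is hermsymmx ->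
  hs X (mxfun2 f A B Y) = hs (mxfun2 f A B X) Y.
Proof.
move=> /resol_eproj rA /resol_eproj rB.
rewrite /mxfun2.
move: (eigval A) (eproj A) (eigval B) (eproj B) rA rB => a P b Q rA rB.
rewrite hs_sumr hs_suml; apply: eq_bigr => i _.
rewrite hs_sumr hs_suml; apply: eq_bigr => k _.
by rewrite hsZr hsZl hs_mulr hs_mull (resol_herm rA) (resol_herm rB) -[in LHS]mulmxA.
Qed.

Lemma mxfun2_adj f A B X : A \is hermsymmx -> B \is hermsymmx ->
  (mxfun2 f A B X)^t* = mxfun2 (fun x y => f y x) B A (X^t*).
Proof.
move=> /resol_eproj rA /resol_eproj rB.
rewrite /mxfun2.
move: (eigval A) (eproj A) (eigval B) (eproj B) rA rB => a P b Q rA rB.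
rewrite adj_sum exchange_big; apply: eq_bigr => i _ /=.
rewrite adj_sum; apply: eq_bigr => k _.
by rewrite adjZ !adjM (resol_herm rA) (resol_herm rB) mulmxA.
Qed.

Lemma mxfun2D f A B X Y : mxfun2 f A B (X + Y) = mxfun2 f A B X + mxfun2 f A B Y.
Proof.
rewrite /mxfun2 -big_split; apply: eq_bigr => i _.
rewrite -big_split; apply: eq_bigr => k _.
by rewrite mulmxDr mulmxDl scalerDr.
Qed.

Lemma mxfun2Z f A B (c : R[i]) X : mxfun2 f A B (c *: X) = c *: mxfun2 f A B X.
Proof.
rewrite /mxfun2 scaler_sumr; apply: eq_bigr => i _.
rewrite scaler_sumr; apply: eq_bigr => k _.
by rewrite -scalemxAr -scalemxAl !scalerA mulrC.
Qed.

Lemma mxfun2B f A B X Y : mxfun2 f A B (X - Y) = mxfun2 f A B X - mxfun2 f A B Y.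
Proof. by rewrite mxfun2D -scaleN1r mxfun2Z scaleN1r. Qed.

(** In the eigenbases the double calculus is a weighted Hilbert-Schmidt norm, so
    that bounds on the weights are bounds on the form. *)
Lemma mxfun2_form f A B Y : A \is hermsymmx -> B \is hermsymmx ->
  hs Y (mxfun2 f A B Y) = \sum_i \sum_k (f (eigval A i) (eigval B k))%:C *
    hs (eproj A i *m Y *m eproj B k) (eproj A i *m Y *m eproj B k).
Proof.
move=> /resol_eproj rA /resol_eproj rB.
rewrite /mxfun2.
move: (eigval A) (eproj A) (eigval B) (eproj B) rA rB => a P b Q rA rB.
rewrite hs_sumr; apply: eq_bigr => i _.
rewrite hs_sumr; apply: eq_bigr => k _; rewrite hsZr; congr (_ * _).
rewrite hs_mulr hs_mull (resol_herm rA) (resol_herm rB).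
by rewrite !mulmxA (resol_mul rA) eqxx -!mulmxA (resol_mul rB) eqxx.
Qed.

Lemma mxfun2_form_sum A B Y : A \is hermsymmx -> B \is hermsymmx ->
  \sum_i \sum_k hs (eproj A i *m Y *m eproj B k) (eproj A i *m Y *m eproj B k) = hs Y Y.
Proof.
move=> hA hB; have rA := resol_eproj hA; have rB := resol_eproj hB.
have := mxfun2_form (fun _ _ => 1) Y hA hB.
under [X in _ = X -> _]eq_bigr do under eq_bigr do rewrite mul1r.
move=> <-; congr (hs Y _); rewrite /mxfun2.
move: (eigval A) (eproj A) (eigval B) (eproj B) rA rB => a P b Q rA rB.
rewrite [RHS](resol_expand rA).
apply: eq_bigr => i _; rewrite [RHS](resol_expandr rB); apply: eq_bigr => k _.
by rewrite scale1r.
Qed.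

Lemma mxfun2_form_le f A B Y (M : R) : A \is hermsymmx -> B \is hermsymmx ->
  (forall i k, f (eigval A i) (eigval B k) <= M) ->
  complex.Re (hs Y (mxfun2 f A B Y)) <= M * complex.Re (hs Y Y).
Proof.
move=> hA hB fM; rewrite mxfun2_form// -(mxfun2_form_sum Y hA hB).
rewrite !raddf_sum mulr_sumr; apply: ler_sum => i _.
rewrite !raddf_sum mulr_sumr; apply: ler_sum => k _ /=.
have := hs_ge0 (eproj A i *m Y *m eproj B k).
case: (hs _ _) => a b; rewrite lecE /= => /andP[_ a0].
by rewrite mul0r subr0 ler_wpM2r.
Qed.

Lemma mxfun2_form_ge0 f A B Y : A \is hermsymmx -> B \is hermsymmx ->
  (forall i k, 0 < f (eigval A i) (eigval B k)) ->
  0 <= hs Y (mxfun2 f A B Y).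
Proof.
move=> hA hB f0; rewrite mxfun2_form// sumr_ge0// => i _; rewrite sumr_ge0// => k _.
by rewrite mulr_ge0 ?hs_ge0// lecR ltW.
Qed.

Lemma mxfun2_form_eq0 f A B Y : A \is hermsymmx -> B \is hermsymmx ->
  (forall i k, 0 < f (eigval A i) (eigval B k)) ->
  hs Y (mxfun2 f A B Y) = 0 -> Y = 0.
Proof.
move=> hA hB f0; have ge0 i k : 0 <= (f (eigval A i) (eigval B k))%:C *
    hs (eproj A i *m Y *m eproj B k) (eproj A i *m Y *m eproj B k).
  by rewrite mulr_ge0 ?hs_ge0// lecR ltW.
rewrite mxfun2_form// => /eqP; rewrite psumr_eq0 => [/allP h|i _]; last exact: sumr_ge0.
apply: hs_eq0; rewrite -(mxfun2_form_sum Y hA hB) big1// => i _; rewrite big1// => k _.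
have := h i (mem_index_enum _); rewrite psumr_eq0//.
move=> /allP/(_ k (mem_index_enum _)); rewrite mulf_eq0 fmorph_eq0 gt_eqF//=.
by move=> /eqP.
Qed.

Variable sigma : 'M[R[i]]_n.
Hypothesis pdS : pdmx sigma.
Let rS := resol_eproj pdS.1.
(* [SM f] multiplies the entries in the eigenbasis of [sigma] by weights that
   depend on the eigenvalues; these maps commute with each other. *)
Local Notation SM f := (mxfun2 f sigma sigma).

Lemma schur_ext f g X : (forall s t, 0 < s -> 0 < t -> f s t = g s t) ->
  SM f X = SM g X.
Proof.
by move=> fg; apply: eq_bigr => i _; apply: eq_bigr => k _; rewrite fg ?pdS.2.
Qed.

Lemma schur1 f X : (forall s t, 0 < s -> 0 < t -> f s t = 1) -> SM f X = X.
Proof.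
move=> f1; rewrite [RHS](resol_expand rS); apply: eq_bigr => i _.
rewrite [RHS](resol_expandr rS); apply: eq_bigr => k _.
by rewrite f1 ?scale1r ?pdS.2.
Qed.

Lemma schur_comp f g X : SM f (SM g X) = SM (fun s t => f s t * g s t) X.
Proof.
rewrite /mxfun2; move: (eigval sigma) (eproj sigma) rS => s P r.
apply: eq_bigr => i _; apply: eq_bigr => k _.
rewrite mulmx_sumr mulmx_suml (bigD1 i)//= [X in _ *: (_ + X)]big1 ?addr0.
  rewrite mulmx_sumr mulmx_suml (bigD1 k)//= big1 ?addr0 => [|l lk].
    rewrite -scalemxAr -scalemxAl scalerA rmorphM; congr (_ *: _).
    by rewrite !mulmxA (resol_mul r) eqxx -!mulmxA (resol_mul r) eqxx.
  by rewrite -scalemxAr -scalemxAl -!mulmxA (resol_mul r) (negbTE lk) !mulmx0 scaler0.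
move=> j ji; rewrite mulmx_sumr mulmx_suml big1// => l _.
by rewrite -scalemxAr -scalemxAl !mulmxA (resol_mul r) eq_sym (negbTE ji) !mul0mx scaler0.
Qed.

(** A [sigma]-modular matrix only connects eigenspaces whose eigenvalues have a
    fixed ratio, so that multiplying by it shifts the argument of a Schur
    multiplier. *)
Lemma modular_block (r : R) V i k : sigma *m V = r%:C *: (V *m sigma) ->
  eigval sigma i != r * eigval sigma k -> eproj sigma i *m V *m eproj sigma k = 0.
Proof.
move: (eigval sigma) (eproj sigma) rS => s P rS' hV ne; have := congr1 (fun Z => P i *m Z *m P k) hV.
rewrite /= !mulmxA (resol_mull rS') -scalemxAr -!scalemxAl !mulmxA.
rewrite -[X in _ = _ *: X]mulmxA (resol_mulr rS') -scalemxAr scalerA -rmorphM.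
move=> /eqP; rewrite -subr_eq0 -scalerBl -rmorphB scaler_eq0 fmorph_eq0 subr_eq0.
by rewrite (negbTE ne) /= => /eqP.
Qed.

Lemma schur_mull (r : R) V f X : 0 < r -> sigma *m V = r%:C *: (V *m sigma) ->
  V *m SM f X = SM (fun s t => f (s / r) t) (V *m X).
Proof.
move=> r0 hV; have := fun i k => @modular_block _ _ i k hV.
rewrite /mxfun2; move: (eigval sigma) (eproj sigma) rS => s P rS' blk.
transitivity (\sum_i \sum_m \sum_k (f (s m) (s k))%:C *:
    (P i *m V *m P m *m X *m P k)).
  rewrite [LHS](resol_expand rS'); apply: eq_bigr => i _.
  rewrite !mulmx_sumr; apply: eq_bigr => m _.
  rewrite !mulmx_sumr; apply: eq_bigr => k _.
  by rewrite -!scalemxAr !mulmxA.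
apply: eq_bigr => i _; rewrite exchange_big; apply: eq_bigr => k _ /=.
rewrite [in RHS](resol_expand rS' X) mulmx_sumr mulmx_sumr mulmx_suml scaler_sumr.
apply: eq_bigr => m _; rewrite !mulmxA.
have [->|ne] := eqVneq (s i) (r * s m).
  by rewrite mulrAC mulfV ?mul1r// gt_eqF.
by rewrite (blk _ _ ne) !mul0mx !scaler0.
Qed.

Lemma schur_mulr (r : R) V f X : sigma *m V = r%:C *: (V *m sigma) ->
  SM f X *m V = SM (fun s t => f s (r * t)) (X *m V).
Proof.
move=> hV; have := fun i k => @modular_block _ _ i k hV.
rewrite /mxfun2; move: (eigval sigma) (eproj sigma) rS => s P rS' blk.
transitivity (\sum_i \sum_k \sum_m (f (s i) (s m))%:C *:
    (P i *m X *m (P m *m V *m P k))).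
  rewrite mulmx_suml; apply: eq_bigr => i _.
  rewrite [RHS]exchange_big mulmx_suml; apply: eq_bigr => m _ /=.
  rewrite [LHS](resol_expandr rS'); apply: eq_bigr => k _.
  by rewrite -!scalemxAl !mulmxA.
apply: eq_bigr => i _; apply: eq_bigr => k _.
rewrite [in RHS](resol_expand rS' V) mulmx_sumr mulmx_sumr mulmx_suml scaler_sumr.
apply: eq_bigr => m _; rewrite !mulmxA.
have [->//|ne] := eqVneq (s m) (r * s k).
have := blk _ _ ne; rewrite -!mulmxA => ->.
by rewrite !mulmx0 !scaler0.
Qed.

End SchurMultipliers.

(** * The metric and the generator at the invariant state *)

Section AtInvariantState.
Variables (R : realType) (n : nat) (sigma : 'M[R[i]]_n).
Hypothesis pdS : pdmx sigma.
Implicit Types (X Y V : 'M[R[i]]_n).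
Let rS := resol_eproj pdS.1.
Let hS := pdS.1.
Local Notation SM f := (mxfun2 f sigma sigma).

Lemma mxpow_herm r : (mxpow sigma r)^t* = mxpow sigma r.
Proof. exact: resol_hermsym (resol_of_mxfun rS _). Qed.

Lemma mxpow_unit r : mxpow sigma r \in unitmx.
Proof.
have rP := resol_of_mxfun rS (fun x => x `^ r).
have [_ rk] := resol_gt0_psd rP (fun i => powR_gt0 _ (pdS.2 i)).
by rewrite -row_free_unit /row_free rk.
Qed.

Lemma sigma_unit : sigma \in unitmx.
Proof. by rewrite -row_free_unit /row_free (pd_psd pdS).2. Qed.

Lemma mxfun2_mulmx (f g : R -> R) X :
  SM (fun a b => f a * g b) X = mxfun f sigma *m X *m mxfun g sigma.
Proof.
rewrite /mxfun2 /mxfun; move: (eigval sigma) (eproj sigma) => s P.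
rewrite mulmx_suml mulmx_suml; apply: eq_bigr => i _.
rewrite mulmx_sumr; apply: eq_bigr => k _.
by rewrite rmorphM -!scalemxAl -scalemxAr scalerA mulrC.
Qed.

Lemma GamE t X : Gam sigma t X = SM (fun a b => a `^ (t / 2) * b `^ (t / 2)) X.
Proof. by rewrite mxfun2_mulmx. Qed.

Lemma GamD t X Y : Gam sigma t (X + Y) = Gam sigma t X + Gam sigma t Y.
Proof. by rewrite !GamE mxfun2D. Qed.

Lemma GamB t X Y : Gam sigma t (X - Y) = Gam sigma t X - Gam sigma t Y.
Proof. by rewrite !GamE mxfun2B. Qed.

Lemma GamZ t a X : Gam sigma t (a *: X) = a *: Gam sigma t X.
Proof. by rewrite !GamE mxfun2Z. Qed.

Lemma Gam_sum t I (r : seq I) (F : I -> 'M[R[i]]_n) :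
  Gam sigma t (\sum_(i <- r) F i) = \sum_(i <- r) Gam sigma t (F i).
Proof.
elim: r => [|i r IHr]; first by rewrite !big_nil /Gam mulmx0 mul0mx.
by rewrite !big_cons GamD IHr.
Qed.

Lemma Gam_adj t X : (Gam sigma t X)^t* = Gam sigma t (X^t*).
Proof. by rewrite /Gam !adjM mxpow_herm mulmxA. Qed.

Lemma hs_Gam t X Y : hs X (Gam sigma t Y) = hs (Gam sigma t X) Y.
Proof. by rewrite !GamE hs_mxfun2. Qed.

Lemma powRDr (a r s : R) : 0 < a -> a `^ r * a `^ s = a `^ (r + s).
Proof. by move=> a0; rewrite powRD// (lt0r_neq0 a0) implybT. Qed.

Lemma GamK t u X : Gam sigma t (Gam sigma u X) = Gam sigma (t + u) X.
Proof.
rewrite !GamE schur_comp//; apply: schur_ext => // a b a0 b0.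
by rewrite mulrACA !powRDr// -mulrDl.
Qed.

Lemma Gam0 X : Gam sigma 0 X = X.
Proof. by rewrite GamE; apply: schur1 => // a b a0 b0; rewrite mul0r !powRr0 mulr1. Qed.

Lemma Gam_inj t X : Gam sigma t X = 0 -> X = 0.
Proof.
move=> h; have := GamK (- t) t X; rewrite h addNr Gam0 => <-.
by rewrite /Gam mulmx0 mul0mx.
Qed.

Lemma pd_Gam t X : pdmx X -> pdmx (Gam sigma t X).
Proof. by move=> pX; apply: pd_conj; [|exact: mxpow_unit|exact: mxpow_herm]. Qed.

Lemma N1_Gam t : exists2 C, 0 < C & forall X, N1 (Gam sigma t X) <= C * N1 X.
Proof.
pose c := N1 (mxpow sigma (t / 2)); exists (c * c + 1).
  by rewrite ltr_wpDl// mulr_ge0 ?N1_ge0.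
move=> X; apply: (@le_trans _ _ (c * c * N1 X)).
  rewrite (le_trans (N1M _ _))// mulrAC ler_wpM2r ?N1_ge0//.
  by rewrite (le_trans (N1M _ _)).
by rewrite ler_wpM2r ?N1_ge0// lerDl.
Qed.

Lemma mxfunM (f g : R -> R) : mxfun f sigma *m mxfun g sigma = mxfun (fun a => f a * g a) sigma.
Proof.
rewrite [in mxfun g sigma]/mxfun mulmx_sumr; apply: eq_bigr => i _.
by rewrite -scalemxAr (resol_mulr (resol_of_mxfun rS f)) scalerA -rmorphM mulrC.
Qed.

Lemma mxfun_ext (f g : R -> R) : (forall a, 0 < a -> f a = g a) ->
  mxfun f sigma = mxfun g sigma.
Proof. by move=> fg; apply: eq_bigr => i _; rewrite fg ?pdS.2. Qed.

Lemma resol_Gam t : resol (Gam sigma t sigma)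
  (fun i => eigval sigma i `^ (1 + t)) (eproj sigma).
Proof.
have -> : Gam sigma t sigma = mxfun (fun a => a `^ (1 + t)) sigma.
  have sE : sigma = mxfun id sigma by rewrite (resol_mxfun rS) -(resolE rS).
  rewrite /Gam {2}sE !mxfunM; apply: mxfun_ext => a a0.
  by rewrite -{2}(powRr1 (ltW a0)) !powRDr//; congr (_ `^ _); field.
exact: (resol_of_mxfun rS).
Qed.

Lemma modular_adj (r : R) V : 0 < r -> sigma *m V = r%:C *: (V *m sigma) ->
  sigma *m V^t* = r^-1%:C *: (V^t* *m sigma).
Proof.
move=> r0 /(congr1 (fun Z => Z^t*)); rewrite adjM adjZ adjM (proj1 (hermP _) hS) => ->.
by rewrite scalerA -rmorphM mulVf ?scale1r// gt_eqF.
Qed.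

(** Modular matrices commute with conjugation by the square root of [sigma] up to
    a constant. *)
Lemma Gam_mull (r : R) V X : 0 < r -> sigma *m V = r%:C *: (V *m sigma) ->
  Gam sigma 1 (V *m X) = (r `^ 2^-1)%:C *: (V *m Gam sigma 1 X).
Proof.
move=> r0 hV; have rn : (r `^ 2^-1)%:C != 0 :> R[i].
  by rewrite fmorph_eq0 gt_eqF ?powR_gt0.
rewrite [in RHS]GamE (schur_mull pdS _ _ r0 hV) GamE.
rewrite -mxfun2Z /mxfun2; apply: eq_bigr => i _; apply: eq_bigr => k _.
rewrite -scalemxAr -scalemxAl scalerA -rmorphM; congr (_%:C *: _).
rewrite powRM ?invr_ge0 ?(ltW r0) ?(ltW (pdS.2 _))// mul1r.
have rV : r^-1 `^ 2^-1 = (r `^ 2^-1)^-1.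
  by rewrite -(powR_inv1 (ltW r0)) -powRrM mulN1r powRN.
by rewrite rV mulrAC divfK// gt_eqF ?powR_gt0.
Qed.

Lemma Gam_mulr (r : R) V X : 0 < r -> sigma *m V = r%:C *: (V *m sigma) ->
  Gam sigma 1 (X *m V) = (r `^ 2^-1)^-1%:C *: (Gam sigma 1 X *m V).
Proof.
move=> r0 hV.
rewrite [in RHS]GamE (schur_mulr pdS _ _ hV) GamE.
rewrite -mxfun2Z /mxfun2; apply: eq_bigr => i _; apply: eq_bigr => k _.
rewrite -scalemxAr -scalemxAl scalerA -rmorphM; congr (_%:C *: _).
rewrite powRM ?(ltW r0) ?(ltW (pdS.2 _))// mul1r.
by field; rewrite gt_eqF ?powR_gt0.
Qed.

Section Exponent.
Variable p : R.
Hypotheses (p1 : 1 < p) (p2 : p <= 2).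
Let p0 : 0 < p. Proof. by rewrite (lt_trans _ p1). Qed.

Local Notation th := (theta p).

(** The weight of the inverse of [brac p sigma sigma 0] composed with
    [Gam sigma 1]: [dualA sigma p X] is the first-order variation of the
    differential of the entropy at [sigma] in the direction [Gam sigma 1 X]. *)
Definition dual_wt (a b : R) : R :=
  a `^ p^-1 * b `^ p^-1 * (a `^ 2^-1 * b `^ 2^-1)^-1 / th (a `^ p^-1) (b `^ p^-1).

Definition dualA X : 'M[R[i]]_n := SM dual_wt X.

Definition phi_wt (a b : R) : R :=
  a `^ p^-1 * b `^ p^-1 / th (a `^ p^-1) (b `^ p^-1).

Lemma Gam_dualA X : Gam sigma 1 (dualA X) = SM phi_wt X.
Proof.
rewrite GamE schur_comp//; apply: schur_ext => // a b a0 b0.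
have an : a `^ 2^-1 != 0 by rewrite gt_eqF ?powR_gt0.
have bn : b `^ 2^-1 != 0 by rewrite gt_eqF ?powR_gt0.
have tn : th (a `^ p^-1) (b `^ p^-1) != 0 by rewrite gt_eqF ?theta_gt0 ?powR_gt0.
by rewrite /dual_wt /phi_wt mul1r; field; do ?[apply/andP; split].
Qed.

Lemma hatpV : (hatp p)^-1 = 1 - p^-1.
Proof.
have pn : p != 0 by rewrite gt_eqF.
have p1n : p - 1 != 0 by rewrite gt_eqF ?subr_gt0.
by rewrite /hatp; field; do ?[apply/andP; split].
Qed.

Lemma resol_Bsigma : resol (Gam sigma (- (hatp p)^-1) sigma)
  (fun i => eigval sigma i `^ p^-1) (eproj sigma).
Proof.
have -> : (fun i => eigval sigma i `^ p^-1) =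
    (fun i => eigval sigma i `^ (1 + - (hatp p)^-1)).
  by apply/funext => i; congr (_ `^ _); rewrite hatpV; ring.
exact: resol_Gam.
Qed.

Definition brac_wt (w a b : R) : R :=
  a `^ ((hatp p)^-1) * b `^ ((hatp p)^-1) *
  th (expR (w / (2 * p)) * a `^ p^-1) (expR (- w / (2 * p)) * b `^ p^-1).

Lemma brac_sigma w X : brac p sigma sigma w X = SM (brac_wt w) X.
Proof.
rewrite /brac (resol_mxfun2 (resolZ resol_Bsigma _) (resolZ resol_Bsigma _)).
rewrite -[X in Gam _ _ X]/(SM (fun a b => th (expR (w / (2 * p)) * a `^ p^-1)
  (expR (- w / (2 * p)) * b `^ p^-1)) _).
rewrite !GamE !schur_comp//; apply: schur_ext => // a b a0 b0.
have half u : 0 < u -> u `^ (hatp p)^-1 = u `^ ((hatp p)^-1 / 2) * u `^ ((hatp p)^-1 / 2).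
  by move=> u0; rewrite powRDr//; congr (_ `^ _); field; rewrite /hatp;
    rewrite !gt_eqF// divr_gt0// subr_gt0.
by rewrite /brac_wt (half a a0) (half b b0); ring.
Qed.

(** A modular shift rescales both arguments of [theta] by a common factor, whose
    power cancels against the one coming from the other multipliers. *)
Lemma brac_wt_mull w a b : 0 < a -> 0 < b ->
  brac_wt w a b * dual_wt (a / expR (- w)) b = a `^ 2^-1 * b `^ 2^-1.
Proof.
move=> a0 b0; pose k := expR (w / (2 * p)).
have k0 : 0 < k by exact: expR_gt0.
have kV : expR (- w / (2 * p)) = k^-1 by rewrite -expRN mulNr.
have pn : p != 0 by rewrite gt_eqF.
have ek r : expR w `^ r = k `^ (2 * p * r).
  by rewrite /k -!expRM; congr expR; field.
have -> : a / expR (- w) = expR w * a by rewrite expRN invrK mulrC.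
rewrite /brac_wt /dual_wt -/k kV.
have pw r : (expR w * a) `^ r = k `^ (2 * p * r) * a `^ r.
  by rewrite powRM; [rewrite ek|exact: expR_ge0|exact: ltW].
rewrite !pw.
have -> : k `^ (2 * p * p^-1) = k * k.
  by rewrite mulfK// -[2]/(2%:R) powR_mulrn ?(ltW k0)// expr2.
have -> : 2 * p * 2^-1 = p by field.
have -> : th (k * k * a `^ p^-1) (b `^ p^-1) =
    k `^ (2 - p) * th (k * a `^ p^-1) (k^-1 * b `^ p^-1).
  rewrite -theta_homog ?mulr_gt0 ?invr_gt0 ?powR_gt0//.
  by rewrite !mulrA mulfV ?mul1r// gt_eqF.
have -> : k `^ (2 - p) = k * k / k `^ p.
  rewrite powRB ?(lt0r_neq0 k0) ?implybT//.
  by rewrite -[2]/(2%:R) powR_mulrn ?(ltW k0)// expr2.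
rewrite hatpV.
have aE u : 0 < u -> u `^ (1 - p^-1) = u `^ 2^-1 * u `^ 2^-1 / u `^ p^-1.
  move=> u0; rewrite powRB ?(lt0r_neq0 u0) ?implybT//; congr (_ / _).
  by rewrite powRDr//; congr (_ `^ _); field.
rewrite !aE//.
have kn : k != 0 by rewrite gt_eqF.
have kpn : k `^ p != 0 by rewrite gt_eqF ?powR_gt0.
have an : a `^ 2^-1 != 0 by rewrite gt_eqF ?powR_gt0.
have bn : b `^ 2^-1 != 0 by rewrite gt_eqF ?powR_gt0.
have apn : a `^ p^-1 != 0 by rewrite gt_eqF ?powR_gt0.
have bpn : b `^ p^-1 != 0 by rewrite gt_eqF ?powR_gt0.
have tn : th (k * a `^ p^-1) (k^-1 * b `^ p^-1) != 0.
  by rewrite gt_eqF// theta_gt0 ?mulr_gt0 ?invr_gt0 ?powR_gt0.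
move: tn; set t := th _ _ => tn.
by field; do ?[apply/andP; split].
Qed.

Lemma brac_wtC w a b : brac_wt w a b = brac_wt (- w) b a.
Proof. by rewrite /brac_wt theta_sym opprK [b `^ _ * a `^ _]mulrC. Qed.

Lemma dual_wtC a b : dual_wt a b = dual_wt b a.
Proof.
rewrite /dual_wt theta_sym [b `^ p^-1 * _]mulrC.
by rewrite [b `^ 2^-1 * a `^ 2^-1]mulrC.
Qed.

Lemma brac_wt_mulr w a b : 0 < a -> 0 < b ->
  brac_wt w a b * dual_wt a (expR (- w) * b) = a `^ 2^-1 * b `^ 2^-1.
Proof.
move=> a0 b0; have -> : expR (- w) * b = b / expR (- - w).
  by rewrite opprK expRN mulrC.
by rewrite dual_wtC brac_wtC brac_wt_mull// mulrC.
Qed.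

Lemma bracB w X Y : brac p sigma sigma w (X - Y) =
  brac p sigma sigma w X - brac p sigma sigma w Y.
Proof. by rewrite !brac_sigma mxfun2B. Qed.

(** The chain rule behind the gradient flow structure: at [sigma] the twisted
    metric turns the derivation of the dual variable of [X] into that of [X],
    conjugated by the square root of [sigma] for every [p]. *)
Lemma brac_comm w V X : sigma *m V = (expR (- w))%:C *: (V *m sigma) ->
  brac p sigma sigma w (comm V (dualA X)) = Gam sigma 1 (comm V X).
Proof.
move=> hV; rewrite /comm bracB GamB !brac_sigma; congr (_ - _).
  rewrite /dualA (schur_mull pdS _ _ (expR_gt0 _) hV) schur_comp// GamE.
  by apply: schur_ext => // a b a0 b0; rewrite brac_wt_mull// mul1r.
rewrite /dualA (schur_mulr pdS _ _ hV) schur_comp// GamE.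
by apply: schur_ext => // a b a0 b0; rewrite brac_wt_mulr// mul1r.
Qed.

Section Lindblad.
Variables (J : nat) (V : 'I_J -> 'M[R[i]]_n) (omega : 'I_J -> R).
Variable (L : {linear 'M[R[i]]_n -> 'M[R[i]]_n}).
Hypothesis aL : alicki L sigma V omega.

Lemma alicki_modularE j : sigma *m V j = (expR (- omega j))%:C *: (V j *m sigma).
Proof.
have := congr1 (mulmx^~ sigma) (alicki_modular aL j).
by rewrite /= -mulmxA mulVmx ?sigma_unit// mulmx1 -scalemxAl.
Qed.

Lemma Dop_dualA X : Dop p sigma V omega sigma (dualA X) =
  \sum_j comm ((V j)^t*) (Gam sigma 1 (comm (V j) X)).
Proof.
apply: eq_bigr => j _; rewrite hsadj_comm brac_comm//.
exact: alicki_modularE.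
Qed.

Lemma Gam_generator X : Gam sigma 1 (L X) =
  - \sum_j comm ((V j)^t*) (Gam sigma 1 (comm (V j) X)).
Proof.
rewrite (alickiE aL) Gam_sum -sumrN; apply: eq_bigr => j _.
have hV := modular_adj (expR_gt0 _) (alicki_modularE j).
have r0 : 0 < (expR (- omega j))^-1 by rewrite invr_gt0 expR_gt0.
rewrite GamD GamZ GamZ (Gam_mull _ r0 hV) (Gam_mulr _ r0 hV).
rewrite scalerA scalerA -rmorphM -rmorphM.
have rE : (expR (- omega j))^-1 `^ 2^-1 = expR (omega j / 2).
  by rewrite -expRN opprK -expRM.
rewrite rE mulNr expRN mulVf ?mulfV ?gt_eqF ?expR_gt0// !scale1r.
have -> : comm X (V j) = - comm (V j) X by rewrite /comm opprB.
have -> : Gam sigma 1 (- comm (V j) X) = - Gam sigma 1 (comm (V j) X).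
  by rewrite -scaleN1r GamZ scaleN1r.
by rewrite /comm mulmxN opprB addrC.
Qed.

(** The linearized gradient flow of the entropy is the dual semigroup. *)
Lemma Dop_dualA_generator X : Dop p sigma V omega sigma (dualA X) = - Gam sigma 1 (L X).
Proof. by rewrite Gam_generator opprK Dop_dualA. Qed.

(** The generator is symmetric for the KMS inner product, by its Dirichlet form. *)
Lemma Gam_generator_sym X Y : hs (L X) (Gam sigma 1 Y) = hs X (Gam sigma 1 (L Y)).
Proof.
have S Z Z' : hs Z (Gam sigma 1 (L Z')) =
    - \sum_j hs (comm (V j) Z) (Gam sigma 1 (comm (V j) Z')).
  rewrite Gam_generator -scaleN1r hsZr mulN1r hs_sumr; congr (- _).
  by apply: eq_bigr => j _; rewrite hs_comm.
rewrite hs_Gam hsC !S rmorphN rmorph_sum; congr (- _).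
by apply: eq_bigr => j _ /=; rewrite -hsC -hs_Gam.
Qed.

End Lindblad.

End Exponent.

End AtInvariantState.

(** * Functional calculus of the modular operator *)

Section ModularFunctionalCalculus.
Variables (R : realType) (n : nat) (sigma : 'M[R[i]]_n).
Hypothesis pdS : pdmx sigma.
Implicit Types (X Y : 'M[R[i]]_n).

Lemma mxvec_dot X Y : mxvec X *m (mxvec Y)^t* = (hs Y X)%:M.
Proof.
apply/matrixP => i j; rewrite !ord1 [RHS]mxE eqxx mulr1n hsE mxE.
rewrite (reindex _ (curry_mxvec_bij n n)) /= (pair_bigA _ (fun i j => (Y i j)^*%R * X i j)).
by apply: eq_bigr => -[k l] _ /=; rewrite !mxE !mxvecE mulrC.
Qed.

Lemma mxvec_eq (M N : 'M[R[i]]_(n * n)) :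
  (forall X, mxvec X *m M = mxvec X *m N) -> M = N.
Proof.
move=> h; apply/row_matrixP => i; rewrite !rowE.
by rewrite -[delta_mx 0 i](@vec_mxK _ n n) h.
Qed.

Definition sandwich (A B : 'M[R[i]]_n) : 'M[R[i]]_(n * n) :=
  lin_mx (mulmxr B \o mulmx A).

Lemma mul_sandwich A B X : mxvec X *m sandwich A B = mxvec (A *m X *m B).
Proof. by rewrite /sandwich mul_vec_lin. Qed.

(** The vectorization of matrices is an isometry for the Hilbert-Schmidt pairing. *)
Lemma sandwich_adj A B : (sandwich A B)^t* = sandwich (A^t*) (B^t*).
Proof.
apply: mxvec_eq => X; apply/eqP; rewrite -subr_eq0; apply/eqP.
set Z := _ - _; rewrite -[Z](@vec_mxK _ n n); set W := vec_mx Z.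
suff : hs W W = 0 by move=> /hs_eq0 ->; rewrite linear0.
have := mxvec_dot W W.
have WZ : mxvec W = Z by rewrite vec_mxK.
rewrite {1}WZ mulmxBl mul_sandwich mxvec_dot.
have -> : mxvec X *m (sandwich A B)^t* *m (mxvec W)^t* = (hs (A *m W *m B) X)%:M.
  by rewrite -mulmxA -adjM mul_sandwich mxvec_dot.
have -> : hs W (A^t* *m X *m B^t*) = hs (A *m W *m B) X by rewrite hs_mulr -mulmxA hs_mull.
by rewrite subrr => /esym/matrixP/(_ 0 0); rewrite !mxE eqxx mulr1n.
Qed.

(** Left and right multiplications by eigenprojections of [sigma] diagonalize the
    modular operator, with the ratios of eigenvalues as spectrum. *)
Lemma resol_Delta : resol (lin_mx (Delta sigma))
  (fun ik : 'I_n * 'I_n => eigval sigma ik.1 / eigval sigma ik.2)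
  (fun ik => sandwich (eproj sigma ik.1) (eproj sigma ik.2)).
Proof.
have rS := resol_eproj pdS.1; have s0 := pdS.2.
move: (eigval sigma) (eproj sigma) rS s0 => s P rS s0.
split.
- by move=> ik; rewrite sandwich_adj !(resol_herm rS).
- move=> [i k] [j l] /=; apply: mxvec_eq => X; rewrite mulmxA !mul_sandwich.
  rewrite !mulmxA (resol_mul rS) -[_ *m _ *m P l]mulmxA (resol_mul rS).
  rewrite (eq_sym j i) xpair_eqE; case: eqVneq => [->|_] /=; last first.
    by rewrite !mul0mx linear0 mulmx0.
  by case: eqVneq => [->|_]; rewrite ?mul_sandwich// !mulmx0 linear0.
- apply: mxvec_eq => X; rewrite mulmx1 mulmx_sumr -(pair_bigA _ (fun i k =>
    mxvec X *m sandwich (P i) (P k))) /=.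
  rewrite [in RHS](resol_expand rS X) linear_sum; apply: eq_bigr => i _.
  rewrite [in RHS](resol_expandr rS (_ *m X)) linear_sum; apply: eq_bigr => k _.
  by rewrite mul_sandwich.
- apply: mxvec_eq => X.
  rewrite -[lin_mx (Delta sigma)]/(sandwich sigma (invmx sigma)) mul_sandwich.
  rewrite mulmx_sumr -(pair_bigA _ (fun i k => mxvec X *m
    ((s i / s k)%:C *: sandwich (P i) (P k)))) /=.
  rewrite [in LHS](resol_expand rS (_ *m X *m _)) linear_sum; apply: eq_bigr => i _.
  rewrite [in LHS](resol_expandr rS (P i *m _)) linear_sum; apply: eq_bigr => k _.
  rewrite -scalemxAr mul_sandwich -linearZ; congr mxvec.
  have -> : P i *m (sigma *m X *m invmx sigma) *m P k =
      (P i *m sigma) *m X *m (invmx sigma *m P k) by rewrite !mulmxA.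
  rewrite (resol_mull rS) -!scalemxAl.
  have -> : invmx sigma *m P k = (s k)^-1%:C *: P k.
    have sn : s k != 0 by rewrite gt_eqF ?s0.
    rewrite -[in LHS](scale1r (P k)) -(rmorph1 (real_complex R)) -(mulVf sn).
    rewrite rmorphM -scalerA -(resol_mulr rS) -scalemxAr mulKmx//.
    exact: sigma_unit.
  by rewrite -scalemxAr scalerA -rmorphM.
Qed.

Lemma sofun_Delta (f : R -> R) X :
  sofun f (Delta sigma) X = mxfun2 (fun a b => f (a / b)) sigma sigma X.
Proof.
rewrite /sofun (resol_mxfun resol_Delta) mulmx_sumr linear_sum /=.
rewrite /mxfun2 [RHS](pair_bigA _ (fun i k => (f (eigval sigma i / eigval sigma k))%:C *:
  (eproj sigma i *m X *m eproj sigma k))) /=.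
by apply: eq_bigr => -[i k] _ /=; rewrite -scalemxAr mul_sandwich linearZ /= mxvecK.
Qed.

Lemma inner_phiE (p : R) (p1 : 1 < p) X Y :
  inner_phi p sigma X Y = hs X (mxfun2 (phi_wt p) sigma sigma Y).
Proof.
have rS := resol_eproj pdS.1.
have p0 : 0 < p by rewrite (lt_trans _ p1).
rewrite /inner_phi sofun_Delta; congr (hs X _).
have -> Z : Z *m sigma = mxfun2 (fun a b => 1 * (fun b => b) b) sigma sigma Z.
  rewrite (mxfun2_mulmx _ (fun=> 1) (fun b => b)).
  rewrite (resol_mxfun rS id) -(resolE rS) (resol_mxfun rS).
  rewrite (eq_bigr (eproj sigma)) => [|i _]; last by rewrite scale1r.
  by rewrite (resol_sum1 rS) mul1mx.
rewrite schur_comp//; apply: schur_ext => // a b a0 b0.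
rewrite /phi_wt -phi_theta ?powR_gt0// -!powRrM.
have -> : a `^ p^-1 / b `^ p^-1 = (a / b) `^ p^-1.
  rewrite powRM ?invr_ge0 ?(ltW a0) ?(ltW b0)//; congr (_ * _).
  by rewrite -(powR_inv1 (ltW b0)) -powRrM mulN1r powRN.
by rewrite -powRrM mulVf ?gt_eqF// !powRr1 ?divr_ge0 ?(ltW a0) ?(ltW b0)// mul1r.
Qed.

End ModularFunctionalCalculus.

(** * Second-order expansion of the entropy *)

Section TraceTaylor.
Variables (R : realType) (n : nat).

Lemma trace_overlap_sum (I K : finType) (A B : 'M[R[i]]_n) a P b Q
  (rA : @resol R I n A a P) (rB : @resol R K n B b Q) (f : R -> R) :
  \tr (mxfun f A) = \sum_i \sum_k (f (a i))%:C * \tr (P i *m Q k) /\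
  \tr (mxfun f B) = \sum_i \sum_k (f (b k))%:C * \tr (P i *m Q k).
Proof.
split; rewrite ?(resol_mxfun rA) ?(resol_mxfun rB) tr_sum.
  apply: eq_bigr => i _; rewrite mxtraceZ [in LHS](resol_expandr rB (P i)).
  by rewrite tr_sum mulr_sumr.
rewrite [RHS]exchange_big; apply: eq_bigr => k _ /=; rewrite mxtraceZ.
by rewrite [in LHS](resol_expand rA (Q k)) tr_sum mulr_sumr.
Qed.

(** The scalar Taylor formula, applied to each pair of eigenvalues and weighted
    by the overlap of the eigenprojections, expands the trace of a function of a
    matrix exactly, without differentiating matrix functions. *)
Lemma trace_taylor (A B : 'M[R[i]]_n) (f df : R -> R) (h : R -> R -> R) :
  A \is hermsymmx -> B \is hermsymmx ->
  (forall i k, let a := eigval A i in let b := eigval B k in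
     f a - f b - (a - b) * df b = (a - b) ^+ 2 * h a b) ->
  \tr (mxfun f A) - \tr (mxfun f B) - \tr ((A - B) *m mxfun df B) =
  hs (A - B) (mxfun2 h A B (A - B)).
Proof.
move=> hA hB; have rA := resol_eproj hA; have rB := resol_eproj hB.
have [-> _] := trace_overlap_sum rA rB f.
have [_ ->] := trace_overlap_sum rA rB f.
rewrite (resol_mxfun2 rA rB) (resol_mxfun rB).
have hAB : (A - B)^t* = A - B by rewrite adjB !(proj1 (hermP _)).
move: (eigval A) (eproj A) (eigval B) (eproj B) rA rB => a P b Q rA rB taylor.
have ovl := resol_overlap rA rB.
have lin : \tr ((A - B) *m \sum_k (df (b k))%:C *: Q k) =
    \sum_i \sum_k ((a i - b k) * df (b k))%:C * \tr (P i *m Q k).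
  rewrite [in LHS](resol_expand rA (A - B)) mulmx_suml tr_sum.
  apply: eq_bigr => i _; rewrite mulmx_sumr tr_sum; apply: eq_bigr => k _.
  by rewrite -scalemxAr ovl !mxtraceZ mulrA -rmorphM mulrC [df _ * _]mulrC mulrC.
rewrite lin -sumrB -sumrB hs_sumr; apply: eq_bigr => i _.
rewrite -sumrB -sumrB hs_sumr; apply: eq_bigr => k _.
rewrite -!mulrBl -!rmorphB taylor hsZr ovl hsZr.
have -> : hs (A - B) (P i *m Q k) = (a i - b k)%:C * \tr (P i *m Q k).
  have : Q k *m (A - B) *m P i = (a i - b k)%:C *: (Q k *m P i).
    have := congr1 (fun Z => Z^t*) (ovl i k).
    by rewrite adjZ !adjM hAB (resol_herm rA) (resol_herm rB) mulmxA.
  rewrite /hs hAB => E; rewrite mulmxA mxtrace_mulC mulmxA E mxtraceZ.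
  by rewrite mxtrace_mulC.
by rewrite expr2 !rmorphM /=; ring.
Qed.

End TraceTaylor.

Section EntropyExpansion.
Variables (R : realType) (n : nat) (sigma : 'M[R[i]]_n) (p : R).
Hypotheses (fdS : full_density sigma) (p1 : 1 < p) (p2 : p <= 2).
Let pdS := full_density_pd fdS.
Let rS := resol_eproj pdS.1.
Let p0 : 0 < p. Proof. by rewrite (lt_trans _ p1). Qed.
Implicit Types X Y rho : 'M[R[i]]_n.
Local Notation SM f := (mxfun2 f sigma sigma).
Local Notation hV := ((hatp p)^-1).
Local Notation Bof rho := (Gam sigma (- hV) rho).

Lemma mxabs_pd (B : 'M[R[i]]_n) : pdmx B -> mxabs B = B.
Proof.
move=> [hB b0]; have rB := resol_eproj hB.
have hB' := proj1 (hermP B) hB.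
have BB : B^t* *m B = mxfun (fun b => b ^+ 2) B.
  rewrite hB' {2}(resolE rB) mulmx_sumr; apply: eq_bigr => i _.
  by rewrite -scalemxAr (resol_mulr rB) scalerA -rmorphM expr2.
rewrite /mxabs BB (resol_mxfun (resol_of_mxfun rB _)) [RHS](resolE rB).
by apply: eq_bigr => i _ /=; rewrite sqrtr_sqr gtr0_norm.
Qed.

Lemma trace_Bof_pow Z : \tr (Bof Z *m mxpow sigma hV) = \tr Z.
Proof.
have mp r s : mxpow sigma r *m mxpow sigma s = mxpow sigma (r + s).
  by rewrite /mxpow mxfunM//; apply: mxfun_ext => // a a0; rewrite powRDr.
rewrite /Gam mxtrace_mulC !mulmxA mp mxtrace_mulC mulmxA mp.
rewrite (_ : _ + _ = 0); last by lra.
rewrite /mxpow (resol_mxfun rS) (eq_bigr (eproj sigma)) => [|i _]; last first.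
  by rewrite powRr0 scale1r.
by rewrite (resol_sum1 rS) mul1mx.
Qed.

(** The linear term pairs [rho - sigma] with a power of [sigma] that undoes the
    conjugations, which leaves the trace of [rho - sigma], that is, zero. *)
Lemma Fp_taylor rho : full_density rho ->
  Fp p sigma rho = (p * (p - 1))^-1 * complex.Re
    (hs (Bof rho - Bof sigma)
       (mxfun2 (taylor2 p) (Bof rho) (Bof sigma) (Bof rho - Bof sigma))).
Proof.
move=> fdr; have pdB : pdmx (Bof rho) by apply: pd_Gam => //; exact: full_density_pd.
have pdB0 : pdmx (Bof sigma) by exact: pd_Gam.
rewrite /Fp /pnorm GamK// (_ : p^-1 + -1 = - hV); last by rewrite hatpV//; ring.
rewrite mxabs_pd//.
have trge0 (B : 'M[R[i]]_n) : pdmx B -> 0 <= complex.Re (\tr (mxpow B p)).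
  move=> [hB b0]; rewrite /mxpow /mxfun tr_sum raddf_sum sumr_ge0// => i _ /=.
  have := resol_tr_ge0 (resol_eproj hB) i; rewrite mxtraceZ.
  case: (\tr _) => a b; rewrite lecE /= => /andP[_ a0].
  by rewrite mul0r subr0 mulr_ge0 ?powR_ge0.
rewrite -powRrM mulVf ?gt_eqF// powRr1 ?trge0//.
have taylor i k : let a := eigval (Bof rho) i in let b := eigval (Bof sigma) k in
    a `^ p - b `^ p - (a - b) * (p * b `^ (p - 1)) = (a - b) ^+ 2 * taylor2 p a b.
  rewrite /=; set a := eigval _ i; set b := eigval _ k; rewrite /taylor2.
  case: eqVneq => [->|ab]; first by rewrite !subrr expr0n !mul0r subrr.
  by rewrite [RHS]mulrC divfK// expf_neq0// subr_eq0.
have E := @trace_taylor _ _ _ _ (fun b => b `^ p) (fun b => p * b `^ (p - 1)) _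
  pdB.1 pdB0.1 taylor.
have dE : mxfun (fun b => p * b `^ (p - 1)) (Bof sigma) = p%:C *: mxpow sigma hV.
  rewrite (resol_mxfun (resol_Bsigma pdS p1)) /mxpow (resol_mxfun rS) scaler_sumr.
  apply: eq_bigr => i _; rewrite scalerA -rmorphM -powRrM; congr ((_ * _ `^ _)%:C *: _).
  by rewrite hatpV//; field; rewrite gt_eqF.
have lin0 : \tr ((Bof rho - Bof sigma) *m mxfun (fun b => p * b `^ (p - 1)) (Bof sigma)) = 0.
  rewrite dE -scalemxAr mxtraceZ -GamB// trace_Bof_pow linearB /= fdr.1.2 fdS.1.2.
  by rewrite subrr mulr0.
have tr1 : \tr (mxfun (fun b => b `^ p) (Bof sigma)) = 1.
  rewrite (resol_mxfun (resol_Bsigma pdS p1)); transitivity (\tr sigma); last exact: fdS.1.2.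
  rewrite [in RHS](resolE rS); congr (\tr _).
  apply: eq_bigr => i _; rewrite -powRrM mulVf ?gt_eqF// powRr1//.
  by rewrite ltW// pdS.2.
have conclude (t t0 tl H : R[i]) (k : R) : t - t0 - tl = H -> t0 = 1 -> tl = 0 ->
    k * (complex.Re t - 1) = k * complex.Re H.
  by move=> <- -> ->; rewrite subr0 raddfB.
exact: (conclude _ _ _ _ _ E tr1 lin0).
Qed.

Lemma schurD f g X : SM f X + SM g X = SM (fun a b => f a b + g a b) X.
Proof.
rewrite /mxfun2 -big_split; apply: eq_bigr => i _; rewrite -big_split.
by apply: eq_bigr => k _; rewrite rmorphD scalerDl.
Qed.

Lemma schurZ (c : R) f X : c%:C *: SM f X = SM (fun a b => c * f a b) X.
Proof.
rewrite /mxfun2 scaler_sumr; apply: eq_bigr => i _; rewrite scaler_sumr.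
by apply: eq_bigr => k _; rewrite scalerA rmorphM.
Qed.

Lemma taylor2_phi_wt a b : 0 < a -> 0 < b ->
  a `^ (p^-1 / 2) * b `^ (p^-1 / 2) * ((p * (p - 1))^-1 *
    (taylor2 p (a `^ p^-1) (b `^ p^-1) + taylor2 p (b `^ p^-1) (a `^ p^-1)) *
    (a `^ (p^-1 / 2) * b `^ (p^-1 / 2))) = phi_wt p a b.
Proof.
move=> a0 b0; rewrite taylor2_sym ?powR_gt0// /phi_wt.
have aE u : 0 < u -> u `^ p^-1 = u `^ (p^-1 / 2) * u `^ (p^-1 / 2).
  by move=> u0; rewrite powRDr//; congr (_ `^ _); field; rewrite gt_eqF.
by rewrite [X in X * _ / _]aE// [X in _ * X / _]aE//; ring.
Qed.

(** This form is the Hessian of the entropy at [sigma] in the direction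
    [Gam sigma 1 X]; on Hermitian matrices a kernel may be symmetrized, which
    turns the Taylor remainder into the inverse of [theta]. *)
Lemma taylor2_form X : X^t* = X -> let N := Gam sigma p^-1 X in
  (p * (p - 1))^-1 * complex.Re (hs N (mxfun2 (taylor2 p) (Bof sigma) (Bof sigma) N)) =
  complex.Re (hs X (SM (phi_wt p) X)) / 2.
Proof.
move=> hX N; have hN : N^t* = N by rewrite /N Gam_adj// hX.
pose w a b := taylor2 p (a `^ p^-1) (b `^ p^-1).
have -> : mxfun2 (taylor2 p) (Bof sigma) (Bof sigma) N = SM w N.
  by rewrite (resol_mxfun2 (resol_Bsigma pdS p1) (resol_Bsigma pdS p1)).
have swap : hs N (SM w N) = hs N (SM (fun a b => w b a) N).
  rewrite -[LHS]hs_adj mxfun2_adj ?hN; [|exact: pdS.1|exact: pdS.1].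
  by rewrite -hs_mxfun2//; exact: pdS.1.
have sum2 : (p * (p - 1))^-1%:C * (hs N (SM w N) + hs N (SM w N)) =
    hs X (SM (phi_wt p) X).
  rewrite {2}swap -hsDr schurD -hsZr schurZ; set W := fun a b => _ * (_ + _).
  pose g (a b : R) := a `^ (p^-1 / 2) * b `^ (p^-1 / 2).
  have -> : hs N (SM W N) = hs X (SM g (SM W (SM g X))).
    have <- : N = SM g X by exact: GamE.
    by rewrite [RHS](hs_mxfun2 g _ _ pdS.1 pdS.1) -[SM g X]GamE.
  rewrite (schur_comp pdS W g) (schur_comp pdS g).
  congr (hs X _); apply: (schur_ext pdS); exact: taylor2_phi_wt.
rewrite -sum2; move: (hs N (SM w N)) (_^-1) => [a b] k /=.
by rewrite mul0r subr0; lra.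
Qed.

Lemma Gam1_perturb (e : R) X : sigma + e%:C *: Gam sigma 1 X = Gam sigma 1 (1%:M + e%:C *: X).
Proof.
rewrite GamD// GamZ//; congr (_ + _).
rewrite GamE// (_ : 1%:M = mxfun (fun=> 1) sigma); last first.
  rewrite (resol_mxfun rS) (eq_bigr (eproj sigma)) ?(resol_sum1 rS)// => i _.
  by rewrite scale1r.
rewrite mxfun2_mulmx !mxfunM// -[LHS]/sigma [LHS](resolE rS) (resol_mxfun rS).
apply: eq_bigr => i _; rewrite mulr1 powRDr ?pdS.2//.
by rewrite (_ : _ + _ = 1) ?powRr1 ?(ltW (pdS.2 i))//; field.
Qed.

(** The perturbed density is the conjugate of [1 + e X] by the square root of
    [sigma], positive as soon as [e] is small against the spectrum of [X]. *)
Lemma perturb_full_density X : X^t* = X -> \tr (sigma *m X) = 0 ->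
  exists2 del, 0 < del & forall e : R, 0 < e < del ->
    full_density (sigma + e%:C *: Gam sigma 1 X).
Proof.
move=> hX trX; have rX := resol_eproj (proj2 (hermP X) hX).
move: (eigval X) (eproj X) rX => x P rX.
have [C C0 hC] := bigmax_bound (fun i => - x i).
exists C^-1; rewrite ?invr_gt0// => e /andP[e0 eC].
have pd1 : pdmx (1%:M + e%:C *: X).
  have r1 : resol (1%:M + e%:C *: X) (fun i => 1 + e * x i) P.
    have := resol_fun rX (fun z => 1 + e * z); congr (resol _ _ _).
    rewrite -(resol_sum1 rX) [in RHS](resolE rX) scaler_sumr -big_split.
    by apply: eq_bigr => i _; rewrite rmorphD rmorph1 rmorphM scalerDl scale1r scalerA.
  have pos i : 0 < 1 + e * x i.
    have eC1 : e * C < 1 by rewrite -ltr_pdivlMr// div1r.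
    have : e * - x i <= e * C by rewrite ler_pM2l.
    by rewrite mulrN; lra.
  have [ps rk] := resol_gt0_psd r1 pos.
  by split; [exact: ps.1|move=> i; exact: psd_eigval_gt0].
rewrite Gam1_perturb; have pdr := pd_Gam pdS 1 pd1.
have [ps rk] := pd_psd pdr; split=> //; split=> //.
rewrite -Gam1_perturb mxtraceD mxtraceZ fdS.1.2.
have -> : \tr (Gam sigma 1 X) = \tr (sigma *m X); last by rewrite trX mulr0 addr0.
rewrite /Gam mxtrace_mulC mulmxA mxfunM//; congr (\tr (_ *m _)).
rewrite (resol_mxfun rS) [RHS](resolE rS); apply: eq_bigr => i _.
rewrite powRDr ?pdS.2//.
by rewrite (_ : _ + _ = 1) ?powRr1 ?(ltW (pdS.2 i))//; field.
Qed.

Lemma Bof_perturb e X : Bof (sigma + e%:C *: Gam sigma 1 X) - Bof sigma =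
  e%:C *: Gam sigma p^-1 X.
Proof.
rewrite -GamB [sigma + _]addrC addrK GamZ (GamK pdS).
have -> // : - hV + 1 = p^-1.
by rewrite hatpV//; ring.
Qed.

Lemma Re_hs_close (N T T0 : 'M[R[i]]_n) (c : R) : N1 (T - T0) <= c ->
  complex.Re (hs N T) <= complex.Re (hs N T0) + N1 N * c.
Proof.
move=> TT0; rewrite -[T in leLHS](subrK T0) hsDr raddfD /= addrC lerD2l.
by rewrite (le_trans (Re_hs_le _ _))// ler_wpM2l ?N1_ge0.
Qed.

Lemma Re_scale2 (e : R) (z : R[i]) :
  complex.Re (e%:C * (e%:C * z)) = e ^+ 2 * complex.Re z.
Proof. by case: z => a b /=; rewrite !mul0r !subr0 mulrA expr2. Qed.

(** In the exact expansion the remainder kernel is evaluated at the perturbed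
    density, and converges by continuity of the double calculus. *)
Lemma Fp_expand X : X^t* = X -> \tr (sigma *m X) = 0 -> forall eta, 0 < eta ->
  exists2 del, 0 < del & forall e : R, 0 < e < del ->
    Fp p sigma (sigma + e%:C *: Gam sigma 1 X) <=
      e ^+ 2 * (complex.Re (hs X (SM (phi_wt p) X)) / 2 + eta).
Proof.
move=> hX trX eta eta0; have formE := taylor2_form hX; move: formE => /=.
have NE e := Bof_perturb e X.
move: (Gam sigma p^-1 X) NE => N NE.
have [del1 del10 fdr] := perturb_full_density hX trX.
have pdB0 : pdmx (Bof sigma) by exact: pd_Gam.
have k0 : 0 < (p * (p - 1))^-1 by rewrite invr_gt0 mulr_gt0// subr_gt0.
have FE e : 0 < e < del1 -> Fp p sigma (sigma + e%:C *: Gam sigma 1 X) =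
    (p * (p - 1))^-1 * (e ^+ 2 * complex.Re (hs N (mxfun2 (taylor2 p)
      (Bof (sigma + e%:C *: Gam sigma 1 X)) (Bof sigma) N))).
  by move=> he; rewrite (Fp_taylor (fdr e he)) NE mxfun2Z hsZr hsZl Re_scale2.
move: (_^-1) k0 FE => k k0 FE formE.
pose eta' := eta / (k * (N1 N + 1)).
have N1p : 0 < N1 N + 1 by rewrite ltr_wpDl ?N1_ge0.
have eta'0 : 0 < eta' by rewrite divr_gt0// mulr_gt0.
have ev i j : cts2 (taylor2 p) (eigval (Bof sigma) i) (eigval (Bof sigma) j).
  by apply: taylor2_cts => //; exact: pdB0.2.
have [del2 del20 hdel2] := mxfun2_cont N pdB0.1 pdB0.1 ev eta'0.
exists (Num.min del1 (del2 / (N1 N + 1))); first by rewrite lt_min del10 divr_gt0.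
move=> e; rewrite lt_min => /andP[e0 /andP[e1 e2]].
have he : 0 < e < del1 by rewrite e0 e1.
rewrite (FE _ he) mulrCA ler_pM2l ?exprn_gt0// -formE.
have pdB : pdmx (Bof (sigma + e%:C *: Gam sigma 1 X)).
  by apply: pd_Gam => //; apply: full_density_pd; exact: fdr.
have close : N1 (Bof (sigma + e%:C *: Gam sigma 1 X) - Bof sigma) < del2.
  rewrite NE N1Z normc_real gtr0_norm//.
  apply: (@le_lt_trans _ _ (e * (N1 N + 1))); first by rewrite ler_pM2l// lerDl.
  by rewrite -ltr_pdivlMr.
have same : N1 (Bof sigma - Bof sigma) < del2 by rewrite subrr N10.
have TE := @Re_hs_close N _ _ _ (hdel2 _ _ pdB.1 pdB0.1 close same).
have := ler_wpM2l (ltW k0) TE; rewrite mulrDr => /le_trans; apply.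
rewrite lerD2l /eta'.
apply: (@le_trans _ _ (k * ((N1 N + 1) * (eta / (k * (N1 N + 1)))))).
  rewrite ler_pM2l// ler_wpM2r ?lerDl//.
  by rewrite divr_ge0 ?(ltW eta0)// ltW// mulr_gt0.
rewrite le_eqVlt; apply/orP; left; apply/eqP; field.
by rewrite !gt_eqF.
Qed.

End EntropyExpansion.

(** * The metric operator over all densities *)

Lemma linear_inj_surj (R : realType) n (f : 'M[R[i]]_n -> 'M[R[i]]_n) :
  linear f -> (forall A, f A = 0 -> A = 0) -> forall B, exists A, f A = B.
Proof.
move=> lf inj B.
pose fl : {linear 'M[R[i]]_n -> 'M[R[i]]_n} :=
  HB.pack f (GRing.isLinear.Build _ _ _ _ f lf).
have rf : row_free (lin_mx fl).
  apply: inj_row_free => v; rewrite mul_rV_lin => h.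
  have /inj v0 : fl (vec_mx v) = 0 by apply: (can_inj mxvecK); rewrite h linear0.
  by rewrite -[v]vec_mxK v0 linear0.
exists (vec_mx (mxvec B *m invmx (lin_mx fl))).
apply: (can_inj mxvecK); rewrite -[mxvec (f _)]/(mxvec (fl _)) -mul_rV_lin.
by rewrite mulmxKV// -row_free_unit.
Qed.

Section MetricOperator.
Variables (R : realType) (n : nat) (sigma : 'M[R[i]]_n) (p : R).
Hypotheses (fdS : full_density sigma) (p1 : 1 < p) (p2 : p <= 2).
Let pdS := full_density_pd fdS.
Variables (J : nat) (V : 'I_J -> 'M[R[i]]_n) (omega : 'I_J -> R).
Implicit Types X Y A rho nu : 'M[R[i]]_n.
Local Notation hV := ((hatp p)^-1).
Local Notation Bof rho := (Gam sigma (- hV) rho).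
Local Notation D := (Dop p sigma V omega).

Definition scaledB rho (w : R) : 'M[R[i]]_n := (expR (w / (2 * p)))%:C *: Bof rho.

Lemma scaledB_pd rho w : full_density rho -> pdmx (scaledB rho w).
Proof.
move=> fdr; apply: pdZ; first exact: expR_gt0.
by apply: pd_Gam => //; exact: full_density_pd.
Qed.

Lemma bracE rho w X : brac p sigma rho w X =
  Gam sigma hV (mxfun2 (theta p) (scaledB rho w) (scaledB rho (- w)) (Gam sigma hV X)).
Proof. by []. Qed.

Lemma hs_brac rho w X Y : hs X (brac p sigma rho w Y) =
  hs (Gam sigma hV X)
    (mxfun2 (theta p) (scaledB rho w) (scaledB rho (- w)) (Gam sigma hV Y)).
Proof. by rewrite bracE (hs_Gam pdS). Qed.

Section FixedDensity.
Variable rho : 'M[R[i]]_n.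
Hypothesis fdr : full_density rho.

Lemma brac_linear w a X Y : brac p sigma rho w (a *: X + Y) =
  a *: brac p sigma rho w X + brac p sigma rho w Y.
Proof. by rewrite !bracE GamD GamZ mxfun2D mxfun2Z GamD GamZ. Qed.

Lemma brac_sym w X Y : hs X (brac p sigma rho w Y) = hs (brac p sigma rho w X) Y.
Proof.
rewrite hs_brac hs_mxfun2 ?(scaledB_pd _ fdr).1//.
by rewrite -(hs_Gam pdS).
Qed.

Lemma brac_adj w X : (brac p sigma rho w X)^t* = brac p sigma rho (- w) (X^t*).
Proof.
rewrite !bracE (Gam_adj pdS) opprK; congr (Gam _ _ _).
rewrite (mxfun2_adj _ _ (scaledB_pd w fdr).1 (scaledB_pd (- w) fdr).1) (Gam_adj pdS).
by apply: eq_bigr => i _; apply: eq_bigr => k _; rewrite theta_sym.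
Qed.

Lemma theta_scaledB_gt0 w i k :
  0 < theta p (eigval (scaledB rho w) i) (eigval (scaledB rho (- w)) k).
Proof. by apply: theta_gt0 => //; exact: (scaledB_pd _ fdr).2. Qed.

Lemma brac_ge0 w X : 0 <= hs X (brac p sigma rho w X).
Proof.
rewrite hs_brac mxfun2_form_ge0 ?(scaledB_pd _ fdr).1//.
exact: theta_scaledB_gt0.
Qed.

Lemma brac_eq0 w X : hs X (brac p sigma rho w X) = 0 -> X = 0.
Proof.
rewrite hs_brac => /mxfun2_form_eq0 h; apply: (Gam_inj pdS (t := hV)); apply: h.
- exact: (scaledB_pd _ fdr).1.
- exact: (scaledB_pd _ fdr).1.
- exact: theta_scaledB_gt0.
Qed.

Lemma hs_Dop A A' : hs A (D rho A') =
  \sum_j hs (comm (V j) A) (brac p sigma rho (omega j) (comm (V j) A')).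
Proof.
rewrite /Dop hs_sumr; apply: eq_bigr => j _.
by rewrite hsadj_comm hs_comm.
Qed.

Lemma Re_hs_Dop A : complex.Re (hs A (D rho A)) =
  \sum_j complex.Re (hs (comm (V j) A) (brac p sigma rho (omega j) (comm (V j) A))).
Proof. by rewrite hs_Dop raddf_sum. Qed.

Lemma comm_linear (W : 'M[R[i]]_n) (a : R[i]) X Y :
  comm W (a *: X + Y) = a *: comm W X + comm W Y.
Proof.
rewrite /comm mulmxDr mulmxDl -scalemxAr -scalemxAl scalerBr opprD.
by rewrite !addrA; congr (_ - _); rewrite addrAC.
Qed.

Lemma comm_conj_linear (W : 'M[R[i]]_n) (b : 'M[R[i]]_n -> 'M[R[i]]_n) :
  linear b -> linear (fun X => hsadj (comm W) (b (comm W X))).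
Proof. by move=> lb a X Y; rewrite !hsadj_comm comm_linear lb comm_linear. Qed.

Lemma Dop_linear : linear (D rho).
Proof.
move=> a X Y; rewrite /Dop scaler_sumr -big_split; apply: eq_bigr => j _.
exact: (@comm_conj_linear (V j) (brac p sigma rho (omega j)) (brac_linear (omega j))).
Qed.

Lemma DopZ a X : D rho (a *: X) = a *: D rho X.
Proof.
have D0 : D rho 0 = 0.
  have := Dop_linear 1 0 0; rewrite scaler0 addr0 scale1r => /esym/eqP.
  by rewrite -subr_eq0 addrK => /eqP.
by have := Dop_linear a X 0; rewrite !addr0 D0 addr0.
Qed.

Lemma DopB X Y : D rho (X - Y) = D rho X - D rho Y.
Proof. by rewrite -[- Y]scaleN1r [X + _]addrC Dop_linear scaleN1r addrC. Qed.

Lemma Dop_sym A A' : hs A (D rho A') = hs (D rho A) A'.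
Proof.
rewrite hs_Dop [RHS]hsC hs_Dop rmorph_sum; apply: eq_bigr => j _.
by rewrite brac_sym; exact: hsC.
Qed.

Lemma Dop_ge0 A : 0 <= hs A (D rho A).
Proof. by rewrite hs_Dop sumr_ge0// => j _; exact: brac_ge0. Qed.

(** Each weight of the metric is positive at a full-rank density. *)
Lemma Dop_form_eq0 A : hs A (D rho A) = 0 -> forall j, comm (V j) A = 0.
Proof.
rewrite hs_Dop => /eqP; rewrite psumr_eq0 => [/allP h j|j _]; last exact: brac_ge0.
by have /eqP := h j (mem_index_enum _); exact: brac_eq0.
Qed.

Lemma Dop_trace A : \tr (D rho A) = 0.
Proof.
rewrite /Dop tr_sum big1// => j _.
by rewrite hsadj_comm /comm linearB /= mxtrace_mulC subrr.
Qed.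

End FixedDensity.

Lemma comm_adj (W X : 'M[R[i]]_n) : (comm W X)^t* = - comm (W^t*) (X^t*).
Proof. by rewrite /comm adjB !adjM opprB. Qed.

Lemma commN (W X : 'M[R[i]]_n) : comm W (- X) = - comm W X.
Proof. by rewrite /comm mulmxN mulNmx opprB opprK addrC. Qed.

Lemma comm_scalar (W : 'M[R[i]]_n) (a : R[i]) : comm W a%:M = 0.
Proof. by rewrite /comm scalar_mxC subrr. Qed.

Variable L : {linear 'M[R[i]]_n -> 'M[R[i]]_n}.
Hypothesis aL : alicki L sigma V omega.

(** Orthogonality makes the [V j] pairwise distinct, so that taking adjoints
    permutes the indices. *)
Lemma adj_involution : exists2 f : 'I_J -> 'I_J, injective f &
  forall j, (V j)^t* = V (f j) /\ omega (f j) = - omega j.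
Proof.
have ex j : exists j', (V j)^t* = V j' /\ omega j' = - omega j.
  by have [j' h1 h2] := alicki_adj aL j; exists j'.
exists (fun j => proj1_sig (cid (ex j))); last by move=> j; case: cid.
apply: can_inj (fun j => proj1_sig (cid (ex j))) _ => j.
have [h1 _] := proj2_sig (cid (ex j)).
have [h2 _] := proj2_sig (cid (ex (proj1_sig (cid (ex j))))).
move: (proj1_sig (cid (ex j))) h1 h2 => j1 h1; move: (proj1_sig _) => j2 h2.
have Vj : V j2 = V j by rewrite -h2 -h1 trmxCK.
have [a a0 orth] := alicki_orth aL.
apply/eqP; apply: contraT => ne; have := orth j2 j; rewrite (negbTE ne) Vj orth eqxx.
by move=> /eqP; rewrite fmorph_eq0 gt_eqF.
Qed.

Lemma brac_comm_adj rho (W A : 'M[R[i]]_n) w : full_density rho ->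
  (hsadj (comm W) (brac p sigma rho w (comm W A)))^t* =
  hsadj (comm (W^t*)) (brac p sigma rho (- w) (comm (W^t*) (A^t*))).
Proof.
move=> fdr; rewrite !hsadj_comm (comm_adj (W^t*)) (brac_adj fdr) comm_adj.
have bN Z : brac p sigma rho (- w) (- Z) = - brac p sigma rho (- w) Z.
  have := brac_linear rho (- w) (-1) Z 0; rewrite !scaleN1r !addr0 => ->.
  rewrite -[RHS]addr0; congr (_ + _).
  have G0 t : Gam sigma t 0 = 0 by rewrite /Gam mulmx0 mul0mx.
  have F0 f (B C : 'M[R[i]]_n) : mxfun2 f B C 0 = 0.
    by have := mxfun2Z f B C 0 0; rewrite !scale0r.
  by rewrite bracE G0 F0 G0.
by rewrite bN commN opprK.
Qed.

Lemma Dop_adj rho A : full_density rho -> (D rho A)^t* = D rho (A^t*).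
Proof.
move=> fdr; have [f injf hf] := adj_involution.
rewrite /Dop adj_sum [RHS](reindex_inj injf) /=; apply: eq_bigr => j _.
by have [<- ->] := hf j; exact: brac_comm_adj.
Qed.

Variable P : R -> {linear 'M[R[i]]_n -> 'M[R[i]]_n}.
Hypotheses (qmsP : is_qms P) (genL : is_generator P L) (primP : primitive P sigma).

Lemma commB (W X Y : 'M[R[i]]_n) : comm W (X - Y) = comm W X - comm W Y.
Proof. by have := comm_linear W (-1) Y X; rewrite !scaleN1r addrC [RHS]addrC. Qed.

Lemma hs1_sigma A : \tr (sigma *m A) = hs sigma A.
Proof. by rewrite /hs (proj1 (hermP _) pdS.1). Qed.

(** A non-scalar Hermitian matrix commuting with all [V j] would give a line of
    invariant states through [sigma]. *)
Lemma commutant_herm A : A^t* = A -> (forall j, comm (V j) A = 0) ->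
  A = (\tr (sigma *m A))%:M.
Proof.
move=> hA cA; apply/subr0_eq; set X := A - _.
have trR : (\tr (sigma *m A))^*%R = \tr (sigma *m A).
  by rewrite hs1_sigma -hsC /hs hA (proj1 (hermP _) pdS.1) mxtrace_mulC.
have hX : X^t* = X.
  rewrite /X adjB hA; congr (_ - _).
  by rewrite tr_scalar_mx map_scalar_mx /= trR.
have cX j : comm (V j) X = 0 by rewrite /X commB cA comm_scalar subrr.
have trX : \tr (sigma *m X) = 0.
  by rewrite /X mulmxBr mul_mx_scalar linearB /= mxtraceZ fdS.1.2 mulr1 subrr.
have [del del0 hdel] := perturb_full_density fdS hX trX.
pose e := del / 2; have e0 : 0 < e by rewrite divr_gt0.
have fdr : full_density (sigma + e%:C *: Gam sigma 1 X).
  by apply: hdel; rewrite e0 /e; lra.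
have inv : invariant_state P (sigma + e%:C *: Gam sigma 1 X).
  split; first exact: fdr.1.
  apply: generator_invariant qmsP genL _ _ => Y.
  rewrite (Gam1_perturb fdS) (Gam_generator_sym pdS aL) (Gam_generator pdS aL).
  rewrite big1 ?oppr0 => [|j _]; first by rewrite /hs mulmx0 mxtrace0.
  have -> : comm (V j) (1%:M + e%:C *: X) = 0.
    by rewrite addrC comm_linear cX scaler0 add0r comm_scalar.
  have -> : Gam sigma 1 0 = 0 by rewrite /Gam mulmx0 mul0mx.
  by rewrite /comm mulmx0 mul0mx subrr.
have [_ uniq _] := primP; have := uniq _ inv.
rewrite -[RHS]addr0 => /addrI/eqP; rewrite scaler_eq0 fmorph_eq0 gt_eqF//=.
by move=> /eqP/(Gam_inj pdS).
Qed.

Lemma comm_eq0_adj A : (forall j, comm (V j) A = 0) -> forall j, comm (V j) (A^t*) = 0.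
Proof.
move=> cA j; have [j' Vj' _] := alicki_adj aL j.
have := comm_adj (V j') A; rewrite cA -Vj' trmxCK trmx0 map_mx0 => /esym/eqP.
by rewrite oppr_eq0 => /eqP.
Qed.

(** The commutant of the [V j] is closed under adjoints, hence generated by its
    Hermitian elements. *)
Lemma commutant_scalar A : (forall j, comm (V j) A = 0) -> exists a, A = a%:M.
Proof.
move=> cA; have cA' := comm_eq0_adj cA.
have [a1 h1] : exists a, A + A^t* = a%:M.
  eexists; apply: commutant_herm => [|j]; first by rewrite adjD trmxCK addrC.
  by rewrite -[A^t*]opprK commB commN cA cA' oppr0 subrr.
have iA : ('i%C *: (A - A^t*))^t* = 'i%C *: (A - A^t*).
  rewrite linearZ /= map_mxZ -[_ ^ _]/((A - A^t*)^t*) adjB trmxCK.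
  have ci : ('i%C : R[i])^*%R = - 'i%C by apply/eqP; rewrite eq_complex /= oppr0 !eqxx.
  transitivity (- 'i%C *: (A^t* - A)); first by congr (_ *: _); exact: ci.
  by rewrite scaleNr -scalerN opprB.
have [a2 h2] : exists a, 'i%C *: (A - A^t*) = a%:M.
  eexists; apply: commutant_herm => // j.
  have := comm_linear (V j) 'i%C (A - A^t*) 0; rewrite !addr0 => ->.
  by rewrite commB cA cA' subrr scaler0 add0r /comm mulmx0 mul0mx subrr.
have i0 : ('i%C : R[i]) != 0 by rewrite eq_complex /= oner_eq0 andbF.
exists (2^-1 * (a1 + 'i%C^-1 * a2)).
have -> : A = 2^-1 *: ((A + A^t*) + 'i%C^-1 *: ('i%C *: (A - A^t*))).
  by apply/matrixP => k l; rewrite !mxE; field; rewrite i0.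
by rewrite h1 h2 !scale_scalar_mx -raddfD scale_scalar_mx.
Qed.

Lemma dim_neq0 : n%:R != 0 :> R[i].
Proof.
rewrite pnatr_eq0; apply/eqP => n0; have := fdS.1.2; rewrite /mxtrace big1.
  by move=> /eqP; rewrite eq_sym oner_eq0.
by move=> [i lti] _; exfalso; move: lti; rewrite {1}n0.
Qed.

Lemma Dop_inj rho A : full_density rho -> \tr A = 0 -> D rho A = 0 -> A = 0.
Proof.
move=> fdr trA DA; have [|a aE] := @commutant_scalar A.
  by apply: (Dop_form_eq0 fdr); rewrite DA /hs mulmx0 mxtrace0.
move: trA; rewrite aE mxtrace_scalar => /eqP.
by rewrite -mulr_natr mulf_eq0 (negbTE dim_neq0) orbF => /eqP ->; rewrite raddf0.
Qed.

(** Adding the trace direction turns [D rho] into an injective, hence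
    surjective, endomorphism of the whole matrix space. *)
Lemma Dop_surj rho nu : full_density rho -> tangent nu ->
  exists A, tangent A /\ D rho A = nu.
Proof.
move=> fdr [/hermP hnu trnu].
pose f A := D rho A + (\tr A)%:M.
have lf : linear f.
  move=> a X Y; rewrite /f Dop_linear mxtraceD mxtraceZ.
  by rewrite raddfD /= -scale_scalar_mx scalerDr addrACA.
have trf A : \tr (f A) = \tr A * n%:R.
  by rewrite /f mxtraceD Dop_trace add0r mxtrace_scalar mulr_natr.
have tr0 A : \tr (f A) = 0 -> \tr A = 0.
  by rewrite trf => /eqP; rewrite mulf_eq0 (negbTE dim_neq0) orbF => /eqP.
have DfE A : \tr A = 0 -> f A = D rho A by move=> t0; rewrite /f t0 raddf0 addr0.
have injf A : f A = 0 -> A = 0.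
  move=> fA; have t0 : \tr A = 0 by apply: tr0; rewrite fA mxtrace0.
  by apply: (Dop_inj fdr t0); rewrite -DfE.
have [A fA] := linear_inj_surj lf injf nu.
have t0 : \tr A = 0 by apply: tr0; rewrite fA.
have DA : D rho A = nu by rewrite -DfE.
exists A; split=> //; split=> //; apply/hermP/subr0_eq/(Dop_inj fdr).
  by rewrite linearB /= trace_map_mx mxtrace_tr t0 rmorph0 subrr.
by rewrite DopB -Dop_adj// DA hnu subrr.
Qed.

Lemma Dinv_spec rho nu : full_density rho -> tangent nu ->
  tangent (Dinv p sigma V omega rho nu) /\ D rho (Dinv p sigma V omega rho nu) = nu.
Proof.
move=> fdr /(Dop_surj fdr)[A hA].
exact: (@xgetI _ 0 [set A | tangent A /\ D rho A = nu] A).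
Qed.

Lemma Re_ge0 (z : R[i]) : 0 <= z -> 0 <= complex.Re z.
Proof. by case: z => a b; rewrite lecE /= => /andP[]. Qed.

Lemma gmet_ge0 rho nu : full_density rho -> 0 <= gmet p sigma V omega rho nu nu.
Proof.
move=> fdr; rewrite /gmet /Dinv; case: xgetP => [A _ [_ <-]|_].
  by apply: Re_ge0; exact: Dop_ge0.
by rewrite /hs trmx0 map_mx0 mul0mx mxtrace0.
Qed.

(** The metric is the Legendre transform of the form of [D rho]; the inequality
    expands the positivity of that form at the difference of [A] and the
    minimizer. *)
Lemma gmet_ge rho nu A : full_density rho -> tangent nu ->
  2 * complex.Re (hs A nu) - complex.Re (hs A (D rho A)) <= gmet p sigma V omega rho nu nu.
Proof.
move=> fdr tnu; rewrite /gmet; have [_ DA'] := Dinv_spec fdr tnu.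
move: (Dinv _ _ _ _ _ _) DA' => A' DA'.
have := Re_ge0 (Dop_ge0 fdr (A' - A)).
rewrite DopB DA' hsBl (hsBr A' nu) (hsBr A nu).
have -> : hs A' (D rho A) = (hs A nu)^*%R by rewrite (Dop_sym fdr) DA' hsC.
move: (hs A' nu) (hs A nu) (hs A (D rho A)) => [a ?] [b ?] [c ?] /=.
lra.
Qed.

Lemma N1_comm (W X : 'M[R[i]]_n) : N1 (comm W X) <= 2 * N1 W * N1 X.
Proof.
rewrite /comm (le_trans (N1D _ _))// N1N -mulrA mulr_natl mulr2n lerD//.
  exact: N1M.
by rewrite mulrC; exact: N1M.
Qed.

Lemma N1_density rho : density rho -> N1 rho <= (n * n)%:R.
Proof.
move=> [pr tr1]; have rr := resol_eproj pr.1.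
rewrite {1}(resolE rr) (le_trans (N1_sum _ _ _))//.
apply: (@le_trans _ _ (\sum_i eigval rho i * (n * n)%:R)).
  apply: ler_sum => i _; rewrite N1Z normc_real ger0_norm ?psd_eigval_ge0//.
  by rewrite ler_wpM2l ?psd_eigval_ge0// (N1_resol rr).
rewrite -mulr_suml -[leRHS]mul1r ler_wpM2r// -lecR.
have -> : (1 : R)%:C = \tr rho by rewrite tr1.
rewrite [in leRHS](resolE rr) tr_sum raddf_sum; apply: ler_sum => i _.
by rewrite mxtraceZ tr_eproj mulr1.
Qed.

(** [theta] being at most a power of the larger argument, the operators
    [D rho] are bounded uniformly over all densities. *)
Lemma Dop_bound : exists2 C, 0 < C & forall rho A, full_density rho ->
  complex.Re (hs A (D rho A)) <= C * complex.Re (hs A A).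
Proof.
have [Kb Kb0 hKb] := N1_Gam sigma (- hV); have [K K0 hK] := N1_Gam sigma hV.
have [T T0 hT] : exists2 T, 0 < T & forall rho, full_density rho -> complex.Re (\tr (Bof rho)) <= T.
  exists (N1 (1%:M : 'M[R[i]]_n) * (Kb * (n * n)%:R) + 1) => [|rho fdr].
    by rewrite ltr_wpDl// !mulr_ge0 ?N1_ge0// ltW.
  have -> : \tr (Bof rho) = hs 1%:M (Bof rho) by rewrite /hs adj1 mul1mx.
  rewrite (le_trans (Re_hs_le _ _))// ler_wpDr// ler_wpM2l ?N1_ge0//.
  by rewrite (le_trans (hKb _))// ler_pM2l// N1_density//; exact: fdr.1.
pose M w := (expR (w / (2 * p)) * T + expR (- w / (2 * p)) * T) `^ (2 - p).
pose c j := M (omega j) * (K * (2 * N1 (V j))) ^+ 2.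
have c0 j : 0 <= c j by rewrite mulr_ge0 ?powR_ge0// exprn_even_ge0.
exists ((\sum_j c j) * (n * n)%:R ^+ 2 + 1) => [|rho A fdr].
  by rewrite ltr_wpDl// mulr_ge0 ?exprn_ge0// sumr_ge0.
have A2 : N1 A ^+ 2 <= (n * n)%:R ^+ 2 * complex.Re (hs A A).
  have hA0 := Re_ge0 (hs_ge0 A).
  rewrite -[X in _ * X]sqr_sqrtr// -exprMn.
  by apply: lerXn2r; rewrite ?nnegrE ?N1_ge0 ?mulr_ge0 ?sqrtr_ge0// N1_le_hs.
apply: (@le_trans _ _ ((\sum_j c j) * N1 A ^+ 2)); last first.
  apply: (@le_trans _ _ ((\sum_j c j) * ((n * n)%:R ^+ 2 * complex.Re (hs A A)))).
    by rewrite ler_wpM2l// sumr_ge0.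
  by rewrite mulrDl mulrA lerDl mul1r Re_ge0// hs_ge0.
rewrite hs_Dop raddf_sum mulr_suml; apply: ler_sum => j _ /=.
have eigB w i : eigval (scaledB rho w) i <= expR (w / (2 * p)) * T.
  have [ps _] := pd_psd (scaledB_pd w fdr).
  rewrite (le_trans (eigval_le_trace i ps))// /scaledB mxtraceZ.
  apply: (@le_trans _ _ (expR (w / (2 * p)) * complex.Re (\tr (Bof rho)))).
    by case: (\tr _) => a b /=; rewrite mul0r subr0.
  by rewrite ler_pM2l ?expR_gt0// hT.
have thM i k : theta p (eigval (scaledB rho (omega j)) i)
    (eigval (scaledB rho (- omega j)) k) <= M (omega j).
  apply: theta_le => //; try exact: (scaledB_pd _ fdr).2.
    by rewrite (le_trans (eigB _ _))// lerDl mulr_ge0 ?expR_ge0// ltW.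
  by rewrite (le_trans (eigB _ _))// lerDr mulr_ge0 ?expR_ge0// ltW.
rewrite hs_brac.
have hb := mxfun2_form_le (Gam sigma hV (comm (V j) A)) (scaledB_pd (omega j) fdr).1
  (scaledB_pd (- omega j) fdr).1 thM.
apply: (le_trans hb); rewrite /c -mulrA ler_wpM2l ?powR_ge0//.
rewrite (le_trans (Re_hs_le _ _))// -expr2 -exprMn lerXn2r ?nnegrE ?N1_ge0//.
  by rewrite !mulr_ge0 ?N1_ge0// ltW.
by rewrite (le_trans (hK _))// -mulrA ler_pM2l// N1_comm.
Qed.

(** The double calculus defining the metric is continuous at [sigma], since
    [theta] is continuous at positive arguments. *)
Lemma brac_cont Y w : forall eta, 0 < eta -> exists2 del, 0 < del &
  forall rho, full_density rho -> N1 (rho - sigma) < del ->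
    complex.Re (hs Y (brac p sigma rho w Y)) <=
    complex.Re (hs Y (brac p sigma sigma w Y)) + eta.
Proof.
move=> eta eta0; pose Z := Gam sigma hV Y.
have hB (w' : R) := scaledB_pd w' fdS.
have N1p : 0 < N1 Z + 1 by rewrite ltr_wpDl ?N1_ge0.
have ev i k : cts2 (theta p) (eigval (scaledB sigma w) i) (eigval (scaledB sigma (- w)) k).
  by apply: theta_cts => //; [exact: (hB w).2|exact: (hB (- w)).2].
have e0 : 0 < eta / (N1 Z + 1) by rewrite divr_gt0.
have [del del0 hdel] := mxfun2_cont Z (hB w).1 (hB (- w)).1 ev e0.
have [Kb Kb0 hKb] := N1_Gam sigma (- hV).
pose q := expR (w / (2 * p)) + expR (- w / (2 * p)).
have q0 : 0 < q by rewrite addr_gt0 ?expR_gt0.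
exists (del / (q * Kb)); first by rewrite divr_gt0// mulr_gt0.
move=> rho fdr close.
have cl w' : expR (w' / (2 * p)) <= q -> N1 (scaledB rho w' - scaledB sigma w') < del.
  move=> wq; rewrite /scaledB -scalerBr -GamB N1Z normc_real ger0_norm ?expR_ge0//.
  apply: (@le_lt_trans _ _ (q * (Kb * N1 (rho - sigma)))).
    by rewrite ler_pM ?expR_ge0 ?N1_ge0 ?hKb.
  by rewrite mulrA mulrC -ltr_pdivlMr// mulr_gt0.
have hr (w' : R) := scaledB_pd w' fdr.
have cw : expR (w / (2 * p)) <= q by rewrite lerDl expR_ge0.
have cw' : expR (- w / (2 * p)) <= q by rewrite lerDr expR_ge0.
have dT := hdel _ _ (hr w).1 (hr (- w)).1 (cl _ cw) (cl _ cw').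
have conclude (a b a' b' : R) : a = a' -> b = b' -> a' <= b' + eta -> a <= b + eta.
  by move=> -> ->.
apply: (conclude _ _ _ _ (congr1 (@complex.Re R) (hs_brac rho w Y Y))
  (congr1 (@complex.Re R) (hs_brac sigma w Y Y))).
apply: (le_trans (Re_hs_close Z dT)); rewrite lerD2l.
by rewrite mulrA ler_pdivrMr// [leLHS]mulrC ler_wpM2l ?(ltW eta0)// lerDl.
Qed.

Lemma Dop_cont A : forall eta, 0 < eta -> exists2 del, 0 < del &
  forall rho, full_density rho -> N1 (rho - sigma) < del ->
    complex.Re (hs A (D rho A)) <= complex.Re (hs A (D sigma A)) + eta.
Proof.
move=> eta eta0; have e0 : 0 < eta / (J%:R + 1).
  by rewrite divr_gt0// ltr_wpDl.
have [del del0 hdel] := @unif_radius R _ (enum 'I_J)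
  (fun j r => forall rho, full_density rho -> N1 (rho - sigma) < r ->
    complex.Re (hs (comm (V j) A) (brac p sigma rho (omega j) (comm (V j) A))) <=
    complex.Re (hs (comm (V j) A) (brac p sigma sigma (omega j) (comm (V j) A))) +
      eta / (J%:R + 1))
  (fun j r r' _ r'r h rho fdr hr => h rho fdr (lt_le_trans hr r'r))
  (fun j => brac_cont (comm (V j) A) (omega j) e0).
exists del => // rho fdr close.
have conclude (a b a' b' : R) : a = a' -> b = b' -> a' <= b' + eta -> a <= b + eta.
  by move=> -> ->.
apply: (conclude _ _ _ _ (Re_hs_Dop rho A) (Re_hs_Dop sigma A)).
have small : \sum_(j < J) eta / (J%:R + 1) <= eta.
  rewrite sumr_const card_ord -[leLHS]mulr_natl mulrA ler_pdivrMr ?ltr_wpDl//.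
  by rewrite mulrC ler_pM2l// lerDl.
apply: (le_trans _ (lerD (lexx _) small)).
rewrite -big_split; apply: ler_sum => j _; apply: hdel => //.
by rewrite mem_enum.
Qed.

End MetricOperator.

(** * Curves of densities *)

Section Curves.
Variables (R : realType) (n : nat) (gamma : R -> 'M[R[i]]_n).
Hypothesis smG : smooth01 gamma.
Implicit Types A : 'M[R[i]]_n.

Lemma is_derive_bigsum (I : finType) (f : I -> R -> R) (df : I -> R) (s : R) :
  (forall i, is_derive s 1 (f i) (df i)) ->
  is_derive s 1 (fun t => \sum_i f i t) (\sum_i df i).
Proof.
move=> h; elim: (index_enum I) => [|i r IHr].
  by under eq_fun do rewrite big_nil; rewrite big_nil; exact: is_derive_cst.
under eq_fun do rewrite big_cons; rewrite big_cons.
exact: is_deriveD.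
Qed.

Lemma cvg_bigsum (I : finType) (f : I -> R -> R) (l : I -> R) (s : R) :
  (forall i, f i t @[t --> s] --> l i) -> \sum_i f i t @[t --> s] --> \sum_i l i.
Proof.
move=> h; elim: (index_enum I) => [|i r IHr].
  by under eq_fun do rewrite big_nil; rewrite big_nil; exact: cvg_cst.
under eq_fun do rewrite big_cons; rewrite big_cons.
by apply: cvgD; [exact: h|exact: IHr].
Qed.

Lemma Re_hsE A (B : 'M[R[i]]_n) : complex.Re (hs A B) = \sum_i \sum_j
  (complex.Re (A i j) * complex.Re (B i j) + complex.Im (A i j) * complex.Im (B i j)).
Proof.
rewrite hsE raddf_sum; apply: eq_bigr => i _; rewrite raddf_sum.
apply: eq_bigr => j _; case: (A i j) (B i j) => a b [c d] /=.
by rewrite mulNr opprK.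
Qed.

Lemma curve_derive : exists2 e : R, 0 < e & forall A s, - e < s < 1 + e ->
  is_derive s 1 (fun t => complex.Re (hs A (gamma t))) (complex.Re (hs A (velocity gamma s))) /\
  {for s, continuous (fun t => complex.Re (hs A (velocity gamma t)))}.
Proof.
have [e e0 he] := smG; exists e => // A s hs_; split.
  under eq_fun do rewrite Re_hsE; rewrite Re_hsE.
  apply: is_derive_bigsum => i; apply: is_derive_bigsum => j; rewrite mxE /=.
  have [h1 h2] := he 0%N i j s hs_; rewrite /derive1n /= in h1 h2.
  have d1 : is_derive s 1 (fun t => complex.Re (gamma t i j)) (derive1 (re_entry gamma i j) s).
    by rewrite derive1E; exact/derivableP.
  have d2 : is_derive s 1 (fun t => complex.Im (gamma t i j)) (derive1 (im_entry gamma i j) s).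
    by rewrite derive1E; exact/derivableP.
  exact: is_deriveD.
have -> : (fun t => complex.Re (hs A (velocity gamma t))) = fun t => \sum_i \sum_j
    (complex.Re (A i j) * derive1 (re_entry gamma i j) t +
     complex.Im (A i j) * derive1 (im_entry gamma i j) t).
  apply/funext => t; rewrite Re_hsE; apply: eq_bigr => i _; apply: eq_bigr => j _.
  by rewrite mxE.
apply: cvg_bigsum => i; apply: cvg_bigsum => j.
have [h1 h2] := he 1%N i j s hs_; rewrite /derive1n /= in h1 h2.
have c1 : {for s, continuous (derive1 (re_entry gamma i j))}.
  by apply: differentiable_continuous; apply/derivable1_diffP.
have c2 : {for s, continuous (derive1 (im_entry gamma i j))}.
  by apply: differentiable_continuous; apply/derivable1_diffP.
by apply: cvgD; apply: cvgM; [exact: cvg_cst|exact: c1|exact: cvg_cst|exact: c2].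
Qed.

Hypothesis fdG : forall s, 0 <= s <= 1 -> full_density (gamma s).

(** A real-linear functional which is constant on densities has zero derivative
    along the curve. *)
Lemma curve_derive0 A c : (forall rho, density rho -> complex.Re (hs A rho) = c) ->
  forall s, 0 < s < 1 -> complex.Re (hs A (velocity gamma s)) = 0.
Proof.
move=> cst_c s /andP[s0 s1]; have [e e0 he] := curve_derive.
have [|[h1 h2] _] := he A s; first by apply/andP; split; lra.
rewrite -h2 (@near_eq_derive _ _ _ _ (cst c)) ?derive_cst//.
near=> t; apply: cst_c; apply: (fdG _).1; apply/andP; split; apply: ltW.
  by near: t; exact: lt_nbhsr.
by near: t; exact: lt_nbhsl.
Unshelve. all: by end_near. Qed.

(** Testing against anti-Hermitian matrices shows that the velocity is Hermitian,
    testing against the identity that it is traceless. *)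
Lemma velocity_tangent s : 0 < s < 1 -> tangent (velocity gamma s).
Proof.
move=> hs_; set v := velocity gamma s.
have antiherm A : A^t* = - A -> complex.Re (hs A v) = 0.
  move=> hA; apply: (@curve_derive0 A 0) hs_ => rho [[/hermP hr _] _].
  have : hs A rho = - (hs A rho)^*%R.
    by rewrite -hsC -[LHS]hs_adj hA hr hsC hsNl rmorphN /= -hsC.
  case: (hs A rho) => a b /eqP; rewrite eq_complex /= => /andP[/eqP h _]; lra.
pose W := v - v^t*.
have hv : v^t* = v.
  apply/esym/subr0_eq/hs_eq0; rewrite -/W.
  have hW : W^t* = - W by rewrite /W adjB trmxCK opprB.
  have W0 := antiherm W hW.
  have W1 : complex.Re (hs W (v^t*)) = 0.
    have -> : hs W (v^t*) = - hs v W.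
      by rewrite -hs_adj trmxCK hW hsC hsNl rmorphN /= -hsC.
    by rewrite raddfN /= hsC; move: W0; case: (hs W v) => a b /= ->; rewrite oppr0.
  have := hs_ge0 W; have : complex.Re (hs W W) = 0.
    by rewrite {2}/W hsBr raddfB /= W0 W1 subrr.
  case: (hs W W) => a b /= ->; rewrite lecE /= => /andP[/eqP -> _].
  by [].
split; first exact/hermP.
have tr1 : complex.Re (hs 1%:M v) = 0.
  apply: (@curve_derive0 _ 1) hs_ => rho [_ tr1].
  by rewrite /hs adj1 mul1mx tr1.
have trC : (\tr v)^*%R = \tr v by rewrite -[in RHS]hv trace_map_mx mxtrace_tr.
have : \tr v \is Num.real by apply/CrealP.
move=> /RRe_real <-; move: tr1; rewrite /hs adj1 mul1mx => ->.
by rewrite rmorph0.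
Qed.

End Curves.

(** * Linearization of the transport inequality *)

Section EnergyBounds.
Variables (R : realType) (n : nat) (sigma : 'M[R[i]]_n) (p : R).
Hypotheses (fdS : full_density sigma) (p1 : 1 < p) (p2 : p <= 2).
Variables (J : nat) (V : 'I_J -> 'M[R[i]]_n) (omega : 'I_J -> R).
Variables (L : {linear 'M[R[i]]_n -> 'M[R[i]]_n}) (P : R -> {linear 'M[R[i]]_n -> 'M[R[i]]_n}).
Hypotheses (aL : alicki L sigma V omega).
Hypotheses (qmsP : is_qms P) (genL : is_generator P L) (primP : primitive P sigma).
Implicit Types X Y A rho nu : 'M[R[i]]_n.
Local Notation D := (Dop p sigma V omega).

Lemma energy_ge0 (gamma : R -> 'M[R[i]]_n) :
  (forall s, 0 <= s <= 1 -> full_density (gamma s)) ->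
  (0 <= energy p sigma V omega gamma)%E.
Proof.
move=> fdG; apply: integral_ge0 => s /=; rewrite in_itv /= => hs_.
by rewrite lee_fin; apply: gmet_ge0 => //; exact: fdG.
Qed.

(** Integrating the Legendre inequality for the metric along the curve, with a
    fixed test matrix, bounds the energy below by the displacement. *)
Lemma energy_ge (gamma : R -> 'M[R[i]]_n) A (M t : R) : smooth01 gamma ->
  (forall s, 0 <= s <= 1 -> full_density (gamma s)) -> 0 < t -> t <= 1 ->
  (forall s, 0 <= s <= 1 -> complex.Re (hs A (D (gamma s) A)) <= M) ->
  ((2 * complex.Re (hs A (gamma t - gamma 0)) - M * t)%:E <=
   energy p sigma V omega gamma)%E.
Proof.
move=> smG fdG t0 t1 hM; have [e e0 he] := curve_derive smG.
have dbl B : complex.Re (hs (2%:C *: A) B) = 2 * complex.Re (hs A B).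
  by rewrite hsZl; case: (hs A B) => a b /=; rewrite mul0r subr0.
rewrite -dbl hsBr raddfB /=.
apply: (@integral_ge_increment R e (fun s => gmet p sigma V omega (gamma s)
    (velocity gamma s) (velocity gamma s))
  (fun s => complex.Re (hs (2%:C *: A) (gamma s)))
  (fun s => complex.Re (hs (2%:C *: A) (velocity gamma s))) M t) => //.
- by move=> s hs_; have [] := he (2%:C *: A) s hs_.
- by move=> s hs_; have [] := he (2%:C *: A) s hs_.
- by move=> s hs_; apply: gmet_ge0 => //; exact: fdG.
move=> s /andP[s0 s1]; have s01 : 0 <= s <= 1 by rewrite !ltW.
rewrite dbl; have tv : tangent (velocity gamma s).
  by apply: velocity_tangent => //; rewrite s0 s1.
have := gmet_ge fdS p1 aL qmsP genL primP A (fdG s s01) tv.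
by apply: le_trans; rewrite lerD2l lerN2 hM.
Qed.

(** Curves of small energy stay close to their starting point: test with a
    multiple of the displacement itself and use the uniform bound on the metric
    operator. *)
Lemma energy_displacement : exists2 C, 0 < C & forall gamma E,
  smooth01 gamma -> (forall s, 0 <= s <= 1 -> full_density (gamma s)) ->
  (energy p sigma V omega gamma <= E%:E)%E ->
  forall t, 0 <= t <= 1 -> N1 (gamma t - gamma 0) <= (n * n)%:R * Num.sqrt (C * E).
Proof.
have [C C0 hC] := Dop_bound fdS p1 p2 V omega.
exists C => // gamma E smG fdG hE t /andP[t0 t1].
rewrite (le_trans (N1_le_hs _))// ler_wpM2l// ler_wsqrtr//.
move: t0; rewrite le_eqVlt => /orP[/eqP<-|t0].
  rewrite subrr /hs mulmx0 mxtrace0 /=.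
  have := le_trans (energy_ge0 fdG) hE; rewrite lee_fin => E0.
  by rewrite mulr_ge0// ltW.
pose Z := gamma t - gamma 0; rewrite -/Z.
have q0 : 0 <= complex.Re (hs Z Z) by apply: Re_ge0; exact: hs_ge0.
pose A := C^-1%:C *: Z.
have AZ : complex.Re (hs A Z) = C^-1 * complex.Re (hs Z Z).
  by rewrite /A hsZl; case: (hs Z Z) => a b /=; rewrite mul0r subr0.
have AA : complex.Re (hs A A) = C^-1 ^+ 2 * complex.Re (hs Z Z).
  by rewrite /A hsZl hsZr Re_scale2.
have hM s : 0 <= s <= 1 -> complex.Re (hs A (D (gamma s) A)) <= C^-1 * complex.Re (hs Z Z).
  move=> s01; apply: (le_trans (hC _ A (fdG s s01))); rewrite AA expr2 -mulrA mulVKf//.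
  by rewrite gt_eqF.
have := le_trans (energy_ge smG fdG t0 t1 hM) hE; rewrite lee_fin -/Z AZ.
move: (complex.Re (hs Z Z)) q0 => q q0 h.
have qt : C^-1 * q * t <= C^-1 * q by rewrite ler_piMr// mulr_ge0// invr_ge0 ltW.
have : C^-1 * q <= E by move: qt h; move: (C^-1 * q) => x; lra.
by rewrite mulrC ler_pdivrMr// mulrC.
Qed.

Section Transport.
Variable c : R.
Hypothesis c0 : 0 < c.
Hypothesis transport : forall rho : 'M[R[i]]_n, density rho ->
  (W2 p sigma V omega rho sigma <= (Num.sqrt (c * Fp p sigma rho))%:E)%E.

(** Both endpoints are full-rank, so that the transport cost is an infimum of
    energies of curves. *)
Lemma transport_curve rho (E : R) : full_density rho -> c * Fp p sigma rho < E -> 0 < E ->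
  exists2 gamma, curve rho sigma gamma & (energy p sigma V omega gamma <= E%:E)%E.
Proof.
move=> fdr FE E0; have := transport fdr.1; rewrite /W2 asboolT//.
rewrite /rdist => hW.
have : (sqrte (ereal_inf (energy p sigma V omega @` [set gamma | curve rho sigma gamma]))
    < sqrte E%:E)%E.
  apply: (le_lt_trans hW); rewrite lte_fin.
  by rewrite ltr_sqrt.
rewrite ltNge lee_sqrt; last first.
  by apply: le_ereal_inf_tmp => _ [gamma [_ fdG _ _] <-]; exact: energy_ge0.
rewrite -ltNge => /ereal_inf_lt[_ [gamma cg <-]] h.
by exists gamma => //; exact: ltW.
Qed.

Local Notation SM f := (mxfun2 f sigma sigma).
Let pdS := full_density_pd fdS.

Lemma phi_wt_gt0 a b : 0 < a -> 0 < b -> 0 < phi_wt p a b.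
Proof.
move=> a0 b0; rewrite /phi_wt divr_gt0 ?mulr_gt0 ?powR_gt0//.
by rewrite theta_gt0 ?powR_gt0.
Qed.

(** The transport inequality along [sigma + e Gam sigma 1 X], to second order in
    [e]. Nearly optimal curves have energy of order [e ^+ 2], hence remain in a
    ball of radius of order [e] where the metric is almost that of [sigma]. *)
Lemma poincare_herm X : X^t* = X -> \tr (sigma *m X) = 0 ->
  2 / c * complex.Re (hs X (SM (phi_wt p) X)) <=
  complex.Re (hs (dualA sigma p X) (D sigma (dualA sigma p X))).
Proof.
move=> hX trX; pose Q := complex.Re (hs X (SM (phi_wt p) X)).
pose A := dualA sigma p X; pose DA := complex.Re (hs A (D sigma A)).
rewrite -/Q -/A -/DA; pose nu := Gam sigma 1 X.
have Q0 : 0 <= Q.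
  apply: Re_ge0; apply: (mxfun2_form_ge0 _ pdS.1 pdS.1) => i k.
  by apply: phi_wt_gt0; exact: pdS.2.
have Anu : complex.Re (hs A nu) = Q.
  rewrite /nu (hs_Gam pdS) (Gam_dualA pdS p1) hsC /Q.
  by case: (hs X _).
suff : forall eta, 0 < eta -> c * Q / 2 <= c ^+ 2 / 4 * DA + eta.
  move=> /ler_addgt0Pr h; rewrite mulrAC ler_pdivrMr//.
  rewrite -(@ler_pM2l _ (c / 4)) ?divr_gt0//.
  by rewrite (_ : c / 4 * (2 * Q) = c * Q / 2) 1?(_ : c / 4 * (DA * c) = c ^+ 2 / 4 * DA)//; field.
move=> eta0' eta0'_gt0; pose eta := eta0' / (c ^+ 2 / 4 + c + 1).
have k0 : 0 < c ^+ 2 / 4 + c + 1 by rewrite !addr_gt0// divr_gt0// exprn_gt0.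
have eta0 : 0 < eta by rewrite divr_gt0.
have -> : eta0' = eta * (c ^+ 2 / 4 + c + 1) by rewrite /eta divfK// gt_eqF.
have [del1 del10 hF] := Fp_expand fdS p1 hX trX eta0.
have [del2 del20 fdr] := perturb_full_density fdS hX trX.
have [del3 del30 hD] := Dop_cont fdS p1 V omega A eta0.
have [C C0 hC] := energy_displacement.
(* One [eta] comes from the entropy, the other leaves room for a curve whose
   energy is not optimal. *)
pose E1 := c * Q / 2 + c * eta + eta.
have E10 : 0 < E1.
  have ce0 : 0 < c * eta by rewrite mulr_gt0.
  have cQ0 : 0 <= c * Q / 2 by rewrite divr_ge0// mulr_ge0// ltW.
  by rewrite /E1 ltr_wpDl// addr_ge0// ltW.
pose K := (n * n)%:R * Num.sqrt (C * E1) + N1 nu + 1.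
have K0 : 0 < K by rewrite ltr_wpDl// addr_ge0 ?N1_ge0// mulr_ge0// sqrtr_ge0.
pose e := Num.min del1 (Num.min del2 (del3 / K)) / 2.
have m0 : 0 < Num.min del1 (Num.min del2 (del3 / K)).
  by rewrite !lt_min del10 del20 divr_gt0.
have e0 : 0 < e by rewrite divr_gt0.
have em : e < Num.min del1 (Num.min del2 (del3 / K)).
  by rewrite /e ltr_pdivrMr// mulr_natr mulr2n ltrDl.
move: em; rewrite !lt_min => /andP[e1 /andP[e2 e3]].
have he1 : 0 < e < del1 by rewrite e0.
have he2 : 0 < e < del2 by rewrite e0.
have {}hF := hF e he1; have {}fdr := fdr e he2.
have {}hF : c * Fp p sigma (sigma + e%:C *: nu) < e ^+ 2 * E1.
  apply: (@le_lt_trans _ _ (c * (e ^+ 2 * (Q / 2 + eta)))); first by rewrite ler_pM2l.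
  rewrite mulrCA ltr_pM2l ?exprn_gt0// /E1 mulrDr mulrA.
  by rewrite ltrDl.
have E0 : 0 < e ^+ 2 * E1 by rewrite mulr_gt0// exprn_gt0.
have [gamma [smG fdG g0 g1] hE] := transport_curve fdr hF E0.
have close s : 0 <= s <= 1 -> N1 (gamma s - sigma) < del3.
  move=> s01; have := hC gamma _ smG fdG hE s s01.
  rewrite mulrCA sqrtrM ?sqr_ge0// sqrtr_sqr gtr0_norm// => h.
  have -> : gamma s - sigma = (gamma s - gamma 0) + e%:C *: nu.
    by rewrite g0 opprD addrA subrK.
  rewrite (le_lt_trans (N1D _ _))// N1Z normc_real gtr0_norm//.
  apply: (@le_lt_trans _ _ (e * K)); last by rewrite -ltr_pdivlMr.
  rewrite /K; move: h; move: (N1 _) (N1 nu) (n * n)%:R (Num.sqrt _) => x y z w h.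
  by rewrite mulrDr mulr1 mulrDr mulrCA; lra.
(* The factor c / 2 maximizes the resulting quadratic lower bound in the
   extremal case; the sign is that of the displacement from the perturbed
   density back to [sigma]. *)
pose A' := (- (c / 2 * e))%:C *: A.
have A'E rho : complex.Re (hs A' (D rho A')) = (c / 2 * e) ^+ 2 * complex.Re (hs A (D rho A)).
  have DZ : D rho A' = (- (c / 2 * e))%:C *: D rho A.
    exact: DopZ.
  by rewrite DZ /A' hsZl hsZr Re_scale2 sqrrN.
have hM s : 0 <= s <= 1 -> complex.Re (hs A' (D (gamma s) A')) <=
    (c / 2 * e) ^+ 2 * (DA + eta).
  move=> s01; rewrite A'E ler_wpM2l ?sqr_ge0//.
  by apply: hD; [exact: fdG|exact: close].
have := le_trans (energy_ge smG fdG ltr01 (lexx 1) hM) hE.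
rewrite lee_fin g0 g1 opprD addrA subrr sub0r.
have -> : complex.Re (hs A' (- (e%:C *: nu))) = c / 2 * e ^+ 2 * Q.
  have -> : - (e%:C *: nu) = (- e)%:C *: nu by rewrite rmorphN scaleNr.
  rewrite -Anu /A' hsZl hsZr; case: (hs A nu) => a b /=.
  by ring.
rewrite mulr1 => h.
have {}h : e ^+ 2 * (c * Q - (c ^+ 2 / 4) * (DA + eta)) <= e ^+ 2 * E1.
  by apply: le_trans h; rewrite le_eqVlt; apply/orP; left; apply/eqP; field.
move: h; rewrite ler_pM2l ?exprn_gt0// /E1.
by rewrite !mulrDr mulr1 [c ^+ 2 / 4 * eta]mulrC [c * eta]mulrC; lra.
Qed.

End Transport.
End EnergyBounds.

(** * From Hermitian to arbitrary matrices *)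

Section Polarization.
Variables (R : realType) (n : nat) (G : 'M[R[i]]_n -> 'M[R[i]]_n).
Hypothesis GD : forall X Y, G (X + Y) = G X + G Y.
Hypothesis GZ : forall a X, G (a *: X) = a *: G X.
Hypothesis Gsym : forall X Y, hs X (G Y) = hs (G X) Y.
Hypothesis Gadj : forall X, (G X)^t* = G (X^t*).

(** The cross terms cancel because the form is real, hence symmetric, on
    Hermitian matrices. *)
Lemma form_cartesian Y1 Y2 : Y1^t* = Y1 -> Y2^t* = Y2 ->
  hs (Y1 + 'i%C *: Y2) (G (Y1 + 'i%C *: Y2)) =
  (complex.Re (hs Y1 (G Y1)) + complex.Re (hs Y2 (G Y2)))%:C.
Proof.
move=> h1 h2; have hG Y : Y^t* = Y -> (G Y)^t* = G Y by move=> hY; rewrite Gadj hY.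
have hsZi (A B : 'M[R[i]]_n) : hs ('i%C *: A) B = - 'i%C * hs A B.
  rewrite hsC hsZr rmorphM /= -hsC; congr (_ * _).
  by apply/eqP; rewrite eq_complex /= oppr0 !eqxx.
rewrite GD GZ hsDl !hsDr !hsZi !hsZr.
rewrite [RHS]rmorphD /= -(hs_herm_real h1 (hG _ h1)) -(hs_herm_real h2 (hG _ h2)).
have -> : hs Y2 (G Y1) = hs Y1 (G Y2).
  by rewrite Gsym hsC (hs_herm_real h1 (hG _ h2)) conjR.
have ii : - 'i%C * 'i%C = 1 :> R[i] by rewrite mulNr -expr2 sqr_i opprK.
have -> : - 'i%C * ('i%C * hs Y2 (G Y2)) = hs Y2 (G Y2) by rewrite mulrA ii mul1r.
by ring.
Qed.

End Polarization.

(** Centering survives the decomposition into Hermitian and anti-Hermitian parts. *)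
Lemma cartesian (R : realType) n (Y : 'M[R[i]]_n) : exists Y1 Y2,
  [/\ Y1^t* = Y1, Y2^t* = Y2, Y = Y1 + 'i%C *: Y2 &
      forall S : 'M[R[i]]_n, S^t* = S -> \tr (S *m Y) = 0 ->
        \tr (S *m Y1) = 0 /\ \tr (S *m Y2) = 0].
Proof.
have ci : ('i%C : R[i])^*%R = - 'i%C by apply/eqP; rewrite eq_complex /= oppr0 !eqxx.
have ii : 'i%C * 'i%C = -1 :> R[i] by rewrite -expr2 sqr_i.
pose Y1 := 2^-1%:C *: (Y + Y^t*); pose Y2 := 2^-1%:C *: (- 'i%C *: (Y - Y^t*)).
have i2 : (2^-1%:C : R[i]) + 2^-1%:C = 1.
  by rewrite -rmorphD -(rmorph1 (real_complex R)); congr (_%:C); field.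
exists Y1, Y2; split.
- by rewrite /Y1 adjZ adjD trmxCK addrC.
- rewrite /Y2 adjZ; congr (_ *: _).
  rewrite linearZ /= map_mxZ -[_ ^ _]/((Y - Y^t*)^t*) adjB trmxCK.
  transitivity ('i%C *: (Y^t* - Y)); last by rewrite scaleNr -scalerN opprB.
  by congr (_ *: _); rewrite rmorphN; apply/eqP; rewrite eq_complex /= oppr0 opprK !eqxx.
- have ihi : 'i%C * 2^-1%:C * - 'i%C = 2^-1%:C :> R[i].
    by rewrite mulrAC mulrN ii opprK mul1r.
  rewrite /Y1 /Y2 !scalerA ihi -scalerDr addrACA subrr addr0.
  by rewrite scalerDr -scalerDl i2 scale1r.
move=> S hS trY.
have trY' : \tr (S *m Y^t*) = 0.
  have -> : S *m Y^t* = (Y *m S)^t* by rewrite adjM hS.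
  by rewrite trace_map_mx mxtrace_tr mxtrace_mulC trY rmorph0.
split; first by rewrite /Y1 -scalemxAr mxtraceZ mulmxDr mxtraceD trY trY' addr0 mulr0.
rewrite /Y2 -!scalemxAr !mxtraceZ mulmxBr linearB /= trY trY' subrr !mulr0//.
Qed.

Theorem proposition4p21 (R : realType) (d : nat)
    (P : R -> {linear 'M[R[i]]_d -> 'M[R[i]]_d})
    (L : {linear 'M[R[i]]_d -> 'M[R[i]]_d}) (sigma : 'M[R[i]]_d)
    (J : nat) (V : 'I_J -> 'M[R[i]]_d) (omega : 'I_J -> R) (p c : R)
    (qmsP : is_qms P) (genL : is_generator P L) (primP : primitive P sigma)
    (gnsL : gns_detailed_balance L sigma) (alickiL : alicki L sigma V omega)
    (p_gt1 : 1 < p) (p_le2 : p <= 2) (c_gt0 : 0 < c)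
    (transport : forall rho : 'M[R[i]]_d, density rho ->
      (W2 p sigma V omega rho sigma <= (Num.sqrt (c * Fp p sigma rho))%:E)%E) :
  exists2 lambda : R, 2 / c <= lambda &
    forall X : 'M[R[i]]_d,
      lambda%:C * sqnorm_phi p sigma (X - (\tr (sigma *m X)) *: 1%:M)
        <= - inner_phi p sigma X (L X).
Proof.
have fdS : full_density sigma by case: primP => [[dS _] _ rkS].
have pdS := full_density_pd fdS.
exists (2 / c) => // X; set Y := X - _.
pose S := mxfun2 (phi_wt p) sigma sigma.
pose D := Dop p sigma V omega sigma; pose T := dualA sigma p.
pose G Z := T (D (T Z)).
have trY : \tr (sigma *m Y) = 0.
  by rewrite /Y mulmxBr linearB /= -scalemxAr mulmx1 mxtraceZ fdS.1.2 mulr1 subrr.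
have LY : L X = L Y.
  have L1 : L 1%:M = 0.
    rewrite (alickiE alickiL) big1// => j _.
    by rewrite {1}/comm mul1mx mulmx1 subrr mulmx0 comm_scalar mul0mx !scaler0 addr0.
  by rewrite /Y linearB linearZ /= L1 scaler0 subr0.
have DT Z : D (T Z) = - Gam sigma 1 (L Z) by exact: (Dop_dualA_generator pdS p_gt1 alickiL Z).
have hS Z Z' : hs Z (S Z') = hs (T Z) (Gam sigma 1 Z').
  rewrite (hs_mxfun2 _ _ _ pdS.1 pdS.1) -(Gam_dualA pdS p_gt1) hsC.
  by rewrite (hs_Gam pdS) -hsC.
have Tsym Z Z' : hs Z (T Z') = hs (T Z) Z' by exact: (hs_mxfun2 _ _ _ pdS.1 pdS.1).
have Dsym Z Z' : hs Z (D Z') = hs (D Z) Z' by exact: (@Dop_sym _ _ _ p fdS _ V omega _ fdS).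
have Tadj Z : (T Z)^t* = T (Z^t*).
  rewrite /T /dualA (mxfun2_adj _ _ pdS.1 pdS.1).
  by apply: (schur_ext pdS) => a b _ _; exact: dual_wtC.
have Dadj Z : (D Z)^t* = D (Z^t*) by exact: (@Dop_adj _ _ _ p fdS _ V omega L alickiL _ _ fdS).
have Sadj Z : (S Z)^t* = S (Z^t*).
  rewrite /S (mxfun2_adj _ _ pdS.1 pdS.1); apply: (schur_ext pdS) => a b _ _.
  by rewrite /phi_wt theta_sym [b `^ _ * _]mulrC.
have rhsE : - inner_phi p sigma X (L X) = hs Y (G Y).
  rewrite (inner_phiE pdS p_gt1) hS LY -hsNr -DT Dsym.
  by rewrite (DT X) LY -DT -Dsym -Tsym.
rewrite rhsE /sqnorm_phi (inner_phiE pdS p_gt1) -/(S Y).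
have [Y1 [Y2 [h1 h2 YE trE]]] := cartesian Y.
have hsig : sigma^t* = sigma by exact: (proj1 (hermP _) pdS.1).
have [tr1 tr2] := trE sigma hsig trY.
have GD Z Z' : G (Z + Z') = G Z + G Z'.
  have DD A B : D (A + B) = D A + D B.
    by have := @Dop_linear R d sigma p J V omega sigma 1 A B; rewrite !scale1r.
  by rewrite /G /T /dualA mxfun2D DD mxfun2D.
have GZ a Z : G (a *: Z) = a *: G Z.
  have DZ A : D (a *: A) = a *: D A by exact: DopZ.
  by rewrite /G /T /dualA mxfun2Z DZ mxfun2Z.
have Gsym Z Z' : hs Z (G Z') = hs (G Z) Z' by rewrite Tsym Dsym Tsym.
have Gadj Z : (G Z)^t* = G (Z^t*) by rewrite /G Tadj Dadj Tadj.
rewrite YE (form_cartesian GD GZ Gsym Gadj h1 h2).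
rewrite (@form_cartesian _ _ S (mxfun2D _ _ _) (mxfun2Z _ _ _) _ Sadj _ _ h1 h2); last first.
  by move=> Z Z'; exact: (hs_mxfun2 _ _ _ pdS.1 pdS.1).
have GT Z : hs Z (G Z) = hs (T Z) (D (T Z)) by exact: Tsym.
have herm := poincare_herm fdS p_gt1 p_le2 alickiL qmsP genL primP c_gt0 transport.
rewrite -rmorphM lecR mulrDr (GT Y1) (GT Y2).
by apply: lerD; apply: herm.
Qed.
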